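(* Let $(\alpha,\theta)\in(0,1)\times\mathbb{R}^+$ and let $\eta$ be a probability measure on $\mathbb{R}^+$ with $\int x^\alpha\eta(dx)<\infty$. Then for any $t\in\Theta_{\alpha,\eta}$, $$\Delta_{\alpha,\theta}(t)=\frac{1}{\pi[\zeta_\alpha^2(t)+\gamma_\alpha^2(t)]^{\theta/(2\alpha)}}\sin(\rho_{\alpha,\theta}(t)).$$
   Context: $\Theta_{\alpha,\eta}=\{y\in\mathbb{R}^+:\int|y-t|^{\alpha-1}\eta(dt)<\infty\}\cap C_\eta$, $C_\eta$ the convex hull of the support of $\eta$. $\tilde P_{\alpha,\theta}=\sum_kW_k\delta_{Z_k}$ with $V_k$ independent $\mathrm{Beta}(1-\alpha,\theta+k\alpha)$, $W_1=V_1$, $W_k=V_k\prod_{j<k}(1-V_j)$, $Z_k$ i.i.d. $\eta$ independent of $(V_k)$; $M_{\alpha,\theta}(\eta)=\int x\,\tilde P_{\alpha,\theta}(dx)$. $\mathcal S_\theta[z;X]=\mathbb{E}[(z+X)^{-\theta}]$ (principal branch, $|\arg z|<\pi$) and $\Delta_{\alpha,\theta}(t)=\frac{1}{2\pi i}\lim_{\varepsilon\downarrow0}\{\mathcal S_\theta[-t-i\varepsilon;M_{\alpha,\theta}(\eta)]-\mathcal S_\theta[-t+i\varepsilon;M_{\alpha,\theta}(\eta)]\}$. $\mathcal A^+_{\eta,d}(t)=\int_{(t,\infty)}(x-t)^d\eta(dx)$, $\mathcal A_{\eta,d}(t)=\int_{[0,t)}(t-x)^d\eta(dx)$, $\gamma_\alpha(t)=\cos(\alpha\pi)\mathcal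 A_{\eta,\alpha}(t)+\mathcal A^+_{\eta,\alpha}(t)$, $\zeta_\alpha(t)=\sin(\alpha\pi)\mathcal A_{\eta,\alpha}(t)$, $\Gamma_\alpha=\{t\in\mathbb{R}^+:\gamma_\alpha(t)<0\}$, and $\rho_{\alpha,\theta}(t)=\frac{\theta}{\alpha}\arctan\frac{\zeta_\alpha(t)}{\gamma_\alpha(t)}+\frac{\pi\theta}{\alpha}\mathbb{I}_{\Gamma_\alpha}(t)$. *)

(* Defs.v *)
From HB Require Import structures.
From mathcomp Require Import all_boot all_order all_algebra.
From mathcomp Require Import all_classical all_reals all_analysis.
From mathcomp Require Import complex.
Import Order.TTheory GRing.Theory Num.Theory.
Import numFieldNormedType.Exports.
Set Implicit Arguments. Unset Strict Implicit. Unset Printing Implicit Defensive.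
Local Open Scope ring_scope.
Local Open Scope classical_set_scope.

Section Defs.
Context {R : realType}.

Definition mutually_independent {d} {T : measurableType d}
    (P : probability T R) {I : eqType} (X : I -> T -> R) : Prop :=
  forall (s : seq I) (B : I -> set R), uniq s -> (forall i, measurable (B i)) ->
  P (\bigcap_(i in [set i | i \in s]) (X i @^-1` B i)) =
  (\prod_(i <- s) P (X i @^-1` B i))%E.

Definition beta_kernel (a b x : R) : R := x `^ (a - 1) * (1 - x) `^ (b - 1).
Definition beta_const (a b : R) : R :=
  Rintegral lebesgue_measure `]0, 1[ (beta_kernel a b).
Definition beta_law (a b : R) (A : set R) : \bar R :=
  (\int[lebesgue_measure]_(x in A `&` `]0%R, 1%R[)
     (beta_kernel a b x / beta_const a b)%:E)%E.

Definition stick {T : Type} (V : nat -> T -> R) (k : nat) (w : T) : R :=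
  V k w * \prod_(j < k) (1 - V j w).

Definition py_mean {T : Type} (V Z : nat -> T -> R) (w : T) : R :=
  limn (fun n => \sum_(k < n) stick V k w * Z k w).

Definition msupport (eta : probability R R) : set R :=
  [set x | forall r : R, 0 < r -> (0 < eta (ball x r))%E].

Definition convex_hull (S : set R) : set R :=
  [set y | forall C : set R,
     (forall a b z, C a -> C b -> a <= z <= b -> C z) -> S `<=` C -> C y].

(* |y - t|^(alpha-1), equal to +oo at t = y (alpha - 1 < 0) *)
Definition sing_kernel (alpha y t : R) : \bar R :=
  if t == y then +oo%E else (`|y - t| `^ (alpha - 1))%:E.

Definition Theta_set (alpha : R) (eta : probability R R) : set R :=
  [set y | 0 <= y /\ (\int[eta]_t sing_kernel alpha y t < +oo)%E]
  `&` convex_hull (msupport eta).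

Definition cmod (w : R[i]) : R := Num.sqrt (complex.Re w ^+ 2 + complex.Im w ^+ 2).

Definition parg (w : R[i]) : R :=
  xget 0 [set phi | -pi < phi <= pi /\
            complex.Re w = cmod w * cos phi /\ complex.Im w = cmod w * sin phi].

Definition cpowr (w : R[i]) (s : R) : R[i] :=
  Complex (cmod w `^ s * cos (s * parg w)) (cmod w `^ s * sin (s * parg w)).

Definition stieltjes {d} {T : measurableType d} (P : probability T R)
    (theta : R) (z : R[i]) (X : T -> R) : R[i] :=
  Complex (Rintegral P setT (fun w => complex.Re (cpowr (z + Complex (X w) 0) (- theta))))
          (Rintegral P setT (fun w => complex.Im (cpowr (z + Complex (X w) 0) (- theta)))).

(* the quantity whose limit as eps -> 0+ is Delta_{alpha,theta}(t) *)
Definition Delta_quot {d} {T : measurableType d} (P : probability T R)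
    (theta : R) (X : T -> R) (t eps : R) : R[i] :=
  (Complex 0 (2 * pi))^-1 *
  (stieltjes P theta (Complex (- t) (- eps)) X -
   stieltjes P theta (Complex (- t) eps) X).

Definition A_minus (eta : probability R R) (d t : R) : R :=
  Rintegral eta `[0, t[ (fun x => (t - x) `^ d).
Definition A_plus (eta : probability R R) (d t : R) : R :=
  Rintegral eta `]t, +oo[ (fun x => (x - t) `^ d).
Definition gamma_fn (eta : probability R R) (alpha t : R) : R :=
  cos (alpha * pi) * A_minus eta alpha t + A_plus eta alpha t.
Definition zeta_fn (eta : probability R R) (alpha t : R) : R :=
  sin (alpha * pi) * A_minus eta alpha t.

(* arctan(a / b), extended by continuity (+-pi/2) when b = 0 *)
Definition atan_div (a b : R) : R :=
  if b == 0 then (if 0 < a then pi / 2 else if a < 0 then - (pi / 2) else 0)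
  else atan (a / b).

Definition rho_fn (eta : probability R R) (alpha theta t : R) : R :=
  theta / alpha * atan_div (zeta_fn eta alpha t) (gamma_fn eta alpha t)
  + (if gamma_fn eta alpha t < 0 then pi * theta / alpha else 0).

End Defs.

(* Main.v *)
(* The heart is the identity E (z + M)^-theta = (Phi z)^(-theta/alpha) for Im z > 0, where
   Phi z = E (z + Z_0)^alpha = \int (z + x)^alpha eta(dx).

   For V and Z bounded, let M_n be the mean built from the sticks n, n+1, ..., so that
   M_n = V_n Z_n + (1 - V_n) M_{n+1} with independent V_n, Z_n, M_{n+1}, and put theta_n = theta + n alpha.
   Mixing over V_n by the beta identity E (b + V s)^-(p+q) = (b + s)^-p b^-q shows that
   f_n z = E (z + M_n)^-theta_n satisfies f_n' = -theta_n E (z + Z_0)^(alpha-1) f_{n+1}. The functions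
   g_n = Phi^(-theta_n/alpha) satisfy the same infinite hierarchy. The differences h_n = f_n - g_n vanish
   because they decay as Re z -> oo and are dominated by explicit positive solutions of the majorant
   hierarchy that can be taken arbitrarily small; first for large Re z, then along each horizontal line.

   Truncating Z at m and letting m -> oo gives the identity for the extended mean, with
   (z + M)^-theta read as 0 where M = oo; letting z -> oo shows that M is almost surely finite.

   Finally, as eps -> 0+, Phi(-t + i eps) tends to gamma_alpha(t) + i zeta_alpha(t), which is nonzero because
   the integrability of |t - x|^(alpha-1) prevents eta from having an atom at t; its argument is
   alpha rho(t) / theta. *)

Require Import Defs.
From HB Require Import structures.
From mathcomp Require Import all_boot all_order all_algebra.
From mathcomp Require Import all_classical all_reals all_analysis.
From mathcomp Require Import complex.
From mathcomp Require Import measurable_realfun ring lra.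
Import Order.TTheory GRing.Theory Num.Theory.
Import numFieldNormedType.Exports.
Set Implicit Arguments. Unset Strict Implicit. Unset Printing Implicit Defensive.
Local Open Scope ring_scope.
Local Open Scope classical_set_scope.
Local Open Scope complex_scope.

(** * Complex powers *)

(** The parameters fit because $(1-\alpha)+\theta_{n+1}=\theta_n+1$: one differentiation of
    $(z+M_n)^{-\theta_n}$ produces exactly the exponent for which mixing over $V_n$ separates $Z_n$
    from $M_{n+1}$. The price is that level $n$ always calls level $n+1$: the system never closes,
    and uniqueness has to come from controlling all levels at once. Put $p_n=\theta_n/\alpha$, so
    that $p_{n+1}=p_n+1$. Then $(v^{-p_n})'=-p_n v' v^{-p_{n+1}}$ for every positive $v$, so as soon
    as $v'$ dominates $\alpha|E(z+Z_0)^{\alpha-1}|$ the powers $v^{-p_n}$ solve the majorant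
    hierarchy exactly. A crude bound $2c^{-p_N}$ on $h_N$ with $c>v$ is beaten by $k v^{-p_N}$ for
    large $N$, however small $k$ is, and this descends to every lower level. Only curves with a real
    parameter inside the open upper half-plane are differentiated, so real calculus by coordinates
    suffices; the lower half-plane is reached by conjugation. *)

Section ComplexPower.
Context {R : realType}.
Implicit Types (w : R[i]) (s r : R).

Lemma cReD w w' : complex.Re (w + w') = complex.Re w + complex.Re w'.
Proof. by case: w w' => ? ? []. Qed.

Lemma cImD w w' : complex.Im (w + w') = complex.Im w + complex.Im w'.
Proof. by case: w w' => ? ? []. Qed.

Lemma cReN w : complex.Re (- w) = - complex.Re w.
Proof. by case: w. Qed.

Lemma cImN w : complex.Im (- w) = - complex.Im w.
Proof. by case: w. Qed.

Lemma cReM w w' : complex.Re (w * w') =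
  complex.Re w * complex.Re w' - complex.Im w * complex.Im w'.
Proof. by case: w w' => ? ? []. Qed.

Lemma cImM w w' : complex.Im (w * w') =
  complex.Re w * complex.Im w' + complex.Im w * complex.Re w'.
Proof. by case: w w' => ? ? []. Qed.

Lemma eq_ReIm w w' : complex.Re w = complex.Re w' -> complex.Im w = complex.Im w' ->
  w = w'.
Proof. by case: w w' => ? ? [? ?] /= -> ->. Qed.

Lemma cmodE w : cmod w = ComplexField.Normc.normc w.
Proof. by case: w. Qed.

Lemma cmod_ge0 w : 0 <= cmod w.
Proof. exact: sqrtr_ge0. Qed.

Lemma cmodM w w' : cmod (w * w') = cmod w * cmod w'.
Proof. by rewrite !cmodE ComplexField.Normc.normcM. Qed.

Lemma cmodN w : cmod (- w) = cmod w.
Proof. by rewrite !cmodE normcN. Qed.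

Lemma cmodB w w' : cmod (w - w') = cmod (w' - w).
Proof. by rewrite -cmodN opprB. Qed.

Lemma ler_cmodD w w' : cmod (w + w') <= cmod w + cmod w'.
Proof. by rewrite !cmodE le_normcD. Qed.

Lemma ler_cmodB w w' : cmod (w - w') <= cmod w + cmod w'.
Proof. by rewrite -(cmodN w') ler_cmodD. Qed.

Lemma cmod0 : cmod (0 : R[i]) = 0.
Proof. by rewrite /cmod/= expr0n addr0 sqrtr0. Qed.

Lemma cmod_eq0 w : (cmod w == 0) = (w == 0).
Proof.
apply/eqP/eqP => [|->]; last exact: cmod0.
by rewrite cmodE => /ComplexField.Normc.eq0_normc.
Qed.

Lemma cmod_gt0 w : (0 < cmod w) = (w != 0).
Proof. by rewrite lt_def cmod_eq0 cmod_ge0 andbT. Qed.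

Lemma cmod_real r : cmod r%:C = `|r|.
Proof. by rewrite /cmod/= expr0n addr0 sqrtr_sqr. Qed.

Lemma cmod_sqr w : cmod w ^+ 2 = complex.Re w ^+ 2 + complex.Im w ^+ 2.
Proof. by rewrite sqr_sqrtr// addr_ge0// sqr_ge0. Qed.

Lemma normr_Re_le w : `|complex.Re w| <= cmod w.
Proof.
by rewrite -ler_sqr ?nnegrE ?cmod_ge0// cmod_sqr real_normK ?num_real// lerDl sqr_ge0.
Qed.

Lemma normr_Im_le w : `|complex.Im w| <= cmod w.
Proof.
by rewrite -ler_sqr ?nnegrE ?cmod_ge0// cmod_sqr real_normK ?num_real// lerDr sqr_ge0.
Qed.

Lemma cmod_conj w : cmod w^* = cmod w.
Proof. by case: w => a b; rewrite /cmod/= sqrrN. Qed.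

Definition cpolar (r phi : R) : R[i] := Complex (r * cos phi) (r * sin phi).

Lemma cpolarM r r' a b : cpolar r a * cpolar r' b = cpolar (r * r') (a + b).
Proof.
by rewrite /cpolar cosD sinD; apply/eqP; rewrite eq_complex /=; apply/andP; split; apply/eqP; ring.
Qed.

Lemma cmod_cpolar r a : 0 <= r -> cmod (cpolar r a) = r.
Proof.
by move=> r0; rewrite /cmod/= !exprMn -mulrDr cos2Dsin2 mulr1 sqrtr_sqr ger0_norm.
Qed.

Lemma conj_cpolar r a : (cpolar r a)^* = cpolar r (- a).
Proof. by rewrite /cpolar cosN sinN mulrN. Qed.

(** With $b\le a$ the half-difference lies in $[0,\pi)$; $\cos(a-b)=1$ makes its sine vanish, hence
    the half-difference itself. *)
Lemma eq_angle (a b : R) : -pi < a <= pi -> -pi < b <= pi ->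
  cos a = cos b -> sin a = sin b -> a = b.
Proof.
wlog ab : a b / b <= a.
  move=> H Ha Hb c s; have [ba|ab] := leP b a; first exact: H.
  by apply/esym/H => //; exact: ltW.
move=> /andP[a1 a2] /andP[b1 b2] cab sab; apply/eqP; rewrite eq_le ab andbT leNgt.
apply/negP => ba; have : 0 < sin ((a - b) / 2) by apply: sin_gt0_pi; lra.
suff : sin ((a - b) / 2) ^+ 2 = 0 by move=> /eqP; rewrite sqrf_eq0 => /eqP ->; rewrite ltxx.
have : cos (((a - b) / 2) *+ 2) = 1.
  by rewrite -mulr_natr mulfVK ?pnatr_eq0// cosB cab sab -!expr2 cos2Dsin2.
by rewrite cos_mulr2n cos2sin2 => h; lra.
Qed.

(** [parg] is a choice from a set: the angle itself is a member, and [eq_angle] leaves no other. *)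
Lemma parg_cpolar r a : 0 < r -> -pi < a <= pi -> parg (cpolar r a) = a.
Proof.
move=> r0 api; have cr := cmod_cpolar a (ltW r0).
rewrite /parg; case: xgetP => [phi _ /= [phipi]|/(_ a)/=].
  rewrite cr => -[/(mulfI (lt0r_neq0 r0)) h1 /(mulfI (lt0r_neq0 r0)) h2].
  by apply: eq_angle.
by rewrite cr; elim.
Qed.

(** The argument on the open upper half-plane. Dividing by the imaginary part gives a single formula
    that is smooth there, also across the imaginary axis. *)
Definition uarg w : R := pi / 2 - atan (complex.Re w / complex.Im w).

Lemma uarg_gt0 w : 0 < uarg w.
Proof. by rewrite /uarg; have := atan_ltpi2 (complex.Re w / complex.Im w); lra. Qed.

Lemma uarg_ltpi w : uarg w < pi.
Proof. by rewrite /uarg; have := atan_gtNpi2 (complex.Re w / complex.Im w); lra. Qed.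

Lemma cpolar_uarg w : 0 < complex.Im w -> w = cpolar (cmod w) (uarg w).
Proof.
case: w => u v /= v0; rewrite /cpolar /uarg /=; set th := atan _.
have cth : cmod (u +i* v) * cos th = v.
  rewrite cos_atan /cmod/=.
  have -> : u ^+ 2 + v ^+ 2 = v ^+ 2 * (1 + (u / v) ^+ 2) by field; rewrite gt_eqF.
  rewrite sqrtrM ?sqr_ge0// sqrtr_sqr gtr0_norm// mulfK//.
  by rewrite gt_eqF// sqrtr_gt0 ltr_wpDr// sqr_ge0.
have sth : cmod (u +i* v) * sin th = u.
  have : tan th = u / v by rewrite atanK.
  have c0 : cos th != 0 by apply: contraTneq v0 => h; rewrite -cth h mulr0 ltxx.
  rewrite /tan => /(congr1 (fun x => x * v)); rewrite divfK ?gt_eqF// => suv.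
  apply: (mulIf c0); rewrite mulrAC cth; apply: (mulIf c0).
  by rewrite -[u in RHS]suv; field.
by rewrite -opprB cosN sinN cosBpihalf sinBpihalf opprK cth sth.
Qed.

Lemma Im_neq0 w : 0 < complex.Im w -> w != 0.
Proof. by apply: contraTneq => -> /=; rewrite ltxx. Qed.

Lemma parg_upper w : 0 < complex.Im w -> parg w = uarg w.
Proof.
move=> w0; rewrite {1}(cpolar_uarg w0) parg_cpolar ?cmod_gt0 ?Im_neq0//.
by rewrite ltW ?uarg_ltpi// andbT; have := uarg_gt0 w; have := @pi_gt0 R; lra.
Qed.

Lemma cpowrE w s : cpowr w s = cpolar (cmod w `^ s) (s * parg w).
Proof. by []. Qed.

Lemma cmod_cpowr w s : cmod (cpowr w s) = cmod w `^ s.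
Proof. by rewrite cpowrE cmod_cpolar// powR_ge0. Qed.

Lemma cpowrD w s r : w != 0 -> cpowr w (s + r) = cpowr w s * cpowr w r.
Proof.
by move=> w0; rewrite !cpowrE cpolarM mulrDl powRD// cmod_eq0 w0 implybT.
Qed.

Lemma cpowr0 w : cpowr w 0 = 1.
Proof. by rewrite cpowrE powRr0 mul0r /cpolar cos0 sin0 mulr1 mulr0. Qed.

Lemma cpowr_neq0 w s : w != 0 -> cpowr w s != 0.
Proof. by move=> w0; rewrite -cmod_gt0 cmod_cpowr powR_gt0// cmod_gt0. Qed.

Lemma cpowrN w s : w != 0 -> cpowr w (- s) = (cpowr w s)^-1.
Proof.
move=> w0; apply: (mulfI (cpowr_neq0 s w0)).
by rewrite -cpowrD// subrr cpowr0 divff// cpowr_neq0.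
Qed.

Lemma cpowr1 w : 0 < complex.Im w -> cpowr w 1 = w.
Proof.
by move=> w0; rewrite cpowrE parg_upper// powRr1 ?cmod_ge0// mul1r -cpolar_uarg.
Qed.

Lemma cpowrB1 w s : 0 < complex.Im w -> cpowr w (s - 1) = cpowr w s / w.
Proof.
by move=> w0; rewrite cpowrD ?Im_neq0// cpowrN ?Im_neq0// cpowr1.
Qed.

Lemma cpolar_Im r a : 0 < r -> 0 < a < pi -> 0 < complex.Im (cpolar r a).
Proof. by move=> r0 a0; rewrite /= mulr_gt0// sin_gt0_pi. Qed.

Lemma cpowr_Im w a : 0 < complex.Im w -> 0 < a < 1 -> 0 < complex.Im (cpowr w a).
Proof.
move=> w0 /andP[a0 a1]; rewrite cpowrE; apply: cpolar_Im.
  by rewrite powR_gt0// cmod_gt0 Im_neq0.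
rewrite parg_upper// mulr_gt0 ?uarg_gt0//=.
by rewrite (lt_trans _ (uarg_ltpi w))// gtr_pMl// uarg_gt0.
Qed.

Lemma parg_cpowr w a : 0 < complex.Im w -> 0 < a < 1 -> parg (cpowr w a) = a * parg w.
Proof.
move=> w0 /andP[a0 a1]; rewrite cpowrE parg_cpolar//.
  by rewrite powR_gt0// cmod_gt0 Im_neq0.
have h1 : 0 < a * parg w by rewrite mulr_gt0// parg_upper// uarg_gt0.
have ? := @pi_gt0 R.
have h2 : a * parg w < pi.
  by rewrite (lt_trans _ (uarg_ltpi w))// parg_upper// gtr_pMl// uarg_gt0.
by apply/andP; split=> //; lra.
Qed.

(** For $0<a<1$ the angle $a\arg w$ stays in $(0,\pi)$, so no branch is crossed and the outer
    exponent may be arbitrary. *)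
Lemma cpowrM w a s : 0 < complex.Im w -> 0 < a < 1 ->
  cpowr (cpowr w a) s = cpowr w (a * s).
Proof.
move=> w0 a1; rewrite [LHS]cpowrE cmod_cpowr parg_cpowr// cpowrE powRrM.
by congr cpolar; ring.
Qed.

Lemma cpowr_conj w s : 0 < complex.Im w -> cpowr w^* s = (cpowr w s)^*.
Proof.
move=> w0; rewrite !cpowrE conj_cpolar cmod_conj; congr cpolar.
rewrite -mulrN; congr (_ * _).
rewrite {1}(cpolar_uarg w0) conj_cpolar parg_cpolar ?parg_upper ?cmod_gt0 ?Im_neq0//.
have := uarg_gt0 w; have := uarg_ltpi w; have := @pi_gt0 R; lra.
Qed.

End ComplexPower.

(** * Calculus of complex-valued curves with a real parameter *)

Section Curves.
Context {R : realType}.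
Implicit Types (c e : R -> R[i]) (x a b s : R).

Definition cderive x c (d : R[i]) :=
  is_derive x 1 (fun t => complex.Re (c t)) (complex.Re d) /\
  is_derive x 1 (fun t => complex.Im (c t)) (complex.Im d).

Lemma cderive_cst x (w : R[i]) : cderive x (fun=> w) 0.
Proof. by split; apply: is_derive_cst. Qed.

Lemma cderive_eq x c d d' : cderive x c d -> d = d' -> cderive x c d'.
Proof. by move=> ? <-. Qed.

Lemma cderive_ext x c c' d : c =1 c' -> cderive x c d -> cderive x c' d.
Proof. by move=> /funext ->. Qed.

Lemma cderiveD x c e d d' : cderive x c d -> cderive x e d' ->
  cderive x (fun t => c t + e t) (d + d').
Proof.
move=> [c1 c2] [e1 e2]; split.
  have := is_deriveD c1 e1; rewrite -cReD.
  by under [X in _ -> is_derive _ _ X _]eq_fun do rewrite cReD.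
have := is_deriveD c2 e2; rewrite -cImD.
by under [X in _ -> is_derive _ _ X _]eq_fun do rewrite cImD.
Qed.

Lemma cderiveN x c d : cderive x c d -> cderive x (fun t => - c t) (- d).
Proof.
move=> [c1 c2]; split.
  have := is_deriveN c1; rewrite -cReN.
  by under [X in _ -> is_derive _ _ X _]eq_fun do rewrite cReN.
have := is_deriveN c2; rewrite -cImN.
by under [X in _ -> is_derive _ _ X _]eq_fun do rewrite cImN.
Qed.

Lemma cderiveB x c e d d' : cderive x c d -> cderive x e d' ->
  cderive x (fun t => c t - e t) (d - d').
Proof. by move=> h1 h2; apply: cderiveD => //; apply: cderiveN. Qed.

Lemma cderiveM x c e d d' : cderive x c d -> cderive x e d' ->
  cderive x (fun t => c t * e t) (d * e x + c x * d').
Proof.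
move=> [c1 c2] [e1 e2]; split.
  under [X in is_derive _ _ X _]eq_fun do rewrite cReM.
  have h := is_deriveB (is_deriveM c1 e1) (is_deriveM c2 e2).
  by apply: is_derive_eq h _; rewrite cReD !cReM /GRing.scale/=; ring.
under [X in is_derive _ _ X _]eq_fun do rewrite cImM.
have h := is_deriveD (is_deriveM c1 e2) (is_deriveM c2 e1).
by apply: is_derive_eq h _; rewrite cImD !cImM /GRing.scale/=; ring.
Qed.

Lemma cderiveZ x c d (w : R[i]) : cderive x c d -> cderive x (fun t => w * c t) (w * d).
Proof.
move=> h; have := cderiveM (cderive_cst x w) h.
by move/cderive_eq; apply; rewrite mul0r add0r.
Qed.

Lemma cderive_real x (w : R[i]) : cderive x (fun t => w + t%:C) 1.
Proof.
split.
  under [X in is_derive _ _ X _]eq_fun do rewrite cReD.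
  by have := is_deriveD (is_derive_cst (complex.Re w) x 1) (is_derive_id x 1); rewrite add0r.
under [X in is_derive _ _ X _]eq_fun do rewrite cImD addr0.
exact: is_derive_cst.
Qed.

Lemma is_derive_continuous x (f : R -> R) df : is_derive x 1 f df -> {for x, continuous f}.
Proof. by move=> [h _]; apply/differentiable_continuous/derivable1_diffP. Qed.

Lemma cpowr_upperE (w : R[i]) s : 0 < complex.Im w ->
  cpowr w s = cpolar ((complex.Re w ^+ 2 + complex.Im w ^+ 2) `^ (s / 2))
     (s * uarg w).
Proof.
move=> w0; rewrite cpowrE parg_upper//; congr cpolar.
rewrite /cmod -powR12_sqrt ?addr_ge0 ?sqr_ge0// -powRrM; congr (_ `^ _).
by field.
Qed.

(** Near $x$ the curve stays in the upper half-plane, where the power has modulus $q^{s/2}$,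
    $q=u^2+v^2$, and angle [s * uarg]; both are differentiated as real functions. *)
Lemma cderive_cpowr x c d s : 0 < complex.Im (c x) -> cderive x c d ->
  cderive x (fun t => cpowr (c t) s) (s%:C * cpowr (c x) (s - 1) * d).
Proof.
move=> c0 [c1 c2].
have ce : \forall t \near x, cpowr (c t) s =
    cpolar ((complex.Re (c t) ^+ 2 + complex.Im (c t) ^+ 2) `^ (s / 2)) (s * uarg (c t)).
  have : \forall t \near x, 0 < complex.Im (c t).
    exact: (is_derive_continuous c2 (lt_nbhsr c0)).
  by apply: filterS => t t0; rewrite cpowr_upperE.
set u := fun t => complex.Re (c t) in c1 *.
set v := fun t => complex.Im (c t) in c2 *.
have v0 : v x != 0 by rewrite gt_eqF.
have vp : 0 < v x by [].
pose q := fun t => u t ^+ 2 + v t ^+ 2.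
have q0 : 0 < q x by rewrite /q ltr_wpDl ?sqr_ge0// exprn_gt0.
have dq : is_derive x 1 q (2 * (u x * complex.Re d + v x * complex.Im d)).
  have := is_deriveD (is_deriveX 2 c1) (is_deriveX 2 c2).
  move=> h; apply: is_derive_eq h _.
  by rewrite /GRing.scale/=; ring.
have dqs : is_derive x 1 (fun t => q t `^ (s / 2))
   (s * q x `^ (s / 2 - 1) * (u x * complex.Re d + v x * complex.Im d)).
  have := @is_derive1_comp _ (fun y => y `^ (s / 2)) q x _ _ (is_derive1_powR (s / 2) q0) dq.
  move=> h; apply: is_derive_eq h _.
  by field.
have dom : is_derive x 1 (fun t => uarg (c t))
   (- (complex.Re d * v x - u x * complex.Im d) / q x).
  have h1 := is_deriveM c1 (is_deriveV v0 c2).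
  have h2 := @is_derive1_comp _ atan _ x _ _ (is_derive1_atan _) h1.
  have := is_deriveB (is_derive_cst (pi / 2 : R) x 1) h2.
  move=> h; apply: is_derive_eq h _.
  rewrite (_ : (u * _) x = u x / v x)// /GRing.scale/= /q.
  by field; rewrite v0 /= !gt_eqF// ltr_wpDl ?sqr_ge0// exprn_gt0.
have dth := is_deriveZ s dom.
have qE : q x `^ (s / 2) = q x `^ (s / 2 - 1) * q x.
  by rewrite -{3}(powRr1 (ltW q0)) -powRD ?subrK// (gt_eqF q0) implybT.
(* The claimed derivative in the same coordinates: $\mathrm{Re}(d/c)$ and $\mathrm{Im}(d/c)$ are the
   derivatives of $\log|c|$ and of the angle. *)
have RE : s%:C * cpowr (c x) (s - 1) * d =
  Complex (s * q x `^ (s / 2 - 1) * ((u x * complex.Re d + v x * complex.Im d) * cos (s * uarg (c x))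
      + (complex.Re d * v x - u x * complex.Im d) * sin (s * uarg (c x))))
   (s * q x `^ (s / 2 - 1) * ((u x * complex.Re d + v x * complex.Im d) * sin (s * uarg (c x))
      - (complex.Re d * v x - u x * complex.Im d) * cos (s * uarg (c x)))).
  rewrite cpowrB1// cpowr_upperE// -/(u x) -/(v x) -/(q x).
  have -> : (c x)^-1 = Complex (u x / q x) (- v x / q x).
    apply: (mulfI (Im_neq0 c0)); rewrite divff ?Im_neq0//.
    rewrite [in RHS](_ : c x = Complex (u x) (v x)); last by rewrite /u /v; case: (c x).
    apply/eqP; rewrite eq_complex /=; apply/andP; split; apply/eqP; rewrite /q; field.
      by rewrite gt_eqF.
    by rewrite gt_eqF.
  rewrite /cpolar qE; move: (q x `^ _) (cos _) (sin _) => A C S.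
  case: (d) => d1 d2; apply/eqP; rewrite eq_complex /=; apply/andP; split; apply/eqP; field.
    by rewrite gt_eqF.
  by rewrite gt_eqF.
split; rewrite RE /=.
  apply: (@near_eq_is_derive _ _ _ (fun t => q t `^ (s / 2) * cos (s * uarg (c t)))).
    by apply: filterS ce => t /(congr1 (@complex.Re _)) /= ->.
  have := is_deriveM dqs (@is_derive1_comp _ cos _ x _ _ (is_derive_cos _) dth).
  move=> h; apply: is_derive_eq h _.
  rewrite /GRing.scale/= qE; field.
  by rewrite gt_eqF.
apply: (@near_eq_is_derive _ _ _ (fun t => q t `^ (s / 2) * sin (s * uarg (c t)))).
  by apply: filterS ce => t /(congr1 (@complex.Im _)) /= ->.
have := is_deriveM dqs (@is_derive1_comp _ sin _ x _ _ (is_derive_sin _) dth).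
move=> h; apply: is_derive_eq h _.
rewrite /GRing.scale/= qE; field.
by rewrite gt_eqF.
Qed.

(* Projecting on the direction of [c b - c a] reduces this to the real mean value inequality. *)
Lemma cmod_le_derive c dc (e de : R -> R) a b : a <= b ->
  (forall x, a <= x <= b -> cderive x c (dc x)) ->
  (forall x, a <= x <= b -> is_derive x 1 e (de x)) ->
  (forall x, a <= x <= b -> cmod (dc x) <= de x) ->
  cmod (c b - c a) <= e b - e a.
Proof.
move=> ab dcP deP dce.
set w := c b - c a.
have [->|w0] := eqVneq w 0.
  rewrite cmod0 subr_ge0.
  apply: (@ger0_derive1_le_cc _ e a b); rewrite ?in_itv/= ?lexx ?ab//.
  - by move=> x /[!in_itv]/= /andP[h1 h2]; have [] := deP x; rewrite ?ltW.
  - move=> x /[!in_itv]/= /andP[h1 h2]; have [|_ ] := deP x; first by rewrite ?ltW.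
    by rewrite derive1E => ->; apply: le_trans (dce _ _); rewrite ?cmod_ge0 ?ltW.
  - apply: continuous_in_subspaceT => x /[!inE]/= /[!in_itv]/= h; exact: is_derive_continuous (deP _ h).
pose p := complex.Re w / cmod w; pose q := complex.Im w / cmod w.
have cw : cmod w != 0 by rewrite cmod_eq0.
pose g t := e t - (p * complex.Re (c t) + q * complex.Im (c t)).
have dg x : a <= x <= b -> is_derive x 1 g (de x - (p * complex.Re (dc x) + q * complex.Im (dc x))).
  move=> h; have [h1 h2] := dcP x h; have h3 := deP x h.
  have := is_deriveB h3 (is_deriveD (is_deriveZ p h1) (is_deriveZ q h2)).
  by [].
have pq : p ^+ 2 + q ^+ 2 = 1.
  by rewrite /p /q !expr_div_n -mulrDl -cmod_sqr divff// sqrf_eq0.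
have key (u : R[i]) : p * complex.Re u + q * complex.Im u <= cmod u.
  apply: le_trans (ler_norm _) _.
  rewrite -ler_sqr ?nnegrE ?cmod_ge0// real_normK ?num_real// cmod_sqr.
  rewrite -[leRHS]mul1r -pq -subr_ge0.
  rewrite [leRHS](_ : _ = (p * complex.Im u - q * complex.Re u) ^+ 2) ?sqr_ge0//.
  by ring.
have : g a <= g b.
  apply: (@ger0_derive1_le_cc _ g a b); rewrite ?in_itv/= ?lexx ?ab//.
  - by move=> x /[!in_itv]/= /andP[h1 h2]; have [] := dg x; rewrite ?ltW.
  - move=> x /[!in_itv]/= /andP[h1 h2]; have [|_ ] := dg x; first by rewrite ?ltW.
    rewrite derive1E => ->; rewrite subr_ge0; apply: le_trans (key _) _.
    by apply: dce; rewrite ?ltW.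
  - apply: continuous_in_subspaceT => x /[!inE]/= /[!in_itv]/= h; exact: is_derive_continuous (dg _ h).
rewrite /g.
have -> : cmod w = p * complex.Re w + q * complex.Im w.
  by apply: (mulfI cw); rewrite -expr2 cmod_sqr /p /q; field.
have -> : complex.Re w = complex.Re (c b) - complex.Re (c a).
  by rewrite /w; case: (c b) => ? ?; case: (c a).
have -> : complex.Im w = complex.Im (c b) - complex.Im (c a).
  by rewrite /w; case: (c b) => ? ?; case: (c a).
move: (p) (q) => P Q; nra.
Qed.

End Curves.

(** * Complex-valued expectations and independence *)

Section Expectation.
Context {R : realType} {d} {T : measurableType d} (P : probability T R).
Implicit Types (X Y : T -> R[i]) (f g : T -> R).

(** Defined by coordinates so that [stieltjes] is an instance of it by conversion. *)
Definition cE X : R[i] := Complex (Rintegral P setT (fun w => complex.Re (X w)))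
                                  (Rintegral P setT (fun w => complex.Im (X w))).

Definition cmeasurable X := measurable_fun setT (fun w => complex.Re (X w)) /\
  measurable_fun setT (fun w => complex.Im (X w)).

Lemma dominated_integrable_fun f g : measurable_fun setT f ->
  P.-integrable setT (EFin \o g) -> (forall w, `|f w| <= g w) ->
  P.-integrable setT (EFin \o f).
Proof.
move=> mf ig fg; apply: le_integrable ig => //; first exact/measurable_EFinP.
move=> w _ /=; rewrite lee_fin (le_trans (fg w))//; exact: ler_norm.
Qed.

Lemma integrable_cst_fun (k : R) : P.-integrable setT (EFin \o (fun=> k)).
Proof. exact: finite_measure_integrable_cst. Qed.

Lemma bounded_integrable f k : measurable_fun setT f -> (forall w, `|f w| <= k) ->
  P.-integrable setT (EFin \o f).
Proof. by move=> mf fk; apply: dominated_integrable_fun (integrable_cst_fun k) fk. Qed.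

Lemma Rint_cst (k : R) : Rintegral P setT (fun=> k) = k.
Proof. by rewrite Rintegral_cst// (_ : fine _ = 1) ?mulr1//= probability_setT. Qed.

Lemma integrable_Zl (k : R) f : P.-integrable setT (EFin \o f) ->
  P.-integrable setT (EFin \o (fun w => k * f w)).
Proof. by move=> i; exact: (integrableZl measurableT k i). Qed.

Lemma Rint_bounded f k : measurable_fun setT f -> (forall w, `|f w| <= k) ->
  `|Rintegral P setT f| <= k.
Proof.
move=> mf fk; have i := bounded_integrable mf fk.
apply: le_trans (le_normr_Rintegral measurableT i) _.
rewrite -[leRHS]Rint_cst; apply: le_Rintegral => //.
- apply: (@bounded_integrable _ k); first exact: measurableT_comp.
  by move=> w; rewrite normr_id.
- exact: integrable_cst_fun.
Qed.

Lemma cE_cst (k : R[i]) : cE (fun=> k) = k.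
Proof. by rewrite /cE !Rint_cst; case: k. Qed.

Lemma cE_ext X Y : X =1 Y -> cE X = cE Y.
Proof. by move=> /funext ->. Qed.

Section Dominated.
Variables (X : T -> R[i]) (g : T -> R).
Hypotheses (mX : cmeasurable X) (ig : P.-integrable setT (EFin \o g))
  (Xg : forall w, cmod (X w) <= g w).

Lemma integrable_Re : P.-integrable setT (EFin \o (fun w => complex.Re (X w))).
Proof.
by apply: dominated_integrable_fun mX.1 ig _ => w; apply: le_trans (normr_Re_le _) _.
Qed.

Lemma integrable_Im : P.-integrable setT (EFin \o (fun w => complex.Im (X w))).
Proof.
by apply: dominated_integrable_fun mX.2 ig _ => w; apply: le_trans (normr_Im_le _) _.
Qed.

Lemma cE_Zl (k : R[i]) : cE (fun w => k * X w) = k * cE X.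
Proof.
have iR := integrable_Re; have iI := integrable_Im.
apply: eq_ReIm.
  rewrite cReM /cE /=; under eq_Rintegral do rewrite cReM.
  by rewrite RintegralB ?RintegralZl//; apply: integrable_Zl.
rewrite cImM /cE /=; under eq_Rintegral do rewrite cImM.
by rewrite RintegralD ?RintegralZl//; apply: integrable_Zl.
Qed.

(** Duality: $|EX|^2=E\,\mathrm{Re}(\overline{EX}\,X)$, so the sharp constant 1 survives the
    treatment by coordinates. *)
Lemma cmod_cE_le : cmod (cE X) <= Rintegral P setT g.
Proof.
have iR := integrable_Re; have iI := integrable_Im.
have [->|w0] := eqVneq (cE X) 0.
  by rewrite cmod0 Rintegral_ge0// => w _; exact: le_trans (cmod_ge0 _) (Xg w).
have cw : 0 < cmod (cE X) by rewrite cmod_gt0.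
rewrite -(ler_pM2l cw) -expr2 cmod_sqr.
pose a := complex.Re (cE X); pose b := complex.Im (cE X).
have -> : complex.Re (cE X) ^+ 2 + complex.Im (cE X) ^+ 2 =
   Rintegral P setT (fun w => a * complex.Re (X w) + b * complex.Im (X w)).
  by rewrite RintegralD ?RintegralZl ?expr2//; apply: integrable_Zl.
rewrite -RintegralZl//; apply: le_Rintegral => //.
- by have := integrableD measurableT (integrableZl measurableT a iR) (integrableZl measurableT b iI).
- by have := integrableZl measurableT (cmod (cE X)) ig.
move=> w _; apply: le_trans (_ : cmod (cE X) * cmod (X w) <= _); last by rewrite ler_pM2l.
rewrite -cmod_conj -cmodM; apply: le_trans (normr_Re_le _); apply: le_trans (ler_norm _).
by rewrite cReM /a /b; case: (cE X) => ? ? /=; lra.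
Qed.

End Dominated.

Lemma cE_D X Y g g' : cmeasurable X -> cmeasurable Y ->
  P.-integrable setT (EFin \o g) -> P.-integrable setT (EFin \o g') ->
  (forall w, cmod (X w) <= g w) -> (forall w, cmod (Y w) <= g' w) ->
  cE (fun w => X w + Y w) = cE X + cE Y.
Proof.
move=> mX mY ig ig' Xg Yg.
apply: eq_ReIm.
  rewrite cReD /cE /=; under eq_Rintegral do rewrite cReD.
  by rewrite RintegralD//; [apply: integrable_Re ig Xg|apply: integrable_Re ig' Yg].
rewrite cImD /cE /=; under eq_Rintegral do rewrite cImD.
by rewrite RintegralD//; [apply: integrable_Im ig Xg|apply: integrable_Im ig' Yg].
Qed.

Lemma cmeasurableD X Y : cmeasurable X -> cmeasurable Y -> cmeasurable (fun w => X w + Y w).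
Proof.
move=> [m1 m2] [m3 m4]; split.
  by under eq_fun do rewrite cReD; exact: measurable_funD.
by under eq_fun do rewrite cImD; exact: measurable_funD.
Qed.

Lemma cmeasurableM X Y : cmeasurable X -> cmeasurable Y -> cmeasurable (fun w => X w * Y w).
Proof.
move=> [m1 m2] [m3 m4]; split.
  by under eq_fun do rewrite cReM; apply: measurable_funB; exact: measurable_funM.
by under eq_fun do rewrite cImM; apply: measurable_funD; exact: measurable_funM.
Qed.

Lemma cmeasurable_cst (k : R[i]) : cmeasurable (fun=> k).
Proof. by split; exact: measurable_cst. Qed.

Lemma Rint_dominated (f_ : nat -> T -> R) f g : (forall n, measurable_fun setT (f_ n)) ->
  P.-integrable setT (EFin \o g) ->
  (forall n w, `|f_ n w| <= g w) ->
  (forall w, f_ n w @[n --> \oo] --> f w) ->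
  Rintegral P setT (f_ n) @[n --> \oo] --> Rintegral P setT f.
Proof.
move=> mf ig fg cv.
have mF : measurable_fun setT f by apply: measurable_fun_cvg => // w _; exact: cv.
have fgw w : `|f w| <= g w.
  have h : `|f_ n w| @[n --> \oo] --> `|f w| by exact: cvg_norm (cv w).
  rewrite -(cvg_lim _ h)//; apply: limr_le; first by apply/cvg_ex; exists (`|f w|).
  by apply: nearW => n; exact: fg.
have iF : P.-integrable setT (EFin \o f) by exact: dominated_integrable_fun ig fgw.
have [] := @dominated_convergence _ T R P setT measurableT (fun n => EFin \o f_ n) (EFin \o f) (EFin \o g).
- by move=> n; exact/measurable_EFinP.
- exact/measurable_EFinP.
- by apply: aeW => w _ /=; apply: cvg_EFin; [exact: nearW|exact: cv].
- exact: ig.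
- by apply: aeW => w n _ /=; rewrite lee_fin.
move=> _ _ h; apply: fine_cvg; rewrite /Rintegral fineK//; exact: integrable_fin_num.
Qed.

Definition ccvg (u : nat -> R[i]) (l : R[i]) :=
  (complex.Re (u n) @[n --> \oo] --> complex.Re l) /\
  (complex.Im (u n) @[n --> \oo] --> complex.Im l).

Lemma cE_dominated (X_ : nat -> T -> R[i]) X g : (forall n, cmeasurable (X_ n)) ->
  P.-integrable setT (EFin \o g) -> (forall n w, cmod (X_ n w) <= g w) ->
  (forall w, ccvg (X_ ^~ w) (X w)) -> ccvg (fun n => cE (X_ n)) (cE X).
Proof.
move=> mX ig Xg cv; split.
  apply: Rint_dominated ig _ _ => [n|n w|w]; first exact: (mX n).1.
    exact: le_trans (normr_Re_le _) _.
  exact: (cv w).1.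
apply: Rint_dominated ig _ _ => [n|n w|w]; first exact: (mX n).2.
  exact: le_trans (normr_Im_le _) _.
exact: (cv w).2.
Qed.

(** A constant bound uniform in the parameter is enough here: negative powers at a fixed height
    above the real axis are bounded in terms of that height. *)
Lemma is_derive_Rint (F dF : R -> T -> R) (k x : R) :
  (forall t, P.-integrable setT (EFin \o F t)) ->
  (forall t w, is_derive t (1 : R) (F^~ w) (dF t w)) ->
  (forall t w, `|dF t w| <= k) ->
  is_derive x 1 (fun t => Rintegral P setT (F t)) (Rintegral P setT (dF x)).
Proof.
move=> iF dFP dFk.
have k0 : 0 <= k by exact: le_trans (normr_ge0 _) (dFk 0 point).
have Ix : `]x - 1, x + 1[%classic x by rewrite /= in_itv/=; apply/andP; split; lra.
have pE t w : partial1of2 F t w = dF t w.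
  by rewrite partial1of2E; have [_ ->] := dFP t w.
have H := @derivable_under_integral R d T P F setT measurableT x _ _ Ix (fun t _ => iF t)
  (fun t w _ _ => @ex_derive _ _ _ _ _ _ _ (dFP t w)) (fun=> k) (fun=> k0) (integrable_cst_fun k).
have H' := @differentiation_under_integral R d T P F setT measurableT x _ _ Ix (fun t _ => iF t)
  (fun t w _ _ => @ex_derive _ _ _ _ _ _ _ (dFP t w)) (fun=> k) (fun=> k0) (integrable_cst_fun k).
apply: DeriveDef.
  by apply: H => t w _ _; rewrite pE.
rewrite -derive1E H'; last by move=> t w _ _; rewrite pE.
by apply: eq_Rintegral => w _; rewrite pE.
Qed.

Lemma cderive_cE (F dF : R -> T -> R[i]) (G : R -> T -> R) (k x : R) :
  (forall t, cmeasurable (F t)) ->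
  (forall t, P.-integrable setT (EFin \o G t)) ->
  (forall t w, cmod (F t w) <= G t w) ->
  (forall t w, cderive t (F^~ w) (dF t w)) ->
  (forall t w, cmod (dF t w) <= k) ->
  cderive x (fun t => cE (F t)) (cE (dF x)).
Proof.
move=> mF iG Fg dFP dFk; split.
  apply: (@is_derive_Rint _ (fun t w => complex.Re (dF t w)) k).
  - by move=> t; exact: integrable_Re (mF t) (iG t) (Fg t).
  - by move=> t w; exact: (dFP t w).1.
  - by move=> t w; exact: le_trans (normr_Re_le _) _.
apply: (@is_derive_Rint _ (fun t w => complex.Im (dF t w)) k).
- by move=> t; exact: integrable_Im (mF t) (iG t) (Fg t).
- by move=> t w; exact: (dFP t w).2.
- by move=> t w; exact: le_trans (normr_Im_le _) _.
Qed.

End Expectation.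

(** * Independence and Fubini's theorem *)

Section Independence.
Context {R : realType} {d} {T : measurableType d} (P : probability T R).

(* Product form of the law of [(X, Y)] on a given event propagates from rectangles to all
   measurable sets by uniqueness of finite measures on a pi-system. *)
Lemma indep_event_pair {d1 d2} {T1 : measurableType d1} {T2 : measurableType d2}
    (E : set T) (c : R) (X : T -> T1) (Y : T -> T2) :
  measurable E -> 0 <= c -> measurable_fun setT X -> measurable_fun setT Y ->
  (forall A B, measurable A -> measurable B ->
     P (E `&` (X @^-1` A `&` Y @^-1` B)) = (c%:E * (P (X @^-1` A) * P (Y @^-1` B)))%E) ->
  (forall A B, measurable A -> measurable B ->
     P (X @^-1` A `&` Y @^-1` B) = (P (X @^-1` A) * P (Y @^-1` B))%E) ->
  forall D, measurable D ->
    P (E `&` (fun w => (X w, Y w)) @^-1` D) = (c%:E * P ((fun w => (X w, Y w)) @^-1` D))%E.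
Proof.
move=> mE c0 mX mY EXY XY D mD.
have mXY : measurable_fun setT (fun w => (X w, Y w)) by exact: measurable_fun_pair.
pose XY' : {mfun T >-> (T1 * T2)%type} :=
  HB.pack (fun w => (X w, Y w)) (isMeasurableFun.Build _ _ _ _ _ mXY).
pose m1 : {measure set (T1 * T2) -> \bar R} := pushforward (mrestr P mE) XY'.
pose m2 : {measure set (T1 * T2) -> \bar R} := mscale (NngNum c0) (distribution P XY').
pose C : set (set (T1 * T2)) :=
  [set C | exists A, measurable A /\ exists B, measurable B /\ C = A `*` B].
have mC A : C A -> measurable A.
  by move=> [A1 [mA1 [A2 [mA2 ->]]]]; exact: measurableX.
suff : m1 mXY D = m2 D.
  by rewrite /m1 /m2 /mscale/= /pushforward /mrestr setIC.
apply: (measure_unique C (fun=> setT)) => //.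
- rewrite measurable_prod_measurableType //; congr (<<s _ >>).
  rewrite predeqE; split => [[A mA [B mB <-]]|[A [mA [B [mB ->]]]]].
    by exists A; split => //; exists B.
  by exists A => //; exists B.
- move=> /= _ _ [X1 [mX1 [X2 [mX2 ->]]]] [Y1 [mY1 [Y2 [mY2 ->]]]].
  rewrite -setXI; exists (X1 `&` Y1); split; first exact: measurableI.
  by exists (X2 `&` Y2); split => //; exact: measurableI.
- by move=> n; exists setT; split => //; exists setT; split => //; rewrite setXTT.
- by rewrite bigcup_const//; exists 0%N.
- move=> _ [A [mA [B [mB ->]]]].
  rewrite /m1 /m2 /mscale/= /pushforward /mrestr.
  have -> : (fun w => (X w, Y w)) @^-1` (A `*` B) = X @^-1` A `&` Y @^-1` B by [].
  by rewrite setIC EXY// -XY.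
- move=> n; rewrite /m1 /= /pushforward /mrestr preimage_setT setTI.
  by rewrite (le_lt_trans (probability_le1 P mE))// ltry.
Qed.

Definition independent2 {d1 d2} {T1 : measurableType d1} {T2 : measurableType d2}
    (X : T -> T1) (Y : T -> T2) := forall A B, measurable A -> measurable B ->
     P (X @^-1` A `&` Y @^-1` B) = (P (X @^-1` A) * P (Y @^-1` B))%E.

Section Fubini.
Context {d1 d2} {T1 : measurableType d1} {T2 : measurableType d2}.
Variables (X : T -> T1) (Y : T -> T2).
Hypotheses (mX : measurable_fun setT X) (mY : measurable_fun setT Y)
  (XY : independent2 X Y).

(** Freezing of [Y]: the joint law is the product of the two marginal laws, and Fubini on that
    product is pulled back to the sample space. *)
Lemma Rint_independent2 (f : T1 * T2 -> R) (k : R) : measurable_fun setT f ->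
  (forall u, `|f u| <= k) ->
  Rintegral P setT (fun w => f (X w, Y w)) =
  Rintegral P setT (fun w => Rintegral P setT (fun w' => f (X w', Y w))).
Proof.
move=> mf fk.
have mXY : measurable_fun setT (fun w => (X w, Y w)) by exact: measurable_fun_pair.
pose X' : {mfun T >-> T1} := HB.pack X (isMeasurableFun.Build _ _ _ _ X mX).
pose Y' : {mfun T >-> T2} := HB.pack Y (isMeasurableFun.Build _ _ _ _ Y mY).
pose XY' : {mfun T >-> (T1 * T2)%type} :=
  HB.pack (fun w => (X w, Y w)) (isMeasurableFun.Build _ _ _ _ _ mXY).
pose PXY : probability (T1 * T2)%type R := distribution P XY'.
pose PX : probability T1 R := distribution P X'.
pose PY : probability T2 R := distribution P Y'.
have E1 D : measurable D -> (PX \x PY)%E D = P ((fun w => (X w, Y w)) @^-1` D).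
  by apply: (@product_measure_unique _ _ _ _ _ PX PY PXY) => A B mA mB; exact: XY.
have mEf : measurable_fun setT (EFin \o f) by exact/measurable_EFinP.
have ifP : P.-integrable setT ((EFin \o f) \o (fun w => (X w, Y w))).
  by apply: (@bounded_integrable _ _ _ P (fun w => f (X w, Y w)) k) => //; exact: measurableT_comp.
have iPP : (PX \x PY)%E.-integrable setT (EFin \o f).
  apply/integrableP; split => //.
  rewrite (eq_measure_integral PXY) => [|A mA _]; last exact: E1.
  have /integrableP[_] := @bounded_integrable _ _ _ PXY f k mf fk.
  by [].
have sec y : measurable_fun setT (fun x => f (x, y)).
  by apply: measurableT_comp => //; exact: pair2_measurable.
pose g y := Rintegral PX setT (fun x => f (x, y)).
have gE : fubini_G PX (EFin \o f) = EFin \o g.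
  apply/funext => y; rewrite /fubini_G /g /= /Rintegral fineK//.
  by apply: integrable_fin_num => //; apply: (@bounded_integrable _ _ _ PX (fun x => f (x, y)) k).
have mg : measurable_fun setT g.
  by apply/measurable_EFinP; rewrite -gE; exact: measurable_fubini_G iPP.
have gk y : `|g y| <= k by exact: Rint_bounded.
rewrite {1}/Rintegral; congr fine.
transitivity (\int[(PX \x PY)%E]_u (EFin \o f) u)%E.
  rewrite (eq_measure_integral PXY) => [|A mA _]; last exact: E1.
  by rewrite integral_distribution.
rewrite -(integral21_prod_meas1 iPP) gE integral_distribution//; last 2 first.
- exact/measurable_EFinP.
- by apply: (@bounded_integrable _ _ _ P (g \o Y) k) => [|w]; [exact: (measurableT_comp mg mY)|exact: gk].
apply: eq_integral => w _ /=; congr EFin; rewrite /g /Rintegral; congr fine.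
rewrite integral_distribution//; first exact/measurable_EFinP/sec.
apply: (@bounded_integrable _ _ _ P (fun w' => f (X w', Y w)) k) => //.
exact: (measurableT_comp (sec (Y w))).
Qed.

End Fubini.

End Independence.

(** * The beta mixture identity *)

Section Density.
Context {R : realType} {d} {T : measurableType d} (P : probability T R).
Local Notation mu := (@lebesgue_measure R).

(** The restricted density and the Radon-Nikodym derivative of the law of [V] have the same integral
    over every measurable set, hence agree almost everywhere; the change of variables formula then
    applies. Integrability of [k] is the total mass 1 of the law. *)
Lemma Rint_density (V : T -> R) (D : set R) (k : R -> R) (h : R -> R) (K : R) :
  measurable_fun setT V -> measurable D -> measurable_fun setT k ->
  (forall A, measurable A -> P (V @^-1` A) = (\int[mu]_(x in A `&` D) (k x)%:E)%E) ->
  (forall x, D x -> 0 <= k x) ->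
  measurable_fun setT h -> (forall x, `|h x| <= K) ->
  mu.-integrable D (EFin \o k) /\
  Rintegral P setT (fun w => h (V w)) = Rintegral mu D (fun x => h x * k x).
Proof.
move=> mV mD mk PV k0 mh hK.
have iD : mu.-integrable D (EFin \o k).
  apply/integrableP; split; first exact/measurable_EFinP/measurable_funTS.
  have := PV setT measurableT; rewrite setTI preimage_setT probability_setT => PV1.
  rewrite (_ : integral _ _ _ = \int[mu]_(x in D) (k x)%:E)%E; first by rewrite -PV1 ltry.
  by apply: eq_integral => x /[!inE] Dx /=; rewrite ger0_norm// k0.
split => //.
pose TR := measurableTypeR R.
have mV' : measurable_fun setT (V : T -> TR) by exact: mV.
pose V' : {mfun T >-> TR} := HB.pack V (isMeasurableFun.Build _ _ T TR V mV').
pose nu : probability TR R := distribution P V'.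
have nuE A : measurable A -> nu A = (\int[mu]_(x in A) ((EFin \o k) \_ D) x)%E.
  by move=> mA; rewrite -integral_mkcondr; exact: PV.
have mkD : measurable_fun setT ((EFin \o k) \_ D).
  by apply/(measurable_restrictT _ mD); exact/measurable_EFinP/measurable_funTS.
have numu : nu `<< mu.
  apply/null_content_dominatesP => A mA A0; rewrite nuE//.
  by apply: null_set_integral => //; exact: measurable_funTS.
have mEh : measurable_fun setT (EFin \o h) by exact/measurable_EFinP.
have mh' : measurable_fun setT (h : TR -> R) by exact: mh.
have inuh : nu.-integrable setT (EFin \o (h : TR -> R)).
  exact: (@bounded_integrable _ _ _ nu h K).
rewrite /Rintegral; congr fine.
transitivity (\int[nu]_x (EFin \o h) x)%E.
  rewrite integral_distribution//.
  apply: (@bounded_integrable _ _ _ P (h \o V) K) => [|w]; last exact: hK.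
  exact: measurableT_comp.
rewrite -(Radon_Nikodym_change_of_variables numu measurableT inuh).
have iRN : mu.-integrable setT (Radon_Nikodym (charge_of_finite_measure nu) mu).
  by apply: Radon_Nikodym_integrable; exact: numu.
transitivity (\int[mu]_x ((h x)%:E * ((EFin \o k) \_ D) x))%E; last first.
  rewrite [RHS]integral_mkcond; apply: eq_integral => x _.
  by rewrite !patchE; case: ifPn => //; rewrite mule0.
apply: ae_eq_integral => //.
- exact: emeasurable_funM.
- exact: emeasurable_funM.
- apply: ae_eqe_mul2l.
  apply: integral_ae_eq => // E _ mE.
  by rewrite -Radon_Nikodym_integral// -nuE.
Qed.

End Density.

Lemma is_derive_onem {R : realType} (v : R) : is_derive v (1 : R) (fun y : R => 1 - y) (- 1).
Proof.
have := is_deriveB (is_derive_cst (1 : R) v (1 : R)) (is_derive_id v (1 : R)).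
by rewrite sub0r.
Qed.

(** * Stein's identity for the beta law *)

Section BetaStein.
Context {R : realType}.
Local Notation mu := (@lebesgue_measure R).
Variables (a b : R).
Hypotheses (a0 : 0 < a) (b0 : 0 < b).

Let D : set R := `]0, 1[%classic.

Lemma measurable_beta_kernel : measurable_fun setT (beta_kernel a b).
Proof.
apply: measurable_funM; first exact: measurable_powR.
by apply: (measurableT_comp (measurable_powR _)); exact: measurable_funB.
Qed.

Section Stein.
Variables (phi dphi : R -> R) (K : R).
Hypotheses (dphiP : forall x, is_derive x (1:R) phi (dphi x))
  (cdphi : forall x, {for x, continuous dphi}).

Let G v := v `^ a * (1 - v) `^ b * phi v.
Let s v := (a - (a + b) * v) * phi v + v * (1 - v) * dphi v.

Let dG (v : R) : 0 < v < 1 -> is_derive v (1:R) G (s v * beta_kernel a b v).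
Proof.
move=> /andP[v0 v1].
have v1' : 0 < 1 - v by rewrite subr_gt0.
have h1 := is_derive1_powR a v0.
have h2 := is_derive_onem v.
have h3 := @is_derive1_comp _ (fun y => y `^ b) _ v _ _ (is_derive1_powR b v1') h2.
have h := is_deriveM (is_deriveM h1 h3) (dphiP v).
apply: is_derive_eq h _.
rewrite [(_ * _) v](_ : _ = v `^ a * (1 - v) `^ b)//.
rewrite /s /beta_kernel /GRing.scale /=.
rewrite -(mulr_powRB1 (ltW v0) a0) -(mulr_powRB1 (ltW v1') b0).
move: (v `^ _) ((1 - v) `^ _) => A B.
ring.
Qed.

Let cG (v : R) : 0 < v < 1 -> {for v, continuous G}.
Proof. by move=> h; exact: is_derive_continuous (dG h). Qed.

Let cg (v : R) : 0 < v < 1 -> {for v, continuous (fun v => s v * beta_kernel a b v)}.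
Proof.
move=> /andP[v0 v1].
have v1' : 0 < 1 - v by rewrite subr_gt0.
have cphi := is_derive_continuous (dphiP v).
have h2 := is_derive_onem v.
have c1 : {for v, continuous (fun y => y `^ (a - 1))} by exact: is_derive_continuous (is_derive1_powR _ v0).
have c3 : {for v, continuous (fun y : R => (1 - y) `^ (b - 1))}.
  exact: is_derive_continuous (@is_derive1_comp _ (fun y => y `^ (b-1)) _ v _ _ (is_derive1_powR (b-1) v1') h2).
apply: cvgM; last by apply: cvgM; [exact: c1|exact: c3].
apply: cvgD; apply: cvgM => //.
- by apply: cvgB; [exact: cvg_cst|apply: cvgM; [exact: cvg_cst|exact: cvg_id]].
- by apply: cvgM; [exact: cvg_id|apply: cvgB; [exact: cvg_cst|exact: cvg_id]].
- exact: cdphi.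
Qed.

Let G0 : G v @[v --> 0^'+] --> 0.
Proof.
rewrite -[X in _ --> X](mul0r (phi 0)) -[X in X * phi 0](mul0r (1 : R)).
apply: cvgM; last by apply: cvg_at_right_filter; exact: is_derive_continuous (dphiP 0).
apply: cvgM; first exact: powR_cvg0.
have h2 := is_derive_onem (0 : R).
have h : 0 < 1 - 0 :> R by rewrite subr0.
have h3 := is_derive_continuous (@is_derive1_comp _ (fun y => y `^ b) _ (0:R) _ _ (is_derive1_powR b h) h2).
have {h3} : (1 - v) `^ b @[v --> 0^'+] --> (1 - 0) `^ b := cvg_at_right_filter h3.
by rewrite subr0 powR1.
Qed.

Let G1 : G v @[v --> 1^'-] --> 0.
Proof.
rewrite -[X in _ --> X](mul0r (phi 1)) -[X in X * phi 1](mulr0 (1 : R)).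
apply: cvgM; last by apply: cvg_at_left_filter; exact: is_derive_continuous (dphiP 1).
apply: cvgM.
  have := is_derive_continuous (is_derive1_powR a (@ltr01 R)).
  by move=> /cvg_at_left_filter; rewrite /= powR1.
apply: cvg_comp (powR_cvg0 b0) => A [e /= e0 H]; exists e => //= v ve v1.
by apply: H; rewrite /= ?subr_gt0//; move: ve; rewrite /= !sub0r normrN.
Qed.

Hypotheses (iD : mu.-integrable D (EFin \o beta_kernel a b))
  (ms : measurable_fun setT s) (sK : forall x, D x -> `|s x| <= K).

Let g v := s v * beta_kernel a b v.

Let mg : measurable_fun setT g.
Proof. by apply: measurable_funM => //; exact: measurable_beta_kernel. Qed.

Let ig : mu.-integrable D (EFin \o g).
Proof.
have iK : mu.-integrable D (EFin \o (fun v => K * beta_kernel a b v)).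
  have mD : @measurable _ (measurableTypeR R) D by exact: measurable_itv.
  exact: (integrableZl mD K iD).
apply: le_integrable iK; first exact: measurable_itv.
  exact/measurable_EFinP/measurable_funTS.
move=> v Dv /=; rewrite lee_fin !normrM ler_wpM2r//.
by apply: le_trans (sK Dv) _; exact: ler_norm.
Qed.

(** The offset three keeps [del n] below one half, so that the intervals from [del n] to [1 - del n]
    are nondegenerate. *)
Let del (n : nat) : R := n.+3%:R^-1.

Let del0 n : 0 < del n < 1 - del n.
Proof.
have h : 3%:R <= n.+3%:R :> R by rewrite ler_nat.
have n0 : 0 < n.+3%:R :> R by rewrite ltr0n.
rewrite /del invr_gt0 n0 /=.
have : n.+3%:R^-1 <= 3%:R^-1 :> R by rewrite lef_pV2 ?posrE.
move: (n.+3%:R^-1) => x; have := divff (_ : 3 != 0 :> R); rewrite pnatr_eq0 => /(_ isT).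
by move: (3^-1) => y; lra.
Qed.

Let cvg_del : del n @[n --> \oo] --> 0^'+.
Proof.
have h : del n @[n --> \oo] --> 0.
  have : @harmonic R (n + 2)%N @[n --> \oo] --> 0 by rewrite (cvg_shiftn 2); exact: cvg_harmonic.
  by rewrite /harmonic /del; under eq_fun do rewrite addn2.
move=> A [e /= e0 H].
have /cvgrPdist_lt /(_ e e0) := h.
apply: filterS => n /= hn; apply: H => //=.
by have /andP[] := del0 n.
Qed.

Let FTC n : Rintegral mu `[del n, 1 - del n] g = G (1 - del n) - G (del n).
Proof.
have /andP[d0 d1] := del0 n.
have sub x : del n <= x <= 1 - del n -> 0 < x < 1 by move=> /andP[? ?]; apply/andP; split; lra.
rewrite /Rintegral (@continuous_FTC2 _ g G)//.
- apply: continuous_in_subspaceT => x /[!inE]/= /[!in_itv]/= h.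
  by apply: cg; exact: sub.
- split => [x /[!in_itv]/= /andP[h1 h2]||].
  + by have [] := dG (sub x _); rewrite ?ltW.
  + by apply: cvg_at_right_filter; apply: cG; apply: sub; rewrite lexx ltW.
  + by apply: cvg_at_left_filter; apply: cG; apply: sub; rewrite lexx ltW.
- move=> x /[!in_itv]/= /andP[h1 h2].
  by rewrite derive1E; have [|_ ->] := dG (sub x _); rewrite ?ltW.
Qed.

Let cvgG : G (1 - del n) - G (del n) @[n --> \oo] --> 0.
Proof.
rewrite -[X in _ --> X](subr0 0); apply: cvgB; last exact: cvg_comp cvg_del G0.
apply: cvg_comp (G1) => A [e /= e0 H].
have : \forall n \near \oo, del n < e := cvg_del (nbhs_right_lt e0).
apply: filterS => n /= hn; have /andP[d0 d1] := del0 n.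
apply: H => /=; last by lra.
by rewrite opprB addrC subrK gtr0_norm.
Qed.

(** The integrand is the derivative of $v^a(1-v)^b\varphi(v)$, which vanishes at both ends because
    $a,b>0$. The kernel may blow up there, so the fundamental theorem is used on compact
    subintervals and dominated convergence does the rest. *)
Lemma beta_stein : Rintegral mu D g = 0.
Proof.
pose f_ n := (EFin \o g) \_ `[del n, 1 - del n].
have mI n : measurable (`[del n, 1 - del n]%classic : set R) by [].
have [] := @dominated_convergence _ _ _ mu D _ f_ (EFin \o g) (abse \o (EFin \o g)).
- exact: measurable_itv.
- move=> n; apply: measurable_funTS; apply/(measurable_restrictT _ (mI n)).
  exact/measurable_funTS/measurable_EFinP.
- exact/measurable_EFinP/measurable_funTS.
- apply: aeW => x; rewrite /D /= in_itv/= => /andP[x0 x1].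
  apply: cvg_near_cst.
  have m0 : 0 < Num.min x (1 - x) by rewrite lt_min x0 subr_gt0.
  have : \forall n \near \oo, del n < Num.min x (1 - x) := cvg_del (nbhs_right_lt m0).
  apply: filterS => n /=; rewrite lt_min => /andP[h1 h2].
  rewrite /f_ patchE mem_set//= in_itv/=; apply/andP; split; lra.
- have mD : @measurable _ (measurableTypeR R) D by exact: measurable_itv.
  exact: (integrable_abse ig).
- apply: aeW => x n _; rewrite /f_ patchE; case: ifPn => // _.
  by rewrite (_ : point = 0%E) ?abse0 ?abse_ge0.
move=> _ _ h.
have hI n : (\int[mu]_(x in D) f_ n x = (G (1 - del n) - G (del n))%:E)%E.
  rewrite /f_ -integral_mkcondr -FTC /Rintegral fineK.
    congr (integral _ _ _); apply/setIidPr => x; rewrite /D /= !in_itv/= => /andP[h1 h2].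
    have /andP[d0 d1] := del0 n; rewrite (lt_le_trans d0 h1) (le_lt_trans h2)//.
    by rewrite gtrBl.
  apply: integrable_fin_num => //; apply: integrableS ig => //; first exact: measurable_itv.
  move=> x; rewrite /D /= !in_itv/= => /andP[h1 h2].
  have /andP[d0 d1] := del0 n; rewrite (lt_le_trans d0 h1) (le_lt_trans h2)//.
  by rewrite gtrBl.
rewrite /Rintegral.
suff -> : (\int[mu]_(x in D) (g x)%:E = 0)%E by [].
apply: (cvg_unique _ h) => //.
rewrite /=; under eq_fun do rewrite hI.
exact: cvg_EFin (nearW _ _) cvgG.
Qed.

End Stein.
End BetaStein.

(** * Powers along horizontal lines, and truncation *)

Section CurveFacts.
Context {R : realType}.

Lemma cpowr_norm_le (w : R[i]) (y s : R) : 0 < y -> y <= complex.Im w -> s <= 0 ->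
  cmod (cpowr w s) <= y `^ s.
Proof.
move=> y0 yw s0; rewrite cmod_cpowr.
have w0 : 0 < cmod w by rewrite cmod_gt0 Im_neq0// (lt_le_trans y0).
have yc : y <= cmod w by rewrite (le_trans yw)// (le_trans _ (normr_Im_le _))// ler_norm.
rewrite -[s]opprK !(powRN _ (- s)) lef_pV2 ?posrE ?powR_gt0//.
by apply: ge0_ler_powR; rewrite ?oppr_ge0// nnegrE ltW.
Qed.

Lemma cderive0_const (c : R -> R[i]) : (forall x, cderive x c 0) -> forall a b, c a = c b.
Proof.
move=> c0.
suff H a b : a <= b -> c b = c a by move=> a b; have [/H|/ltW/H] := leP a b.
move=> ab; apply/eqP; rewrite -subr_eq0 -cmod_eq0 eq_le cmod_ge0 andbT.
have := @cmod_le_derive R c (fun=> 0) (fun=> 0) (fun=> 0) a b ab (fun x _ => c0 x).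
rewrite subrr; apply => // x _.
by rewrite cmod0.
Qed.

Lemma cderive_continuous (c : R -> R[i]) x d : cderive x c d ->
  {for x, continuous (fun t => complex.Re (c t))} /\
  {for x, continuous (fun t => complex.Im (c t))}.
Proof. by move=> [h1 h2]; split; [exact: is_derive_continuous h1|exact: is_derive_continuous h2]. Qed.

Lemma cderive_measurable (c dc : R -> R[i]) : (forall x, cderive x c (dc x)) -> cmeasurable c.
Proof.
by move=> h; split; apply: continuous_measurable_fun => x;
  have [h1 h2] := cderive_continuous (h x); [exact: h1|exact: h2].
Qed.

Lemma Im_shift (w : R[i]) (x : R) : complex.Im (w + x%:C) = complex.Im w.
Proof. by rewrite cImD addr0. Qed.

Lemma cderive_line (w : R[i]) (k x : R) : cderive x (fun t => w + (k * t)%:C) k%:C.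
Proof.
have := cderiveD (cderive_cst x w) (cderiveZ k%:C (cderive_real x 0)).
rewrite mulr1 add0r; apply: cderive_ext => t.
by rewrite add0r rmorphM.
Qed.

Lemma cderive_cpowr_line (w : R[i]) (k s x : R) : 0 < complex.Im w ->
  cderive x (fun t => cpowr (w + (k * t)%:C) s) (s%:C * cpowr (w + (k * x)%:C) (s - 1) * k%:C).
Proof. by move=> w0; apply: cderive_cpowr (cderive_line w k x); rewrite Im_shift. Qed.

Lemma cderive_cpowr_shift (w : R[i]) (s x : R) : 0 < complex.Im w ->
  cderive x (fun t => cpowr (w + t%:C) s) (s%:C * cpowr (w + x%:C) (s - 1)).
Proof.
by move=> w0; have := cderive_cpowr_line 1 s x w0; rewrite mulr1; under eq_fun do rewrite mul1r; rewrite mul1r.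
Qed.

Lemma cpowr_shift_measurable (w : R[i]) (s : R) : 0 < complex.Im w ->
  cmeasurable (fun x : R => cpowr (w + x%:C) s).
Proof. by move=> w0; apply: cderive_measurable => x; exact: cderive_cpowr_shift. Qed.

Lemma cmeasurable_comp {d} {T : measurableType d} (c : R -> R[i]) (X : T -> R) :
  cmeasurable c -> measurable_fun setT X -> cmeasurable (fun w => c (X w)).
Proof.
by move=> [m1 m2] mX; split; [exact: (measurableT_comp m1 mX)|exact: (measurableT_comp m2 mX)].
Qed.

(** Used with $B=1$ on the sticks and with large $B$ on the atoms: their laws place them in the
    desired ranges only almost surely, or not at all. *)
Definition clamp (B x : R) : R := Num.max 0 (Num.min x B).

Lemma clamp_ge0 B x : 0 <= clamp B x.
Proof. by rewrite /clamp le_max lexx. Qed.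

Lemma clamp_le B x : 0 <= B -> clamp B x <= B.
Proof. by move=> B0; rewrite /clamp ge_max B0 ge_min lexx orbT. Qed.

Lemma clamp_id B x : 0 <= x <= B -> clamp B x = x.
Proof. by move=> /andP[x0 xB]; rewrite /clamp (min_idPl xB) (max_idPr x0). Qed.

Lemma measurable_clamp B : measurable_fun setT (clamp B).
Proof. by apply: measurable_maxr => //; apply: measurable_minr. Qed.

End CurveFacts.

(** * From Stein's identity to the mixture of complex powers *)

Section BetaMixture.
Context {R : realType} {d} {T : measurableType d} (P : probability T R).
Local Notation mu := (@lebesgue_measure R).
Variables (a b : R) (V : T -> R).
Hypotheses (a0 : 0 < a) (b0 : 0 < b) (mV : measurable_fun setT V)
  (V01 : forall w, 0 <= V w <= 1)
  (lawV : forall A, measurable A -> P (V @^-1` A) = beta_law a b A).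

Lemma beta_stein_E (phi dphi : R -> R) (K1 K2 : R) :
  (forall x, is_derive x (1:R) phi (dphi x)) -> (forall x, {for x, continuous dphi}) ->
  (forall x, `|phi x| <= K1) -> (forall x, `|dphi x| <= K2) ->
  Rintegral P setT (fun w => (a - (a + b) * V w) * phi (V w) + V w * (1 - V w) * dphi (V w)) = 0.
Proof.
move=> dP cd phiK dphiK.
pose D : set R := `]0, 1[%classic.
pose c := beta_const a b.
pose k x := beta_kernel a b x / c.
pose s v := (a - (a + b) * v) * phi v + v * (1 - v) * dphi v.
(* [s] is bounded on the unit interval only; clamping gives a globally bounded test function with
   the same values along [V]. *)
pose h x := s (clamp 1 x).
have mphi : measurable_fun setT phi.
  by apply: continuous_measurable_fun => x; exact: is_derive_continuous (dP x).
have mdphi : measurable_fun setT dphi by exact: continuous_measurable_fun.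
have ms : measurable_fun setT s.
  apply: measurable_funD; apply: measurable_funM => //.
    by apply: measurable_funB => //; exact: measurable_funM.
  by apply: measurable_funM => //; exact: measurable_funB.
have sK v : 0 <= v <= 1 -> `|s v| <= (a + (a + b)) * K1 + K2.
  move=> /andP[v0 v1]; apply: le_trans (ler_normD _ _) _; rewrite !normrM.
  have K10 : 0 <= K1 by apply: le_trans (phiK 0).
  have K20 : 0 <= K2 by apply: le_trans (dphiK 0).
  apply: lerD; first apply: ler_pM => //.
    by apply: le_trans (ler_normB _ _) _; rewrite gtr0_norm// lerD2l ger0_norm ?mulr_ge0 ?ler_piMr// addr_ge0// ltW.
  rewrite -[leRHS]mul1r; apply: ler_pM => //; rewrite ?mulr_ge0//.
  by rewrite !ger0_norm ?subr_ge0// mulr_ile1 ?subr_ge0// lerBlDr lerDl.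
have mh : measurable_fun setT h by exact: measurableT_comp ms (measurable_clamp 1).
have hK x : `|h x| <= (a + (a + b)) * K1 + K2.
  by apply: sK; rewrite clamp_ge0 clamp_le.
have mk : measurable_fun setT k.
  by apply: measurable_funM => //; exact: measurable_beta_kernel.
have c_ge0 : 0 <= c.
  by apply: Rintegral_ge0 => x _; rewrite /beta_kernel mulr_ge0// powR_ge0.
have k0 x : D x -> 0 <= k x.
  by move=> _; rewrite /k divr_ge0// /beta_kernel mulr_ge0// powR_ge0.
have PV A : measurable A -> P (V @^-1` A) = (\int[mu]_(x in A `&` D) (k x)%:E)%E.
  by move=> mA; rewrite lawV.
have mD : measurable D by exact: measurable_itv.
(* Division by 0 gives 0, so a vanishing constant would leave [V] with total mass 0. This also
   excludes a divergent beta integral, whose [Rintegral] would be 0. *)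
have c_neq0 : c != 0.
  apply/eqP => c00.
  have := PV setT measurableT; rewrite preimage_setT probability_setT.
  under eq_integral do rewrite /k c00 invr0 mulr0.
  by rewrite integral0 => /eqP; rewrite eqe oner_eq0.
have [ik H] := Rint_density mV mD mk PV k0 mh hK.
have ibk : mu.-integrable D (EFin \o beta_kernel a b).
  have mD' : @measurable _ (measurableTypeR R) D by exact: measurable_itv.
  have := integrableZl mD' c ik.
  apply: eq_integrable => // x _ /=.
  by rewrite -EFinM /k mulrC divfK.
have := beta_stein a0 b0 dP cd ibk ms (K := (a + (a + b)) * K1 + K2) _.
have sKD x : `]0, 1[%classic x -> `|s x| <= (a + (a + b)) * K1 + K2.
  by rewrite /= in_itv/= => /andP[x0 x1]; apply: sK; rewrite !ltW.
move=> /(_ sKD) S0.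
transitivity (Rintegral P setT (fun w => h (V w))).
  by apply: eq_Rintegral => w _; rewrite /h clamp_id.
rewrite H -[RHS](mul0r c^-1) -[in RHS]S0 -RintegralZr//.
  apply: eq_Rintegral => x; rewrite inE /D /= in_itv/= => /andP[x0 x1].
  by rewrite /h clamp_id ?mulrA// !ltW.
have iK := integrableZl (mD : @measurable _ (measurableTypeR R) D) ((a + (a + b)) * K1 + K2) ibk.
apply: le_integrable iK => //.
  by apply/measurable_EFinP/measurable_funTS; apply: measurable_funM => //; exact: measurable_beta_kernel.
move=> v Dv /=; rewrite lee_fin !normrM ler_wpM2r//.
by apply: le_trans (sKD _ Dv) _; exact: ler_norm.
Qed.

(* Carlson's identity; in [s] the left-hand side [J] solves [(w0 + s) J' + a J = 0] by [beta_stein_E]. *)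
Lemma beta_mixture (w0 : R[i]) (s : R) : 0 < complex.Im w0 ->
  cE P (fun w => cpowr (w0 + (V w * s)%:C) (- (a + b))) =
  cpowr (w0 + s%:C) (- a) * cpowr w0 (- b).
Proof.
move=> w00; set r := - (a + b).
have r0 : r <= 0 by rewrite oppr_le0 addr_ge0// ltW.
have V1 w : `|V w| <= 1 by have /andP[h1 h2] := V01 w; rewrite ger0_norm.
pose y := complex.Im w0.
pose F t w := cpowr (w0 + (V w * t)%:C) r.
pose dF t w := r%:C * cpowr (w0 + (V w * t)%:C) (r - 1) * (V w)%:C.
have mVt t : measurable_fun setT (fun w => V w * t) by exact: measurable_funM.
have mF t : cmeasurable (F t).
  exact: (cmeasurable_comp (cpowr_shift_measurable r w00) (mVt t)).
have mP t : cmeasurable (fun w => cpowr (w0 + (V w * t)%:C) (r - 1)).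
  exact: (cmeasurable_comp (cpowr_shift_measurable (r - 1) w00) (mVt t)).
have mdF t : cmeasurable (dF t).
  by apply: cmeasurableM; [apply: cmeasurableM => //; exact: cmeasurable_cst|split].
have Fb t w : cmod (F t w) <= y `^ r by apply: cpowr_norm_le => //; rewrite Im_shift.
have Pb t w : cmod (cpowr (w0 + (V w * t)%:C) (r - 1)) <= y `^ (r - 1).
  by apply: cpowr_norm_le => //; rewrite ?Im_shift//; lra.
have dFb t w : cmod (dF t w) <= `|r| * y `^ (r - 1).
  rewrite /dF !cmodM !cmod_real -[leRHS]mulr1 ler_pM// ?mulr_ge0 ?cmod_ge0//.
  by rewrite ler_wpM2l.
have icst k : P.-integrable setT (EFin \o (fun=> k : R)) by exact: integrable_cst_fun.
pose J t := cE P (F t); pose dJ t := cE P (dF t).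
have dJP t : cderive t J (dJ t).
  apply: (cderive_cE (G := fun _ _ => y `^ r) (k := `|r| * y `^ (r - 1))) => //.
  by move=> u w; exact: cderive_cpowr_line.
have ode t : dJ t * (w0 + t%:C) + a%:C * J t = 0.
  rewrite mulrC /dJ /J -(cE_Zl (mdF t) (icst _) (dFb t)) -(cE_Zl (mF t) (icst _) (Fb t)).
  rewrite -(cE_D (g := fun=> cmod (w0 + t%:C) * (`|r| * y `^ (r - 1))) (g' := fun=> a * y `^ r))//; last 4 first.
  - by apply: cmeasurableM => //; exact: cmeasurable_cst.
  - by apply: cmeasurableM => //; exact: cmeasurable_cst.
  - by move=> w; rewrite cmodM ler_wpM2l// cmod_ge0.
  - by move=> w; rewrite cmodM cmod_real (gtr0_norm a0) ler_wpM2l// ltW.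
  pose phi v := cpowr (w0 + (t * v)%:C) r.
  pose dphi v := r%:C * cpowr (w0 + (t * v)%:C) (r - 1) * t%:C.
  have dphiP v : cderive v phi (dphi v) by exact: cderive_cpowr_line.
  have cdphi v : {for v, continuous (fun t => complex.Re (dphi t))} /\
     {for v, continuous (fun t => complex.Im (dphi t))}.
    have h := cderive_cpowr_line t (r - 1) v w00.
    apply: (@cderive_continuous _ _ _ (r%:C * ((r - 1)%:C * cpowr (w0 + (t * v)%:C) (r - 1 - 1) * t%:C) * t%:C)).
    have := cderiveZ t%:C (cderiveZ r%:C h).
    rewrite mulrC; apply: cderive_ext => u; by rewrite /dphi mulrC.
  have phib v : cmod (phi v) <= y `^ r by apply: cpowr_norm_le => //; rewrite Im_shift.
  have dphib v : cmod (dphi v) <= `|r| * y `^ (r - 1) * `|t|.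
    rewrite /dphi !cmodM !cmod_real ler_wpM2r// ler_wpM2l//.
    by apply: cpowr_norm_le => //; rewrite ?Im_shift//; lra.
  (* With $u=w_0+Vt$ one has $w_0+t=u+(1-V)t$, which turns the combination into the Stein integrand
     of $\varphi(v)=(w_0+tv)^r$; the coefficients match because $r=-(a+b)$. *)
  have XE w : (w0 + t%:C) * dF t w + a%:C * F t w =
      (a - (a + b) * V w)%:C * phi (V w) + (V w * (1 - V w))%:C * dphi (V w).
    rewrite /dF /F /phi /dphi (mulrC t).
    set u := w0 + (V w * t)%:C.
    have u0 : 0 < complex.Im u by rewrite /u Im_shift.
    have -> : cpowr u r = cpowr u (r - 1) * u by rewrite cpowrB1// divfK// Im_neq0.
    have -> : a - (a + b) * V w = a + r * V w by rewrite /r mulNr.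
    have -> : w0 = u - (V w * t)%:C by rewrite /u addrK.
    rewrite !(rmorphD, rmorphB, rmorphM, rmorph1)/=.
    by ring.
  apply: eq_ReIm.
    transitivity (Rintegral P setT (fun w => (a - (a + b) * V w) * complex.Re (phi (V w)) +
        V w * (1 - V w) * complex.Re (dphi (V w)))).
      apply: eq_Rintegral => w _; rewrite XE cReD !cReM /= !mul0r; lra.
    apply: (@beta_stein_E (fun v => complex.Re (phi v)) (fun v => complex.Re (dphi v)) (y `^ r) (`|r| * y `^ (r - 1) * `|t|)).
    + by move=> v; have [] := dphiP v.
    + by move=> v; have [] := cdphi v.
    + by move=> v; exact: le_trans (normr_Re_le _) _.
    + by move=> v; exact: le_trans (normr_Re_le _) _.
  transitivity (Rintegral P setT (fun w => (a - (a + b) * V w) * complex.Im (phi (V w)) +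
        V w * (1 - V w) * complex.Im (dphi (V w)))).
    apply: eq_Rintegral => w _; rewrite XE cImD !cImM /= !mul0r; lra.
  apply: (@beta_stein_E (fun v => complex.Im (phi v)) (fun v => complex.Im (dphi v)) (y `^ r) (`|r| * y `^ (r - 1) * `|t|)).
  + by move=> v; have [] := dphiP v.
  + by move=> v; have [] := cdphi v.
  + by move=> v; exact: le_trans (normr_Im_le _) _.
  + by move=> v; exact: le_trans (normr_Im_le _) _.
(* Integrating factor of the equation: [H] is constant, and its value at 0 is
   $w_0^{r+a}=w_0^{-b}$. *)
pose H t := J t * cpowr (w0 + t%:C) a.
have Hc t : cderive t H 0.
  apply: cderive_eq (cderiveM (dJP t) (cderive_cpowr_shift a t w00)) _.
  have u0 : 0 < complex.Im (w0 + t%:C) by rewrite Im_shift.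
  rewrite cpowrB1//; apply: (mulIf (Im_neq0 u0)); rewrite mul0r.
  set pa := cpowr _ a; have qu : pa / (w0 + t%:C) * (w0 + t%:C) = pa by rewrite divfK// Im_neq0.
  transitivity (dJ t * (w0 + t%:C) * pa + a%:C * J t * (pa / (w0 + t%:C) * (w0 + t%:C))).
    by move: (pa / _) => q; ring.
  rewrite qu -mulrDl.
  by rewrite ode mul0r.
have := cderive0_const Hc s 0; rewrite /H.
have -> : J 0 = cpowr w0 r.
  rewrite /J /F -[RHS](cE_cst P); apply: cE_ext => w.
  by rewrite mulr0 addr0.
rewrite addr0 -cpowrD ?Im_neq0// (_ : r + a = - b); last by rewrite /r; ring.
move=> <-; rewrite mulrCA mulrA -mulrA -cpowrD ?addNr ?cpowr0 ?mulr1//.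
by rewrite Im_neq0// Im_shift.
Qed.

End BetaMixture.

(** * Independence and equality in law for complex expectations *)

Section ComplexFubini.
Context {R : realType} {d} {T : measurableType d} (P : probability T R).

Lemma cE_independent2 {d1 d2} {T1 : measurableType d1} {T2 : measurableType d2}
    (X : T -> T1) (Y : T -> T2) (f : T1 * T2 -> R[i]) (k : R) :
  measurable_fun setT X -> measurable_fun setT Y -> independent2 P X Y ->
  cmeasurable f -> (forall u, cmod (f u) <= k) ->
  cE P (fun w => f (X w, Y w)) = cE P (fun w => cE P (fun w' => f (X w', Y w))).
Proof.
move=> mX mY XY [m1 m2] fk; apply: eq_ReIm.
  apply: (Rint_independent2 mX mY XY m1 (k := k)) => u.
  exact: le_trans (normr_Re_le _) _.
apply: (Rint_independent2 mX mY XY m2 (k := k)) => u.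
exact: le_trans (normr_Im_le _) _.
Qed.

Lemma Rint_same_law {d'} {T' : measurableType d'} (P' : probability T' R)
    (X : T -> R) (X' : T' -> R) (f : R -> R) (k : R) :
  measurable_fun setT X -> measurable_fun setT X' ->
  (forall A, measurable A -> P (X @^-1` A) = P' (X' @^-1` A)) ->
  measurable_fun setT f -> (forall x, `|f x| <= k) ->
  Rintegral P setT (fun w => f (X w)) = Rintegral P' setT (fun w => f (X' w)).
Proof.
move=> mX mX' XX' mf fk.
pose Y : {mfun T >-> R} := HB.pack X (isMeasurableFun.Build _ _ _ _ X mX).
pose Y' : {mfun T' >-> R} := HB.pack X' (isMeasurableFun.Build _ _ _ _ X' mX').
have mEf : measurable_fun setT (EFin \o f) by exact/measurable_EFinP.
have i1 : P.-integrable setT ((EFin \o f) \o Y).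
  by apply: (@bounded_integrable _ _ _ P (f \o X) k) => [|w]; [exact: (measurableT_comp mf mX)|exact: fk].
have i2 : P'.-integrable setT ((EFin \o f) \o Y').
  by apply: (@bounded_integrable _ _ _ P' (f \o X') k) => [|w]; [exact: (measurableT_comp mf mX')|exact: fk].
rewrite /Rintegral; congr fine.
transitivity (\int[distribution P Y]_x (EFin \o f) x)%E; first by rewrite integral_distribution.
rewrite (eq_measure_integral (distribution P' Y')) => [|A mA _]; last exact: XX'.
by rewrite integral_distribution.
Qed.

Lemma cE_same_law {d'} {T' : measurableType d'} (P' : probability T' R)
    (X : T -> R) (X' : T' -> R) (f : R -> R[i]) (k : R) :
  measurable_fun setT X -> measurable_fun setT X' ->
  (forall A, measurable A -> P (X @^-1` A) = P' (X' @^-1` A)) ->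
  cmeasurable f -> (forall x, cmod (f x) <= k) ->
  cE P (fun w => f (X w)) = cE P' (fun w => f (X' w)).
Proof.
move=> mX mX' XX' [m1 m2] fk; apply: eq_ReIm.
  apply: (Rint_same_law mX mX' XX' m1 (k := k)) => u.
  exact: le_trans (normr_Re_le _) _.
apply: (Rint_same_law mX mX' XX' m2 (k := k)) => u.
exact: le_trans (normr_Im_le _) _.
Qed.

End ComplexFubini.

(** * Truncated stick-breaking means *)

Section StickBreaking.
Context {R : realType} {d} {T : measurableType d} (P : probability T R).
Variables (V Z : nat -> T -> R).

(* The mean of the sticks [n, ..., n + m - 1], with remaining mass placed at [0]. *)
Fixpoint tmean (m n : nat) (w : T) : R :=
  if m is m'.+1 then V n w * Z n w + (1 - V n w) * tmean m' n.+1 w else 0.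

Hypotheses (mV : forall n, measurable_fun setT (V n)) (mZ : forall n, measurable_fun setT (Z n)).

Lemma measurable_tmean m n : measurable_fun setT (tmean m n).
Proof.
elim: m n => [|m IH] n /=; first exact: measurable_cst.
apply: measurable_funD; first exact: measurable_funM.
by apply: measurable_funM => //; exact: measurable_funB.
Qed.

Lemma tmean_bounds B m n w : (forall n, 0 <= V n w <= 1) -> (forall n, 0 <= Z n w <= B) ->
  0 <= tmean m n w <= B.
Proof.
move=> V01 ZB; elim: m n => [|m IH] n /=.
  by rewrite lexx/=; have /andP[h1 h2] := ZB 0%N; exact: le_trans h2.
have /andP[v0 v1] := V01 n; have /andP[z0 z1] := ZB n; have /andP[m0 m1] := IH n.+1.
apply/andP; split; first by rewrite addr_ge0// mulr_ge0// subr_ge0.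
rewrite (_ : B = V n w * B + (1 - V n w) * B); last by ring.
by apply: lerD; apply: ler_wpM2l => //; rewrite subr_ge0.
Qed.

Lemma tmean_nondecreasing m n w : (forall n, 0 <= V n w <= 1) -> (forall n, 0 <= Z n w) ->
  tmean m n w <= tmean m.+1 n w.
Proof.
move=> V01 Z0; elim: m n => [|m IH] n.
  have /andP[v0 v1] := V01 n.
  by rewrite /= mulr0 addr0 mulr_ge0.
have /andP[v0 v1] := V01 n.
by rewrite /= lerD2l ler_wpM2l ?subr_ge0//; exact: IH.
Qed.

(** Horner's scheme: all sticks after the first share the factor $1-V_n$. *)
Lemma tmean_shiftE m n w : tmean m n w = \sum_(k < m) stick (fun k => V (n + k)) k w * Z (n + k) w.
Proof.
elim: m n => [|m IH] n /=; first by rewrite big_ord0.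
rewrite big_ord_recl /= /stick big_ord0 mulr1 addn0; congr (_ + _).
rewrite IH mulr_sumr; apply: eq_bigr => k _.
rewrite /bump /= add1n big_ord_recl /= addn0 addSnnS.
rewrite /stick addSnnS [X in (1 - _) * (_ * X * _)](eq_bigr (fun j : 'I_k => 1 - V (n + bump 0 j) w)) => [|j _].
  by ring.
by rewrite /bump /= add1n addSnnS.
Qed.

Lemma tmeanE m w : tmean m 0 w = \sum_(k < m) stick V k w * Z k w.
Proof. by rewrite tmean_shiftE. Qed.

Hypothesis VZ : mutually_independent P
    (fun i : nat + nat => match i with inl k => V k | inr k => Z k end).

(* The pi-system of rectangles in the first [n] pairs [(V k, Z k)]. *)
Inductive past : nat -> set T -> Prop :=
| past0 : past 0 setT
| pastS n E A B : past n E -> measurable A -> measurable B ->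
    past n.+1 (E `&` (V n @^-1` A `&` Z n @^-1` B)).

Lemma past_setT n : past n setT.
Proof.
elim: n => [|n IH]; first exact: past0.
by have := pastS IH measurableT measurableT; rewrite !preimage_setT !setIT.
Qed.

Lemma measurable_pre (X : T -> R) A : measurable_fun setT X -> measurable A -> measurable (X @^-1` A).
Proof. by move=> mX mA; have := mX measurableT A mA; rewrite setTI. Qed.

Lemma past_measurable n E : past n E -> measurable E.
Proof.
elim=> // {}n {}E A B _ mE mA mB.
by apply: measurableI => //; apply: measurableI; exact: measurable_pre.
Qed.

Let X (i : nat + nat) := match i with inl k => V k | inr k => Z k end.

Fixpoint pseq (n : nat) : seq (nat + nat) :=
  if n is n'.+1 then inl n' :: inr n' :: pseq n' else [::].

Lemma mem_pseq n i : i \in pseq n -> (match i with inl k => k | inr k => k end < n)%N.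
Proof.
elim: n i => //= n IH i; rewrite !inE => /or3P[/eqP ->|/eqP ->|/IH h] //.
by case: i h => k h; rewrite ltnS ltnW.
Qed.

Lemma inl_pseq n : inl n \in pseq n.+1.
Proof. by rewrite /= inE eqxx. Qed.

Lemma inr_pseq n : inr n \in pseq n.+1.
Proof. by rewrite /= !inE eqxx orbT. Qed.

Lemma sub_pseq n i : i \in pseq n -> i \in pseq n.+1.
Proof. by move=> h; rewrite /= !inE h !orbT. Qed.

Lemma uniq_pseq n : uniq (pseq n).
Proof.
elim: n => //= n IH; rewrite inE /= IH andbT; apply/andP; split.
  by apply/negP => /mem_pseq; rewrite ltnn.
by apply/negP => /mem_pseq; rewrite ltnn.
Qed.

(** Puts an event of the past in the form of a cylinder over distinct indices, the form in which
    [mutually_independent] is stated. *)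
Lemma past_pseq n E : past n E -> exists2 B : nat + nat -> set R,
  forall i, measurable (B i) & E = \bigcap_(i in [set i | i \in pseq n]) (X i @^-1` B i).
Proof.
elim=> [|{}n {}E A B _ [B0 mB0 ->] mA mB].
  by exists (fun=> setT) => //; apply/seteqP; split.
exists (fun i => if i == inl n then A else if i == inr n then B else B0 i).
  by move=> i; case: ifP => // _; case: ifP.
apply/seteqP; split => w.
  move=> [H [wA wB]] i /=; rewrite !inE.
  by case: eqP => [->|] //=; case: eqP => [->|] //= _ _; exact: H.
move=> H; split; last first.
  by split; [have := H _ (inl_pseq n)|have := H _ (inr_pseq n)]; rewrite /= eqxx.
move=> i /= ip; have /= := H _ (sub_pseq ip).
have := mem_pseq ip.
by case: eqP => [->|_]; rewrite ?ltnn//; case: eqP => [->|_]; rewrite ?ltnn.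
Qed.

Lemma past_indep n E A B : past n E -> measurable A -> measurable B ->
  P (E `&` (V n @^-1` A `&` Z n @^-1` B)) = (P E * (P (V n @^-1` A) * P (Z n @^-1` B)))%E.
Proof.
move=> pE mA mB.
have [B0 mB0 EE] := past_pseq pE.
have PE : P E = (\prod_(i <- pseq n) P (X i @^-1` B0 i))%E.
  by rewrite EE; apply: VZ => //; exact: uniq_pseq.
pose B' i := if i == inl n then A else if i == inr n then B else B0 i.
have mB' i : measurable (B' i) by rewrite /B'; case: ifP => // _; case: ifP.
have -> : E `&` (V n @^-1` A `&` Z n @^-1` B) =
    \bigcap_(i in [set i | i \in pseq n.+1]) (X i @^-1` B' i).
  rewrite EE; apply/seteqP; split => w.
    move=> [H [wA wB]] i /=; rewrite !inE /B'.
    by case: eqP => [->|] //=; case: eqP => [->|] //= _ _; exact: H.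
  move=> H; split; last first.
    by split; [have := H _ (inl_pseq n)|have := H _ (inr_pseq n)]; rewrite /B' /= eqxx.
  move=> i /= ip; have /= := H _ (sub_pseq ip).
  have := mem_pseq ip; rewrite /B'.
  by case: eqP => [->|_]; rewrite ?ltnn//; case: eqP => [->|_]; rewrite ?ltnn.
rewrite VZ//; last exact: uniq_pseq.
rewrite /= !big_cons PE {1 2}/B' /= !eqxx muleA muleC; congr (_ * _)%E.
rewrite big_seq [RHS]big_seq; apply: eq_bigr => i ip.
have := mem_pseq ip; rewrite /B'.
by case: eqP => [->|_]; rewrite ?ltnn//; case: eqP => [->|_]; rewrite ?ltnn.
Qed.

Lemma tmean_indep m n :
  (forall E C, past n E -> measurable C ->
     P (E `&` tmean m n @^-1` C) = (P E * P (tmean m n @^-1` C))%E) /\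
  (if m is m'.+1 then independent2 P (Z n) (tmean m' n.+1) /\
     independent2 P (V n) (fun w => (Z n w, tmean m' n.+1 w)) else True).
Proof.
elim: m n => [|m IH] n.
  split => // E C pE mC /=.
  have [C0|C0] := pselect (C 0).
    rewrite (_ : (fun _ : T => 0) @^-1` C = setT) ?setIT ?probability_setT ?mule1//.
    by apply/seteqP; split.
  rewrite (_ : (fun _ : T => 0) @^-1` C = set0) ?setI0 ?measure0 ?mule0//.
  by apply/seteqP; split.
have {}IH := (IH n.+1).1.
set M := tmean m n.+1 in IH *.
have mM : measurable_fun setT M by exact: measurable_tmean.
have Pfin A : measurable A -> P A = (fine (P A))%:E by move=> mA; rewrite fineK// fin_num_measure.
(* The conditions on [V n] and [Z n] are absorbed into the past of level [n.+1], where the induction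
   hypothesis applies. *)
have key E A B C : past n E -> measurable A -> measurable B -> measurable C ->
  P ((E `&` V n @^-1` A) `&` (Z n @^-1` B `&` M @^-1` C)) =
    (P E * P (V n @^-1` A) * (P (Z n @^-1` B) * P (M @^-1` C)))%E.
  move=> pE mA mB mC.
  have -> : (E `&` V n @^-1` A) `&` (Z n @^-1` B `&` M @^-1` C) =
     (E `&` (V n @^-1` A `&` Z n @^-1` B)) `&` M @^-1` C by rewrite !setIA.
  by rewrite IH//; [rewrite past_indep// !muleA|exact: pastS].
have iZM : independent2 P (Z n) M.
  move=> B C mB mC; have := key setT setT B C (past_setT n) measurableT mB mC.
  by rewrite preimage_setT setIT setTI !probability_setT !mul1e.
have step E A D : past n E -> measurable A -> measurable D ->
  P ((E `&` V n @^-1` A) `&` (fun w => (Z n w, M w)) @^-1` D) =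
    (P E * P (V n @^-1` A) * P ((fun w => (Z n w, M w)) @^-1` D))%E.
  move=> pE mA mD.
  have mE := past_measurable pE; have mVA := measurable_pre (mV n) mA.
  rewrite (Pfin _ mE) (Pfin _ mVA) -EFinM.
  apply: indep_event_pair => //; first exact: measurableI.
    by rewrite mulr_ge0// fine_ge0.
  by move=> B C mB mC; rewrite key// EFinM -!Pfin.
have iVZM : independent2 P (V n) (fun w => (Z n w, M w)).
  move=> A D mA mD; have := step setT A D (past_setT n) mA mD.
  by rewrite setTI probability_setT mul1e.
split => // E C pE mC.
have mE := past_measurable pE.
have mZM : measurable_fun setT (fun w => (Z n w, M w)) by exact: measurable_fun_pair.
pose Phi (u : R * (R * R)) := u.1 * u.2.1 + (1 - u.1) * u.2.2.
have mPhi : measurable_fun setT Phi.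
  apply: measurable_funD; apply: measurable_funM.
  - exact: measurable_fst.
  - exact: (measurableT_comp measurable_fst measurable_snd).
  - by apply: measurable_funB => //; exact: measurable_fst.
  - exact: (measurableT_comp measurable_snd measurable_snd).
have mD : measurable (Phi @^-1` C) by have := mPhi measurableT C mC; rewrite setTI.
have H := @indep_event_pair _ _ _ P _ _ _ _ E (fine (P E)) (V n) (fun w => (Z n w, M w))
   mE (fine_ge0 (measure_ge0 _ _)) (mV n) mZM _ iVZM _ mD.
rewrite (_ : tmean m.+1 n @^-1` C = (fun w => (V n w, (Z n w, M w))) @^-1` (Phi @^-1` C))//.
rewrite (Pfin _ mE) H// => A D mA mD'.
by rewrite setIA step// -Pfin// muleA.
Qed.

End StickBreaking.

(** * The hierarchy for means of bounded atoms *)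

Section BoundedMeans.
Context {R : realType} {d} {T : measurableType d} (P : probability T R).
Variables (V Z : nat -> T -> R) (alpha theta B : R).
Hypotheses (alpha01 : 0 < alpha < 1) (theta0 : 0 < theta)
  (mV : forall n, measurable_fun setT (V n)) (mZ : forall n, measurable_fun setT (Z n))
  (V01 : forall n w, 0 <= V n w <= 1) (ZB : forall n w, 0 <= Z n w <= B)
  (VZ : mutually_independent P
    (fun i : nat + nat => match i with inl k => V k | inr k => Z k end))
  (lawV : forall (k : nat) (A : set R), measurable A ->
     P (V k @^-1` A) = beta_law (1 - alpha) (theta + k.+1%:R * alpha) A)
  (lawZ : forall (k : nat) (A : set R), measurable A -> P (Z k @^-1` A) = P (Z 0%N @^-1` A)).

Definition th (n : nat) : R := theta + n%:R * alpha.
Definition phi (s : R) (z : R[i]) : R[i] := cE P (fun w => cpowr (z + (Z 0%N w)%:C) s).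

Lemma th_gt0 n : 0 < th n.
Proof. by case/andP: alpha01 => a0 _; rewrite /th ltr_wpDr// mulr_ge0// ltW. Qed.

Lemma thS n : th n.+1 = th n + alpha.
Proof. by rewrite /th -addn1 natrD; ring. Qed.

(** With [Z n] and the tail mean frozen, the beta parameters of [V n] sum to [th n + 1], so the
    mixture identity yields a product, and independence factors its expectation. The tail has one
    stick fewer, a discrepancy that disappears in the limit. *)
Lemma tmean_step (m n : nat) (z : R[i]) : 0 < complex.Im z ->
  cE P (fun w => cpowr (z + (tmean V Z m.+1 n w)%:C) (- (th n + 1))) =
  phi (alpha - 1) z * cE P (fun w => cpowr (z + (tmean V Z m n.+1 w)%:C) (- th n.+1)).
Proof.
move=> z0; case/andP: (alpha01) => a0 a1.
set a := 1 - alpha; set b := th n.+1; set y := complex.Im z.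
have a_gt0 : 0 < a by rewrite subr_gt0.
have b_gt0 : 0 < b by exact: th_gt0.
have -> : th n + 1 = a + b by rewrite /a /b thS; ring.
have -> : alpha - 1 = - a by rewrite /a opprB.
have [_ [iZM iVZM]] := tmean_indep mV mZ VZ m.+1 n.
set M := tmean V Z m n.+1 in iZM iVZM *.
have mM : measurable_fun setT M by exact: measurable_tmean.
have mZM : measurable_fun setT (fun w => (Z n w, M w)) by exact: measurable_fun_pair.
have bnd s (x : R) : s <= 0 -> cmod (cpowr (z + x%:C) s) <= y `^ s.
  by move=> s0; apply: cpowr_norm_le => //; rewrite Im_shift.
have mcp s : cmeasurable (fun x : R => cpowr (z + x%:C) s) by exact: cpowr_shift_measurable.
pose Phi (u : R * (R * R)) := u.1 * u.2.1 + (1 - u.1) * u.2.2.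
have mPhi : measurable_fun setT Phi.
  apply: measurable_funD; apply: measurable_funM.
  - exact: measurable_fst.
  - exact: (measurableT_comp measurable_fst measurable_snd).
  - by apply: measurable_funB => //; exact: measurable_fst.
  - exact: (measurableT_comp measurable_snd measurable_snd).
pose F u := cpowr (z + (Phi u)%:C) (- (a + b)).
have mF : cmeasurable F by exact: (cmeasurable_comp (mcp _) mPhi).
have ab0 : - (a + b) <= 0 by rewrite oppr_le0 addr_ge0// ltW.
have Fb u : cmod (F u) <= y `^ (- (a + b)) by exact: bnd.
transitivity (cE P (fun w => F (V n w, (Z n w, M w)))); first by [].
rewrite (cE_independent2 (mV n) mZM iVZM mF Fb).
pose G (u : R * R) := cpowr (z + u.1%:C) (- a) * cpowr (z + u.2%:C) (- b).
have mG : cmeasurable G.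
  apply: cmeasurableM.
    exact: (cmeasurable_comp (mcp (- a)) measurable_fst).
  exact: (cmeasurable_comp (mcp (- b)) measurable_snd).
have na : - a <= 0 by rewrite oppr_le0 ltW.
have nb : - b <= 0 by rewrite oppr_le0 ltW.
have Gb u : cmod (G u) <= y `^ (- a) * y `^ (- b).
  by rewrite cmodM ler_pM ?cmod_ge0// bnd.
transitivity (cE P (fun w => G (Z n w, M w))).
  apply: cE_ext => w.
  have z0' : 0 < complex.Im (z + (M w)%:C) by rewrite Im_shift.
  (* The base point is $z+M$ and the increment $Z_n-M$, since $M+V(Z_n-M)=VZ_n+(1-V)M$. *)
  have := beta_mixture a_gt0 b_gt0 (mV n) (V01 n) (lawV n) (Z n w - M w) z0'.
  rewrite (_ : z + (M w)%:C + (Z n w - M w)%:C = z + (Z n w)%:C); last by rewrite rmorphB/=; ring.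
  rewrite /G /= => <-; apply: cE_ext => w'.
  rewrite /F /Phi /=; congr cpowr; rewrite -addrA; congr (_ + _).
  by rewrite -rmorphD/=; congr (_%:C); ring.
rewrite (cE_independent2 (mZ n) mM iZM mG Gb).
have ik k : P.-integrable setT (EFin \o (fun=> k : R)) by exact: integrable_cst_fun.
have mA : cmeasurable (fun w => cpowr (z + (Z n w)%:C) (- a)) by exact: (cmeasurable_comp (mcp _) (mZ n)).
have mB : cmeasurable (fun w => cpowr (z + (M w)%:C) (- b)) by exact: (cmeasurable_comp (mcp _) mM).
have -> : phi (- a) z = cE P (fun w => cpowr (z + (Z n w)%:C) (- a)).
  have lawZ' A : measurable A -> P (Z 0%N @^-1` A) = P (Z n @^-1` A) by move=> mA'; rewrite (lawZ n).
  rewrite /phi.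
  exact: (cE_same_law (mZ 0%N) (mZ n) lawZ' (mcp (- a)) (fun x => bnd (- a) x na)).
rewrite -(cE_Zl mB (ik (y `^ (- b))) (fun w => bnd _ _ nb)).
apply: cE_ext => w; rewrite /G /= mulrC.
rewrite -(cE_Zl mA (ik (y `^ (- a))) (fun w => bnd _ _ na)).
by apply: cE_ext => w'; rewrite mulrC.
Qed.

Definition bmean (n : nat) (w : T) : R := limn (fun m => tmean V Z m n w).

Lemma tmean_cvg n w : tmean V Z m n w @[m --> \oo] --> bmean n w.
Proof.
have tB m : 0 <= tmean V Z m n w <= B by apply: tmean_bounds => k; [exact: V01|exact: ZB].
have H : cvgn (fun m => tmean V Z m n w).
  apply: nondecreasing_is_cvgn.
    apply/nondecreasing_seqP => m; apply: tmean_nondecreasing => k; first exact: V01.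
    by have /andP[] := ZB k w.
  by exists B => _ [m _ <-]; have /andP[] := tB m.
exact: H.
Qed.

Lemma bmean_bounds n w : 0 <= bmean n w <= B.
Proof.
have tB m : 0 <= tmean V Z m n w <= B by apply: tmean_bounds => k; [exact: V01|exact: ZB].
have h : tmean V Z m n w @[m --> \oo] --> bmean n w by exact: tmean_cvg.
apply/andP; split.
  by apply: (limr_ge (cvgP _ h)); apply: nearW => m; have /andP[] := tB m.
by apply: (limr_le (cvgP _ h)); apply: nearW => m; have /andP[] := tB m.
Qed.

Lemma measurable_bmean n : measurable_fun setT (bmean n).
Proof.
apply: (@measurable_fun_cvg _ _ _ setT (fun m => tmean V Z m n)) => // [m|w _].
  exact: measurable_tmean.
exact: tmean_cvg.
Qed.

Lemma ccvg_cpowr_shift (z : R[i]) (s : R) (u : nat -> R) (l : R) : 0 < complex.Im z ->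
  u n @[n --> \oo] --> l -> ccvg (fun n => cpowr (z + (u n)%:C) s) (cpowr (z + l%:C) s).
Proof.
move=> z0 ul; have [h1 h2] := cderive_continuous (cderive_cpowr_shift s l z0).
by split; [exact: cvg_comp ul h1|exact: cvg_comp ul h2].
Qed.

Lemma ccvg_shiftS (u : nat -> R[i]) (l : R[i]) : ccvg u l -> ccvg (fun n => u n.+1) l.
Proof.
move=> [h1 h2]; split.
  by rewrite (cvg_shiftS (fun n => complex.Re (u n))).
by rewrite (cvg_shiftS (fun n => complex.Im (u n))).
Qed.

Lemma ccvg_unique (u : nat -> R[i]) (l l' : R[i]) : ccvg u l -> ccvg u l' -> l = l'.
Proof.
by move=> [h1 h2] [h3 h4]; apply: eq_ReIm; [exact: cvg_unique h1 h3|exact: cvg_unique h2 h4].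
Qed.

Lemma ccvgZ (k : R[i]) (u : nat -> R[i]) (l : R[i]) : ccvg u l -> ccvg (fun n => k * u n) (k * l).
Proof.
move=> [h1 h2]; split.
  rewrite cReM; under eq_fun do rewrite cReM.
  by apply: cvgB; apply: cvgM => //; exact: cvg_cst.
rewrite cImM; under eq_fun do rewrite cImM.
by apply: cvgD; apply: cvgM => //; exact: cvg_cst.
Qed.

Lemma cE_cpowr_cvg (n : nat) (z : R[i]) (s : R) : 0 < complex.Im z -> s <= 0 ->
  ccvg (fun m => cE P (fun w => cpowr (z + (tmean V Z m n w)%:C) s))
    (cE P (fun w => cpowr (z + (bmean n w)%:C) s)).
Proof.
move=> z0 s0.
apply: (@cE_dominated _ _ _ _ _ _ (fun=> complex.Im z `^ s)).
- move=> m; apply: (cmeasurable_comp (cpowr_shift_measurable s z0)).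
  exact: measurable_tmean.
- exact: integrable_cst_fun.
- by move=> m w; apply: cpowr_norm_le => //; rewrite Im_shift.
- by move=> w; apply: ccvg_cpowr_shift => //; exact: tmean_cvg.
Qed.

Definition bf (n : nat) (z : R[i]) : R[i] := cE P (fun w => cpowr (z + (bmean n w)%:C) (- th n)).

Lemma bmean_step (n : nat) (z : R[i]) : 0 < complex.Im z ->
  cE P (fun w => cpowr (z + (bmean n w)%:C) (- (th n + 1))) = phi (alpha - 1) z * bf n.+1 z.
Proof.
move=> z0; have tn := th_gt0 n; have tn1 := th_gt0 n.+1.
have s0 : - (th n + 1) <= 0 by lra.
have s1 : - th n.+1 <= 0 by lra.
have h1 := ccvg_shiftS (cE_cpowr_cvg n z0 s0).
have h2 := ccvgZ (phi (alpha - 1) z) (cE_cpowr_cvg n.+1 z0 s1).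
apply: ccvg_unique h1 _.
rewrite (_ : (fun k => _) = (fun m => phi (alpha - 1) z *
    cE P (fun w => cpowr (z + (tmean V Z m n.+1 w)%:C) (- th n.+1))))//.
by apply/funext => m; exact: tmean_step.
Qed.

Lemma cderive_bf (n : nat) (z : R[i]) (x : R) : 0 < complex.Im z ->
  cderive x (fun t => bf n (z + t%:C)) (- (th n)%:C * phi (alpha - 1) (z + x%:C) * bf n.+1 (z + x%:C)).
Proof.
move=> z0; have tn := th_gt0 n.
have s0 : - th n <= 0 by lra.
have s1 : - th n - 1 <= 0 by lra.
have zx t : 0 < complex.Im (z + t%:C) by rewrite Im_shift.
pose F t w := cpowr (z + t%:C + (bmean n w)%:C) (- th n).
pose dF t w := (- th n)%:C * cpowr (z + t%:C + (bmean n w)%:C) (- th n - 1).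
have ik k : P.-integrable setT (EFin \o (fun=> k : R)) by exact: integrable_cst_fun.
have mb s t : cmeasurable (fun w => cpowr (z + t%:C + (bmean n w)%:C) s).
  by apply: (cmeasurable_comp (cpowr_shift_measurable s (zx t))); exact: measurable_bmean.
have bb s t w : s <= 0 -> cmod (cpowr (z + t%:C + (bmean n w)%:C) s) <= complex.Im z `^ s.
  by move=> ?; apply: cpowr_norm_le => //; rewrite !Im_shift.
have := @cderive_cE R d T P F dF (fun _ _ => complex.Im z `^ (- th n))
   (`|- th n| * complex.Im z `^ (- th n - 1)) x (mb _) (fun _ => ik _) (fun t w => bb _ _ _ s0).
have h1 t w : cderive t (F^~ w) (dF t w).
  have z0' : 0 < complex.Im (z + (bmean n w)%:C) by rewrite Im_shift.
  have := cderive_cpowr_shift (- th n) t z0'.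
  rewrite addrAC; apply: cderive_ext => u; by rewrite /F addrAC.
have h2 t w : cmod (dF t w) <= `|- th n| * complex.Im z `^ (- th n - 1).
  by rewrite cmodM cmod_real ler_wpM2l// bb.
move=> /(_ h1 h2) H; apply: cderive_eq H _.
rewrite /dF (cE_Zl (mb (- th n - 1) x) (ik _) (fun w => bb _ _ w s1)).
have e : - (th n + 1) = - th n - 1 by rewrite opprD.
rewrite -mulrA -bmean_step// e; congr (_ * _).
by apply: eq_ReIm; rewrite /= ?oppr0.
Qed.

End BoundedMeans.

(** * The bounded case *)

Section Estimates.
Context {R : realType}.

Lemma cpowr_le (w : R[i]) (u s : R) : 0 < u -> u <= cmod w -> s <= 0 ->
  cmod (cpowr w s) <= u `^ s.
Proof.
move=> u0 uw s0; rewrite cmod_cpowr.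
have w0 : 0 < cmod w by rewrite (lt_le_trans u0).
rewrite -[s]opprK !(powRN _ (- s)) lef_pV2 ?posrE ?powR_gt0//.
by apply: ge0_ler_powR; rewrite ?oppr_ge0// nnegrE ltW.
Qed.

Lemma Re_le_cmod (w : R[i]) : complex.Re w <= cmod w.
Proof. exact: le_trans (ler_norm _) (normr_Re_le w). Qed.

Lemma is_derive_powR_comp (v : R -> R) (dv s x : R) : is_derive x (1 : R) v dv -> 0 < v x ->
  is_derive x (1 : R) (fun t => v t `^ s) (s * v x `^ (s - 1) * dv).
Proof. by move=> dvx v0; exact: (@is_derive1_comp _ (fun y => y `^ s) v x _ _ (is_derive1_powR s v0) dvx). Qed.

Lemma is_derive_addr (c x : R) : is_derive x (1 : R) (fun t => c + t) 1.
Proof.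
have := is_deriveD (is_derive_cst c x (1 : R)) (is_derive_id x (1 : R)).
by rewrite add0r.
Qed.

(** Since $|z+t|\ge x+t$ and $s\le1$, the derivative is dominated by that of the real power at the
    abscissa $x$. The factor [Num.sg s] treats increasing and decreasing powers at once. *)
Lemma cpowr_shift_diff (z : R[i]) (x M s : R) : 0 < complex.Im z -> 0 < x -> x <= complex.Re z ->
  0 <= M -> s <= 1 ->
  cmod (cpowr (z + M%:C) s - cpowr z s) <= Num.sg s * ((x + M) `^ s - x `^ s).
Proof.
move=> z0 x0 xz M0 s1.
have h := @cmod_le_derive R (fun t => cpowr (z + t%:C) s) (fun t => s%:C * cpowr (z + t%:C) (s - 1))
  (fun t => Num.sg s * (x + t) `^ s) (fun t => `|s| * (x + t) `^ (s - 1)) 0 M M0.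
have {h} := h _ _ _; rewrite !addr0 -mulrBr; apply.
- by move=> t _; exact: cderive_cpowr_shift.
- move=> t /andP[t0 _].
  have xt : 0 < x + t by rewrite ltr_wpDr.
  have := is_deriveZ (Num.sg s) (is_derive_powR_comp s (is_derive_addr x t) xt).
  by move=> h; apply: is_derive_eq h _; rewrite /GRing.scale /= mulr1 mulrA -normrEsg.
- move=> t /andP[t0 _]; rewrite cmodM cmod_real ler_wpM2l//.
  apply: cpowr_le; rewrite ?subr_le0// ?ltr_wpDr//.
  by apply: le_trans (Re_le_cmod _); rewrite cReD /= lerD2r.
Qed.

(** On the segment from $p$ to $q$ the modulus at time $\tau$ is at least $v-e\tau$, so
    $(v-e\tau)^s$ has the larger derivative. Convexity of the upper half-plane keeps the segment
    away from the cut. *)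
Lemma cpowr_path_diff (p q : R[i]) (v e s : R) : 0 < complex.Im p -> 0 < complex.Im q ->
  v <= cmod p -> cmod (q - p) <= e -> e < v -> s <= 0 ->
  cmod (cpowr q s - cpowr p s) <= (v - e) `^ s - v `^ s.
Proof.
move=> p0 q0 vp qp ev s0.
have e0 : 0 <= e by apply: le_trans qp; exact: cmod_ge0.
pose c (t : R) := cpowr (p + (q - p) * t%:C) s.
have dv (t : R) : is_derive t (1 : R) (fun t => v - e * t) (- e).
  have := is_deriveB (is_derive_cst v t (1 : R)) (is_deriveZ e (is_derive_id t (1 : R))).
  by move=> h; apply: is_derive_eq h _; rewrite sub0r /GRing.scale /= mulr1.
have h := @cmod_le_derive R c (fun t => s%:C * cpowr (p + (q - p) * t%:C) (s - 1) * (q - p))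
  (fun t => (v - e * t) `^ s) (fun t => s * (v - e * t) `^ (s - 1) * (- e)) 0 1 ler01.
have {h} := h _ _ _; rewrite /c mulr0 mulr1 mulr0 addr0 subr0 mulr1 (addrC p) subrK; apply.
- move=> t /andP[t0 t1].
  apply: cderive_cpowr.
    rewrite cImD cImM /= mulr0 add0r cImD cImN.
    rewrite (_ : _ + _ = (1 - t) * complex.Im p + t * complex.Im q); last by ring.
    have [->|tn0] := eqVneq t 0; first by rewrite subr0 mul1r mul0r addr0.
    rewrite ltr_wpDl// ?mulr_ge0 ?subr_ge0// ?ltW// mulr_gt0// lt_def tn0.
    by [].
  have := cderiveD (cderive_cst t p) (cderiveZ (q - p) (cderive_real t 0)).
  rewrite mulr1 add0r; apply: cderive_ext => u; by rewrite add0r.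
- move=> t /andP[t0 t1]; apply: is_derive_powR_comp => //.
  by rewrite subr_gt0 (le_lt_trans _ ev)// ler_piMr.
- move=> t /andP[t0 t1]; rewrite !cmodM cmod_real ler0_norm// mulrN -!mulNr.
  apply: ler_pM; rewrite ?cmod_ge0 ?mulr_ge0 ?cmod_ge0 ?oppr_ge0// ler_wpM2l ?oppr_ge0//.
  apply: cpowr_le; last by lra.
    by rewrite mulNr subr_gt0 (le_lt_trans _ ev)// ler_piMr.
  rewrite mulNr lerBlDr (le_trans vp)//.
  rewrite -{1}(addrK ((q - p) * t%:C) p).
  apply: le_trans (ler_cmodB _ _) _; rewrite lerD2l cmodM cmod_real ger0_norm//.
  by rewrite ler_wpM2r.
Qed.

(* Projection on the bisecting direction of the sector [0 < arg < s * pi]. *)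
Lemma cpowr_proj (w : R[i]) (s : R) : 0 < complex.Im w -> 0 < s < 1 ->
  cmod w `^ s * cos (s * (pi / 2)) <=
  complex.Re (cpolar 1 (- (s * (pi / 2))) * cpowr w s).
Proof.
move=> w0 /andP[s0 s1]; rewrite cpowrE cpolarM /= mul1r ler_wpM2l ?powR_ge0//.
rewrite parg_upper//; have := uarg_gt0 w; have := uarg_ltpi w; have ? := @pi_gt0 R.
move: (uarg w) => om h1 h2.
rewrite -[X in _ <= cos X](_ : s * (om - pi / 2) = _); last by ring.
rewrite (_ : cos (s * (om - _)) = cos `|s * (om - pi / 2)|); last first.
  by case: (ger0P (s * (om - pi / 2))) => // _; rewrite cosN.
have ps : s * (pi / 2) <= pi by rewrite -[leRHS]mul1r ler_pM// ?divr_ge0 ?ltW//; lra.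
have hs : `|s * (om - pi / 2)| <= s * (pi / 2).
  rewrite normrM (gtr0_norm s0) ler_wpM2l// ?(ltW s0)// ler_norml.
  by apply/andP; split; lra.
apply: (@ler0_derive1_le_cc _ (@cos R) 0 pi) => //.
- move=> x /[!in_itv]/= /andP[x0 xpi]; rewrite derive1E.
  by have [_ ->] := is_derive_cos x; rewrite oppr_le0 sin_ge0_pi// !ltW.
- exact/continuous_subspaceT/continuous_cos.
- by rewrite in_itv/= ps mulr_ge0 ?divr_ge0 ?ltW.
- by rewrite in_itv/= normr_ge0 (le_trans hs).
Qed.

Lemma power_increment (alpha x B : R) : 0 < alpha < 1 -> 0 < x -> 0 <= B ->
  (x + B) `^ alpha - x `^ alpha <= B * x `^ (alpha - 1).
Proof.
move=> /andP[a0 a1] x0 B0.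
have -> : x + B = x * (1 + B / x) by field; rewrite gt_eqF.
rewrite powRM ?(ltW x0) ?addr_ge0 ?divr_ge0 ?(ltW x0)//.
have h : (1 + B / x) `^ alpha <= 1 + B / x.
  by apply: ler1_powR; [rewrite lerDl divr_ge0// ltW|exact: ltW].
have -> : B * x `^ (alpha - 1) = x `^ alpha * (B / x).
  rewrite powRB; last by rewrite (gt_eqF x0) implybT.
  by rewrite powRr1 ?(ltW x0)//; ring.
rewrite -{2}(mulr1 (x `^ alpha)) -mulrBr ler_wpM2l ?powR_ge0//.
by rewrite lerBlDl.
Qed.

Lemma power_increment_small (alpha B e : R) : 0 < alpha < 1 -> 0 <= B -> 0 < e ->
  exists2 X, 0 < X & forall x, X <= x -> (x + B) `^ alpha <= x `^ alpha + e.
Proof.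
move=> a01 B0 e0; case/andP: (a01) => a0 a1.
have b0 : 0 < 1 - alpha by rewrite subr_gt0.
(* The condition needed is $Bx^{\alpha-1}\le e$, that is $x^{1-\alpha}\ge B/e$; the added 1 keeps
   the threshold positive when [B] is 0. *)
exists ((B / e + 1) `^ (1 - alpha)^-1).
  by rewrite powR_gt0// ltr_wpDl// divr_ge0// ltW.
move=> x Xx.
have x0 : 0 < x by apply: lt_le_trans Xx; rewrite powR_gt0// ltr_wpDl// divr_ge0// ltW.
rewrite -lerBlDl; apply: le_trans (power_increment a01 x0 B0) _.
have -> : alpha - 1 = - (1 - alpha) by rewrite opprB.
rewrite powRN ler_pdivrMr ?powR_gt0// mulrC -ler_pdivrMr//.
have : ((B / e + 1) `^ (1 - alpha)^-1) `^ (1 - alpha) <= x `^ (1 - alpha).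
  by apply: ge0_ler_powR; rewrite ?nnegrE ?powR_ge0// ltW.
rewrite -powRrM mulVf ?gt_eqF// powRr1; last by rewrite addr_ge0// divr_ge0// ltW.
by apply: le_trans; rewrite lerDl.
Qed.

(* Backward induction: both [h n] and [E n] solve the same linear hierarchy, so a bound at one level
   [N] descends to the level [0]. *)
Lemma hierarchy_descent (h dh : nat -> R -> R[i]) (E : nat -> R -> R) (p : nat -> R) (dv : R -> R)
    (D : R -> Prop) (N : nat) :
  (forall x b y, D x -> D b -> x <= y <= b -> D y) ->
  (forall n x, D x -> cderive x (h n) (dh n x)) ->
  (forall n x, D x -> cmod (dh n x) <= p n * dv x * cmod (h n.+1 x)) ->
  (forall n x, D x -> is_derive x (1 : R) (E n) (- (p n * dv x * E n.+1 x))) ->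
  (forall n x, D x -> 0 <= E n x) -> (forall n x, D x -> 0 <= p n * dv x) ->
  (forall n x e, D x -> 0 < e -> exists b, [/\ x <= b, D b & cmod (h n b) <= e]) ->
  (forall x, D x -> cmod (h N x) <= E N x) ->
  forall n x, (n <= N)%N -> D x -> cmod (h n x) <= E n x.
Proof.
move=> Dc hP dhP EP E0 pdv hb hN n x /subnK; move: (N - n)%N => k kN.
elim: k n x kN => [|k IH] n x kN Dx; first by move: kN; rewrite add0n => ->; exact: hN.
have {}IH y : D y -> cmod (h n.+1 y) <= E n.+1 y by move=> Dy; apply: IH => //; rewrite addnS.
(* Integration runs from [x] to a point [b] where [h n] is below the slack [e]; the majorant's value
   at [b] is nonnegative and is dropped. *)
apply/ler_addgt0Pr => e e0; have [b [xb Db hbe]] := hb n x e Dx e0.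
have Dy y : x <= y <= b -> D y by exact: Dc.
have := @cmod_le_derive R (h n) (dh n) (fun y => - E n y) (fun y => p n * dv y * E n.+1 y) x b xb.
have H1 y : x <= y <= b -> cderive y (h n) (dh n y) by move=> /Dy; exact: hP.
have H2 y : x <= y <= b -> is_derive y (1 : R) (fun y => - E n y) (p n * dv y * E n.+1 y).
  by move=> /Dy h'; have := is_deriveN (EP n y h'); rewrite opprK.
have H3 y : x <= y <= b -> cmod (dh n y) <= p n * dv y * E n.+1 y.
  by move=> /Dy h'; apply: le_trans (dhP n y h') _; rewrite ler_wpM2l ?pdv ?IH.
move=> /(_ H1 H2 H3) H.
have : cmod (h n x) <= cmod (h n b - h n x) + cmod (h n b).
  by rewrite cmodB; apply: le_trans (ler_cmodD _ _); rewrite subrK.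
have := E0 n b Db; move: H hbe; lra.
Qed.

End Estimates.

(** * Positivity and lower bounds for Phi *)

Section Positivity.
Context {R : realType} {d} {T : measurableType d} (P : probability T R).

Lemma Rint_gt0 (f : T -> R) : P.-integrable setT (EFin \o f) -> (forall w, 0 <= f w) ->
  P (f @^-1` [set 0]) != 1%E -> 0 < Rintegral P setT f.
Proof.
move=> i f0 Pf; rewrite lt_def Rintegral_ge0// andbT; apply: contra_neq Pf => I0.
have mf : measurable_fun setT (EFin \o f) by have /integrableP[] := i.
have /(ae_eq_integral_abs _ measurableT mf).1 : (\int[P]_x `|(EFin \o f) x| = 0)%E.
  transitivity (\int[P]_x (f x)%:E)%E.
    by apply: eq_integral => w _ /=; rewrite ger0_norm.
  rewrite -[LHS]fineK; first by rewrite (_ : fine _ = Rintegral P setT f)// I0.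
  exact: integrable_fin_num.
move=> [N [mN N0 sN]].
have mZ : measurable (f @^-1` [set 0]).
  by rewrite -[X in measurable X]setTI; apply: (measurable_EFinP _ _).1 mf _ _ _ => //.
have ZC0 : P (~` (f @^-1` [set 0])) = 0%E.
  apply/eqP; rewrite eq_le measure_ge0 andbT -N0; apply: le_measure; rewrite ?inE//.
    exact: measurableC.
  by move=> w /= fw; apply: sN => /= /(_ I) [] h; exact: fw.
by rewrite -[f @^-1` _]setCK probability_setC ?ZC0 ?sube0//; exact: measurableC.
Qed.

Section Phi.
Variables (X : T -> R) (alpha : R) (z : R[i]) (g : T -> R).
Hypotheses (mX : measurable_fun setT X) (alpha01 : 0 < alpha < 1) (z0 : 0 < complex.Im z)
  (ig : P.-integrable setT (EFin \o g))
  (Xg : forall w, cmod (cpowr (z + (X w)%:C) alpha) <= g w).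

Let mF : cmeasurable (fun w => cpowr (z + (X w)%:C) alpha).
Proof. exact: (cmeasurable_comp (cpowr_shift_measurable alpha z0) mX). Qed.

Lemma Im_cE_cpowr_gt0 : 0 < complex.Im (cE P (fun w => cpowr (z + (X w)%:C) alpha)).
Proof.
have pos w : 0 < complex.Im (cpowr (z + (X w)%:C) alpha).
  by apply: cpowr_Im => //; rewrite Im_shift.
apply: Rint_gt0; first exact: integrable_Im ig Xg.
  by move=> w; exact: ltW.
have -> : (fun w => complex.Im (cpowr (z + (X w)%:C) alpha)) @^-1` [set 0] = set0.
  apply/seteqP; split => // w h.
  have h' : complex.Im (cpowr (z + (X w)%:C) alpha) = 0 := h.
  by have := pos w; rewrite h' ltxx.
by rewrite measure0 eq_sym onee_eq0.
Qed.

(** All values of the power lie in a sector of angle $\alpha\pi<\pi$. After rotation of its bisector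
    to the real axis every value has a real part at least this large, so averaging cannot cancel. *)
Lemma cmod_cE_cpowr_ge :
  complex.Im z `^ alpha * cos (alpha * (pi / 2)) <= cmod (cE P (fun w => cpowr (z + (X w)%:C) alpha)).
Proof.
set F := fun w => _.
have ca : 0 <= cos (alpha * (pi / 2)).
  apply: cos_ge0_pihalf; have ? := @pi_gt0 R; case/andP: alpha01 => a0 a1.
  apply/andP; split; first by rewrite (@le_trans _ _ 0)// ?oppr_le0 ?mulr_ge0 ?divr_ge0// ltW.
  by rewrite ler_piMl ?divr_ge0// ltW.
pose k : R[i] := cpolar 1 (- (alpha * (pi / 2))).
have k1 : cmod k = 1 by rewrite cmod_cpolar.
apply: le_trans (_ : complex.Re (k * cE P F) <= _); last first.
  by apply: le_trans (Re_le_cmod _) _; rewrite cmodM k1 mul1r.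
have mkF : cmeasurable (fun w => k * F w) by apply: cmeasurableM => //; exact: cmeasurable_cst.
have kFg w : cmod (k * F w) <= g w by rewrite cmodM k1 mul1r Xg.
rewrite -(cE_Zl mF ig Xg) /=.
rewrite -[leLHS](Rint_cst P); apply: le_Rintegral => //.
- exact: integrable_cst_fun.
- exact: integrable_Re mkF ig kFg.
move=> w _; apply: le_trans (cpowr_proj _ alpha01); last by rewrite Im_shift.
rewrite ler_wpM2r//; apply: ge0_ler_powR; rewrite ?nnegrE ?cmod_ge0 ?(ltW z0)//.
  by case/andP: alpha01 => /ltW.
by rewrite -(Im_shift z (X w)); apply: le_trans (ler_norm _) (normr_Im_le _).
Qed.

End Phi.
End Positivity.

(** * Uniqueness for the hierarchy *)

Section BoundedIdentity.
Context {R : realType} {d} {T : measurableType d} (P : probability T R).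
Variables (V Z : nat -> T -> R) (alpha theta B : R).
Hypotheses (alpha01 : 0 < alpha < 1) (theta0 : 0 < theta) (B0 : 0 < B)
  (mV : forall n, measurable_fun setT (V n)) (mZ : forall n, measurable_fun setT (Z n))
  (V01 : forall n w, 0 <= V n w <= 1) (ZB : forall n w, 0 <= Z n w <= B)
  (VZ : mutually_independent P
    (fun i : nat + nat => match i with inl k => V k | inr k => Z k end))
  (lawV : forall (k : nat) (A : set R), measurable A ->
     P (V k @^-1` A) = beta_law (1 - alpha) (theta + k.+1%:R * alpha) A)
  (lawZ : forall (k : nat) (A : set R), measurable A -> P (Z k @^-1` A) = P (Z 0%N @^-1` A)).

Let tn := th alpha theta.
Let ph := phi P Z.
Let f n z := bf P V Z alpha theta n z.
Let p n : R := tn n / alpha.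
Let g n z := cpowr (ph alpha z) (- p n).

Let a0 : 0 < alpha. Proof. by case/andP: alpha01. Qed.
Let a1 : alpha < 1. Proof. by case/andP: alpha01. Qed.

Let tn_gt0 n : 0 < tn n. Proof. exact: th_gt0. Qed.
Let p_gt0 n : 0 < p n. Proof. by rewrite divr_gt0. Qed.
Let pS n : p n.+1 = p n + 1.
Proof. by rewrite /p /tn thS mulrDl divff// gt_eqF. Qed.
Let p_ge n : n%:R <= p n.
Proof. by rewrite /p /tn /th mulrDl mulfK ?gt_eqF// lerDr divr_ge0// ltW. Qed.
Let pE n : p n * alpha = tn n. Proof. by rewrite divfK// gt_eqF. Qed.
Let npE n : - tn n = alpha * - p n. Proof. by rewrite mulrN mulrC pE. Qed.

Let ik k : P.-integrable setT (EFin \o (fun=> k : R)).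
Proof. exact: integrable_cst_fun. Qed.

Let mcz s z : 0 < complex.Im z -> cmeasurable (fun w => cpowr (z + (Z 0%N w)%:C) s).
Proof. by move=> z0; exact: (cmeasurable_comp (cpowr_shift_measurable s z0)). Qed.

Let mcb n s z : 0 < complex.Im z ->
  cmeasurable (fun w => cpowr (z + (bmean V Z n w)%:C) s).
Proof.
move=> z0; apply: (cmeasurable_comp (cpowr_shift_measurable s z0)).
exact: (measurable_bmean mV mZ V01 ZB).
Qed.

Let cz_bound z w : cmod (cpowr (z + (Z 0%N w)%:C) alpha) <= (cmod z + B) `^ alpha.
Proof.
rewrite cmod_cpowr; apply: ge0_ler_powR; rewrite ?nnegrE ?cmod_ge0 ?addr_ge0 ?cmod_ge0 ?(ltW a0) ?(ltW B0)//.
apply: le_trans (ler_cmodD _ _) _; rewrite lerD2l cmod_real.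
by have /andP[h1 h2] := ZB 0%N w; rewrite ger0_norm.
Qed.

Let cz_neg_bound s z w : 0 < complex.Im z -> s <= 0 ->
  cmod (cpowr (z + (Z 0%N w)%:C) s) <= complex.Im z `^ s.
Proof. by move=> z0 s0; apply: cpowr_norm_le => //; rewrite Im_shift. Qed.

Let Im_ph z : 0 < complex.Im z -> 0 < complex.Im (ph alpha z).
Proof. by move=> z0; apply: (@Im_cE_cpowr_gt0 _ _ _ P _ _ _ (fun=> (cmod z + B) `^ alpha)) => // w; exact: cz_bound. Qed.

Let ph_ge z : 0 < complex.Im z -> complex.Im z `^ alpha * cos (alpha * (pi / 2)) <= cmod (ph alpha z).
Proof. by move=> z0; apply: (@cmod_cE_cpowr_ge _ _ _ P _ _ _ (fun=> (cmod z + B) `^ alpha)) => // w; exact: cz_bound. Qed.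

Let cderive_ph z x : 0 < complex.Im z ->
  cderive x (fun t => ph alpha (z + t%:C)) (alpha%:C * ph (alpha - 1) (z + x%:C)).
Proof.
move=> z0.
have zx t : 0 < complex.Im (z + t%:C) by rewrite Im_shift.
have s1 : alpha - 1 <= 0 by rewrite subr_le0 ltW.
pose F t w := cpowr (z + t%:C + (Z 0%N w)%:C) alpha.
pose dF t w := alpha%:C * cpowr (z + t%:C + (Z 0%N w)%:C) (alpha - 1).
have h1 t w : cderive t (F^~ w) (dF t w).
  have z0' : 0 < complex.Im (z + (Z 0%N w)%:C) by rewrite Im_shift.
  have := cderive_cpowr_shift alpha t z0'.
  rewrite addrAC; apply: cderive_ext => u; by rewrite /F addrAC.
have h2 t w : cmod (dF t w) <= `|alpha| * complex.Im z `^ (alpha - 1).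
  rewrite cmodM cmod_real ler_wpM2l// -(Im_shift z t); exact: cz_neg_bound.
have H := @cderive_cE R d T P F dF (fun t _ => (cmod (z + t%:C) + B) `^ alpha)
   _ x (fun t => mcz alpha (zx t)) (fun _ => ik _) (fun t w => cz_bound _ w) h1 h2.
apply: cderive_eq H _.
by rewrite /dF (cE_Zl (mcz (alpha - 1) (zx x)) (ik _) (fun w => cz_neg_bound w (zx x) s1)).
Qed.

Let h n z := f n z - g n z.

(** The two hierarchies agree because $p_n\alpha=\theta_n$ and $p_{n+1}=p_n+1$. *)
Let cderive_h n z x : 0 < complex.Im z ->
  cderive x (fun t => h n (z + t%:C)) (- (tn n)%:C * ph (alpha - 1) (z + x%:C) * h n.+1 (z + x%:C)).
Proof.
move=> z0; have zx t : 0 < complex.Im (z + t%:C) by rewrite Im_shift.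
have d1 := cderive_bf alpha01 theta0 mV mZ V01 ZB VZ lawV lawZ n x z0.
have d2 := cderive_cpowr (- p n) (Im_ph (zx x)) (cderive_ph x z0).
apply: cderive_eq (cderiveB d1 d2) _.
rewrite /h mulrBr; congr (_ - _).
rewrite /g pS opprD -pE.
have -> : (p n * alpha)%:C = (p n)%:C * alpha%:C by rewrite rmorphM.
have -> : (- p n)%:C = - (p n)%:C by apply: eq_ReIm; rewrite /= ?oppr0.
rewrite /ph; move: (phi P Z (alpha - 1) (z + x%:C)) (cpowr _ (- p n - 1)) => q q'.
by ring.
Qed.

Let ph_neg z u : 0 < complex.Im z -> 0 < u -> u <= cmod z ->
  (forall w, u <= cmod (z + (Z 0%N w)%:C)) -> cmod (ph (alpha - 1) z) <= u `^ (alpha - 1).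
Proof.
move=> z0 u0 uz H.
have s1 : alpha - 1 <= 0 by rewrite subr_le0 ltW.
rewrite -[leRHS](Rint_cst P); apply: (cmod_cE_le (mcz _ z0) (ik _)) => w.
exact: cpowr_le.
Qed.

Let f_bound n z u : 0 < complex.Im z -> 0 < u ->
  (forall m, 0 <= m -> u <= cmod (z + m%:C)) -> cmod (f n z) <= (u `^ alpha) `^ (- p n).
Proof.
move=> z0 u0 H; rewrite -powRrM -npE -[leRHS](Rint_cst P).
apply: (cmod_cE_le (mcb n _ z0) (ik _)) => w; apply: cpowr_le => //.
  by apply: H; have /andP[] := bmean_bounds V01 ZB n w.
by rewrite oppr_le0 ltW.
Qed.

Let Im_le (z : R[i]) : complex.Im z <= cmod z.
Proof. exact: le_trans (ler_norm _) (normr_Im_le z). Qed.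

Let K (z : R[i]) : R := complex.Im z `^ alpha * cos (alpha * (pi / 2)).

Let K_gt0 z : 0 < complex.Im z -> 0 < K z.
Proof.
move=> z0; rewrite mulr_gt0 ?powR_gt0//; apply: cos_gt0_pihalf; have ? := @pi_gt0 R.
apply/andP; split; first by rewrite (@lt_trans _ _ 0)// ?oppr_lt0 ?mulr_gt0 ?divr_gt0.
by rewrite gtr_pMl ?divr_gt0.
Qed.

(** Crude, but geometric in the level and dependent on the height of [z] only: the growth control
    that uniqueness rests on. *)
Let h_bound n z : 0 < complex.Im z -> cmod (h n z) <= 2 * K z `^ (- p n).
Proof.
move=> z0; have np : - p n <= 0 by rewrite oppr_le0 ltW.
rewrite mulr_natl mulr2n; apply: le_trans (ler_cmodB _ _) _; apply: lerD.
  apply: le_trans (f_bound n z0 z0 _) _.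
    by move=> m _; rewrite -(Im_shift z m).
  rewrite !powRN lef_pV2 ?posrE ?powR_gt0 ?K_gt0//.
  have KI : K z <= complex.Im z `^ alpha by rewrite /K ler_piMr ?powR_ge0// cos_le1.
  by apply: ge0_ler_powR; rewrite ?nnegrE ?powR_ge0 ?(ltW (p_gt0 n)) ?(ltW (K_gt0 z0)).
by apply: cpowr_le; [exact: K_gt0|exact: ph_ge|].
Qed.

Let le_mul_eps (x c : R) : (forall k, 0 < k -> x <= k * c) -> x <= 0.
Proof.
move=> H; have [c0|c0] := leP c 0; first by rewrite (le_trans (H 1 ltr01))// mul1r.
apply/ler_addgt0Pr => e e0; rewrite add0r.
by have := H (e / c) (divr_gt0 e0 c0); rewrite divfK// gt_eqF.
Qed.

(** Bernoulli's inequality together with $p_N\ge N$. *)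
Let pow_large (q k : R) (n : nat) : 1 < q -> 0 < k -> exists2 N, (n <= N)%N & k <= q `^ p N.
Proof.
move=> q1 k0.
have q0 : 0 < q - 1 by rewrite subr_gt0.
have [N hN] : exists N : nat, k / (q - 1) <= N%:R.
  exists (Num.bound (k / (q - 1))); apply/ltW/archi_boundP.
  by rewrite divr_ge0// ltW.
exists (maxn n N); first exact: leq_maxl.
apply: (@le_trans _ _ (q `^ (maxn n N)%:R)); last by apply: ler_powR; rewrite ?p_ge// ltW.
rewrite powR_mulrn; last by rewrite ltW// (lt_trans _ q1).
apply: (@le_trans _ _ (1 + (q - 1) *+ maxn n N)); last first.
  have bern m : 1 + (q - 1) *+ m <= q ^+ m.
    elim: m => [|m IH]; first by rewrite mulr0n addr0 expr0.
    rewrite exprS mulrSr; have := ler_pM (_ : 0 <= q) _ (lexx q) IH.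
    have hm : 0 <= (q - 1) *+ m by rewrite mulrn_wge0// ltW.
    move=> /(_ _ _); move: hm; move: (_ *+ m) => x hx H.
    apply: le_trans (H _ _); [by nra|by lra|by lra].
  exact: bern.
rewrite -mulr_natr mulrC -[leLHS]add0r lerD//.
move: hN; rewrite ler_pdivrMr// => /le_trans; apply.
by rewrite ler_wpM2r ?(ltW q0)// ler_nat leq_maxr.
Qed.

(* [K z] bounds [|Phi|] from below on the whole line, so that [k * v ^ (- p n)] with [v] affine is a majorant
   on an interval whose length does not depend on [x1]. *)
Let step_left z : 0 < complex.Im z -> exists2 del : R, 0 < del &
  forall x1, (forall n, h n (z + x1%:C) = 0) ->
    forall n x, x1 - del <= x <= x1 -> h n (z + x%:C) = 0.
Proof.
move=> z0; have zx t : 0 < complex.Im (z + t%:C) by rewrite Im_shift.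
pose L := alpha * complex.Im z `^ (alpha - 1).
have L0 : 0 < L by rewrite mulr_gt0// powR_gt0.
have Kz := K_gt0 z0.
have KE t : K (z + t%:C) = K z by rewrite /K Im_shift.
(* [L] dominates $\alpha|E(z+Z_0)^{\alpha-1}|$ on the line and is the slope of [v] below. Starting
   from [K z / 2] at [x1], [v] stays above [K z / 4] over the length [del], and its upper bound
   [K z / 2] leaves a factor $2^{p_N}$ against the crude bound. *)
pose del := K z / (4 * L).
have dL : del * L = K z / 4 by rewrite /del; field; rewrite gt_eqF.
have del0 : 0 < del by rewrite divr_gt0// mulr_gt0.
exists del => // x1 H1 n x xx1.
apply/eqP; rewrite -cmod_eq0 eq_le cmod_ge0 andbT.
pose v t := K z / 2 - L * (x1 - t).
pose D t := x1 - del <= t <= x1.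
have v_ge t : D t -> K z / 4 <= v t <= K z / 2.
  move=> /andP[h1 h2]; rewrite /v; have : L * (x1 - t) <= K z / 4.
    by rewrite -dL mulrC ler_wpM2r ?(ltW L0)//; lra.
  have : 0 <= L * (x1 - t) by rewrite mulr_ge0 ?subr_ge0// ltW.
  by move=> *; apply/andP; split; lra.
have v_gt0 t : D t -> 0 < v t by move=> /v_ge /andP[hh _]; apply: lt_le_trans hh; rewrite divr_gt0.
have dv t : is_derive t (1 : R) v L.
  have := is_deriveB (is_derive_cst (K z / 2) t (1 : R))
    (is_deriveZ L (is_deriveB (is_derive_cst x1 t (1 : R)) (is_derive_id t (1 : R)))).
  by move=> hh; apply: is_derive_eq hh _; rewrite /GRing.scale /=; ring.
apply: (@le_mul_eps _ (v x `^ (- p n))) => k k0.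
have [N nN kN] := @pow_large 2 (2 / k) n (ltr1n _ 2) (divr_gt0 (ltr0n _ 2) k0).
pose E m t := k * v t `^ (- p m).
apply: (@hierarchy_descent R (fun m t => h m (z + t%:C)) _ E p (fun=> L) D N _
   (fun m t _ => cderive_h m t z0)) => //.
- by move=> t b y /andP[t1 t2] /andP[b1 b2] /andP[y1 y2]; apply/andP; split; lra.
- move=> m t _; rewrite !cmodM cmodN cmod_real gtr0_norm// ler_wpM2r ?cmod_ge0//.
  rewrite -pE /L mulrA; apply: ler_wpM2l; first exact: mulr_ge0 (ltW (p_gt0 m)) (ltW a0).
  apply: ph_neg => // [|w]; first by rewrite -[leLHS](Im_shift z t) Im_le.
  by rewrite -[leLHS](Im_shift z t) -(Im_shift (z + t%:C) (Z 0%N w)) Im_le.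
- move=> m t Dt.
  have := is_deriveZ k (is_derive_powR_comp (- p m) (dv t) (v_gt0 t Dt)).
  by move=> hh; apply: is_derive_eq hh _; rewrite /E pS opprD /GRing.scale /=; ring.
- by move=> m t _; rewrite mulr_ge0 ?powR_ge0// ltW.
- by move=> m t _; rewrite mulr_ge0 ?(ltW L0)// ltW.
- move=> m t e Dt e0; exists x1; split; first by case/andP: Dt.
    by rewrite /D lexx andbT lerBlDr lerDl ltW.
  by rewrite H1 cmod0 ltW.
- move=> t Dt; apply: le_trans (h_bound N (zx t)) _; rewrite KE /E.
  have /andP[v1 v2] := v_ge t Dt; have vt := v_gt0 t Dt.
  apply: (@le_trans _ _ (k * (K z / 2) `^ (- p N))); last first.
    rewrite ler_wpM2l ?(ltW k0)// !powRN lef_pV2 ?posrE ?powR_gt0 ?divr_gt0//.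
    by apply: ge0_ler_powR; rewrite ?nnegrE ?(ltW (p_gt0 N)) ?(ltW vt) ?divr_ge0 ?(ltW Kz).
  rewrite powRM ?invr_ge0 ?(ltW Kz)// mulrCA mulrC ler_wpM2l ?powR_ge0//.
  rewrite -powR_inv1// -powRrM mulN1r opprK -ler_pdivrMl//.
  by rewrite mulrC.
Qed.

Let zero_left z x1 : 0 < complex.Im z -> (forall n x, x1 <= x -> h n (z + x%:C) = 0) ->
  forall n x, h n (z + x%:C) = 0.
Proof.
move=> z0 H; have [del del0 step] := step_left z0.
have IH k : forall n x, x1 - k%:R * del <= x -> h n (z + x%:C) = 0.
  elim: k => [|k IHk] n x; first by rewrite mul0r subr0; exact: H.
  move=> xk; have [h1|h1] := leP (x1 - k%:R * del) x; first exact: IHk.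
  apply: (step (x1 - k%:R * del)) => [m|]; first by apply: IHk.
  rewrite (ltW h1) andbT; move: xk; rewrite -natr1 mulrDl mul1r; lra.
move=> n x; apply: (IH (Num.bound ((x1 - x) / del)).+1).
have [h1|h1] := leP (x1 - x) 0.
  by rewrite lerBlDr (le_trans (_ : x1 <= x)) ?lerDl ?mulr_ge0 ?(ltW del0)//; lra.
have := archi_boundP (_ : 0 <= (x1 - x) / del); rewrite divr_ge0 ?(ltW h1) ?(ltW del0)// => /(_ isT).
rewrite ltr_pdivrMr// => h2; rewrite -natr1 mulrDl mul1r.
move: h2; move: (_ * del) => y; lra.
Qed.

Let powR_anti (s u w : R) : s <= 0 -> 0 < u -> u <= w -> w `^ s <= u `^ s.
Proof.
move=> s0 u0 uw; have w0 : 0 < w by exact: lt_le_trans uw.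
rewrite -[s]opprK !(powRN _ (- s)) lef_pV2 ?posrE ?powR_gt0//.
by apply: ge0_ler_powR; rewrite ?oppr_ge0// nnegrE ltW.
Qed.

(** Serves both terms of [h]: with exponent [alpha] for the atom [Z 0], and with exponent [- tn n]
    for the mean. *)
Let cE_shift_diff (X : T -> R) z x s : measurable_fun setT X -> (forall w, 0 <= X w <= B) ->
  0 < complex.Im z -> 0 < x -> complex.Re z = x -> s <= 1 ->
  cmod (cE P (fun w => cpowr (z + (X w)%:C) s) - cpowr z s) <= Num.sg s * ((x + B) `^ s - x `^ s).
Proof.
move=> mX XB z0 x0 zx s1.
pose k := cpowr z s.
have mono w : Num.sg s * ((x + X w) `^ s - x `^ s) <= Num.sg s * ((x + B) `^ s - x `^ s).
  have /andP[X0 X1] := XB w.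
  have xX : 0 < x + X w by rewrite ltr_wpDr.
  have xB : x + X w <= x + B by rewrite lerD2l.
  have [s_lt0|s_gt0|->] := ltgtP s 0; last by rewrite sgr0 !mul0r.
    by rewrite ltr0_sg// !mulN1r lerN2 lerB// powR_anti// ltW.
  rewrite gtr0_sg// !mul1r lerB//.
  by apply: ge0_ler_powR; rewrite ?nnegrE ?(ltW s_gt0) ?(ltW xX) ?(le_trans (ltW xX) xB).
have mF : cmeasurable (fun w => cpowr (z + (X w)%:C) s).
  exact: (cmeasurable_comp (cpowr_shift_measurable s z0) mX).
have mFk : cmeasurable (fun w => cpowr (z + (X w)%:C) s + - k).
  by apply: cmeasurableD => //; exact: cmeasurable_cst.
have bFk w : cmod (cpowr (z + (X w)%:C) s + - k) <= Num.sg s * ((x + B) `^ s - x `^ s).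
  apply: le_trans (mono w); apply: cpowr_shift_diff => //; first by rewrite zx.
  by have /andP[] := XB w.
have bF w : cmod (cpowr (z + (X w)%:C) s) <= Num.sg s * ((x + B) `^ s - x `^ s) + cmod k.
  rewrite -[cpowr _ s](subrK k); apply: le_trans (ler_cmodD _ _) _; rewrite lerD2r; exact: bFk.
have <- : cE P (fun w => cpowr (z + (X w)%:C) s + - k) =
    cE P (fun w => cpowr (z + (X w)%:C) s) - k.
  rewrite (cE_D mF (cmeasurable_cst (- k)) (ik _) (ik (cmod (- k))) bF (fun=> lexx _)).
  by rewrite cE_cst.
rewrite -[leRHS](Rint_cst P); exact: (cmod_cE_le mFk (ik _) bFk).
Qed.

(** Atoms in $[0,B]$ move the abscissa by at most $B$, and the increments of $t^\alpha$ over such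
    shifts tend to 0; so both terms of [h n] approach $(z+t)^{-\theta_n}$ far to the right, and the
    majorant can be made small. *)
Let vanish_far z : 0 < complex.Im z -> complex.Re z = 0 ->
  forall n x, (B + 2) `^ alpha^-1 <= x -> h n (z + x%:C) = 0.
Proof.
move=> z0 Rz; have zx t : 0 < complex.Im (z + t%:C) by rewrite Im_shift.
have Rzx t : complex.Re (z + t%:C) = t by rewrite cReD Rz add0r.
(* Beyond [x1] one has $t\ge1$ and $t^\alpha\ge B+2$. The former gives $|\Phi-(z+t)^\alpha|\le B$,
   the latter keeps [v t - B] and [v t - (B + 1)] positive. *)
set x1 := (B + 2) `^ alpha^-1.
pose v (t : R) := t `^ alpha.
pose D t := x1 <= t.
have x1_gt0 : 0 < x1 by rewrite powR_gt0// addr_gt0.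
have D0 t : D t -> 0 < t by exact: lt_le_trans.
have B2 : 0 <= B + 2 by rewrite ltW// addr_gt0.
have vD t : D t -> B + 2 <= v t.
  move=> Dt; have -> : B + 2 = x1 `^ alpha by rewrite /x1 -powRrM mulVf ?gt_eqF// powRr1.
  by apply: ge0_ler_powR; rewrite ?nnegrE ?(ltW a0) ?(ltW x1_gt0) ?(ltW (D0 t Dt)).
have D1 t : D t -> t `^ (alpha - 1) <= 1.
  move=> Dt; rewrite -[leRHS](_ : 1 `^ (alpha - 1) = 1); last by rewrite powR1.
  apply: powR_anti => //; first by rewrite subr_le0 ltW.
  apply: le_trans Dt; rewrite /x1 -[leLHS](powRr0 (B + 2)); apply: ler_powR.
    by move: B0; lra.
  by rewrite invr_ge0 ltW.
have np n : - p n <= 0 by rewrite oppr_le0 ltW.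
have vp t n : D t -> t `^ (- tn n) = v t `^ (- p n) by move=> _; rewrite /v -powRrM npE.
have phd t : D t -> cmod (ph alpha (z + t%:C) - cpowr (z + t%:C) alpha) <= (t + B) `^ alpha - t `^ alpha.
  move=> Dt; have := cE_shift_diff (mZ 0%N) (ZB 0%N) (zx t) (D0 t Dt) (Rzx t) (ltW a1).
  by rewrite gtr0_sg// mul1r.
have phB t : D t -> cmod (ph alpha (z + t%:C) - cpowr (z + t%:C) alpha) <= B.
  move=> Dt; apply: le_trans (phd t Dt) _.
  apply: le_trans (power_increment alpha01 (D0 t Dt) (ltW B0)) _.
  by rewrite ler_piMr ?(ltW B0)// D1.
have vc t : D t -> v t <= cmod (cpowr (z + t%:C) alpha).
  move=> Dt; rewrite cmod_cpowr; apply: ge0_ler_powR; rewrite ?nnegrE ?(ltW a0) ?cmod_ge0 ?(ltW (D0 t Dt))//.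
  by rewrite -{1}(Rzx t) Re_le_cmod.
have crude n t : D t -> cmod (h n (z + t%:C)) <= 2 * (v t - B) `^ (- p n).
  move=> Dt; have vt := vD t Dt.
  rewrite mulr_natl mulr2n; apply: le_trans (ler_cmodB _ _) _; apply: lerD.
    apply: le_trans (f_bound n (zx t) (D0 t Dt) _) _.
      by move=> m m0; apply: le_trans (Re_le_cmod _); rewrite cReD Rzx lerDl.
    by apply: powR_anti => //; [move: B0; lra|rewrite gerBl ltW].
  apply: cpowr_le => //; first by move: B0; lra.
  rewrite lerBlDr; apply: le_trans (vc t Dt) _.
  rewrite -{1}(subrKC (ph alpha (z + t%:C)) (cpowr _ _)); apply: le_trans (ler_cmodD _ _) _.
  by rewrite lerD2l cmodB phB.
have near n t e : D t -> 0 < e -> e < 1 -> (t + B) `^ alpha <= v t + e ->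
    cmod (h n (z + t%:C)) <= (v t - e) `^ (- p n) - (v t + e) `^ (- p n).
  move=> Dt e0 e1 te; have vt := vD t Dt; have t0 := D0 t Dt.
  (* Both terms are compared with $(z+t)^{-\theta_n}$: the mean costs the upper half of the
     difference, $v^{-p_n}-(v+e)^{-p_n}$, and the power of Phi the lower half,
     $(v-e)^{-p_n}-v^{-p_n}$. *)
  have -> : h n (z + t%:C) = (f n (z + t%:C) - cpowr (z + t%:C) (- tn n)) -
     (g n (z + t%:C) - cpowr (z + t%:C) (- tn n)) by rewrite /h; ring.
  apply: le_trans (ler_cmodB _ _) _.
  have -> : (v t - e) `^ (- p n) - (v t + e) `^ (- p n) =
    (v t `^ (- p n) - (v t + e) `^ (- p n)) + ((v t - e) `^ (- p n) - v t `^ (- p n)) by ring.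
  apply: lerD.
    have := @cE_shift_diff (bmean V Z n) _ _ (- tn n) (measurable_bmean mV mZ V01 ZB n)
       (bmean_bounds V01 ZB n) (zx t) t0 (Rzx t) _.
    rewrite ltr0_sg ?oppr_lt0// mulN1r opprB => H; apply: le_trans (H _) _.
      by rewrite (le_trans _ ler01)// oppr_le0 ltW.
    rewrite vp// lerD2l lerN2 npE powRrM.
    apply: powR_anti => //.
    by rewrite powR_gt0// addr_gt0.
  rewrite npE -cpowrM//.
  apply: cpowr_path_diff => //; [exact: cpowr_Im|exact: Im_ph|exact: vc| |by move: B0; lra].
  by apply: le_trans (phd t Dt) _; rewrite lerBlDl.
move=> n x Dx; apply/eqP; rewrite -cmod_eq0 eq_le cmod_ge0 andbT.
have dv t : D t -> is_derive t (1 : R) v (alpha * t `^ (alpha - 1)).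
  by move=> Dt; exact: is_derive1_powR (D0 t Dt).
have key e k : 0 < e -> e < 1 -> 0 < k ->
  cmod (h n (z + x%:C)) <= ((v x - e) `^ (- p n) - (v x + e) `^ (- p n)) + k * (v x - (B + 1)) `^ (- p n).
  move=> e0 e1 k0.
  have [X X0 HX] := power_increment_small alpha01 (ltW B0) e0.
  (* A lower bound, for $t\le X$, on the ratio of [v t - B] to [v t - (B + 1)], which equals
     $1+(v(t)-(B+1))^{-1}$. *)
  pose q := 1 + (v X + B + 2)^-1.
  have q1 : 1 < q by rewrite ltrDl invr_gt0 addr_gt0 ?addr_gt0 ?powR_gt0.
  have [N nN kN] := @pow_large q (2 / k) n q1 (divr_gt0 (ltr0n _ 2) k0).
  (* The difference dominates [h m] for [t >= X], where the increments of [v] are below [e]; the last term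
     dominates the crude bound on the compact range [t <= X] once [m] is large. *)
  pose E m t := ((v t - e) `^ (- p m) - (v t + e) `^ (- p m)) + k * (v t - (B + 1)) `^ (- p m).
  have E0 m t : D t -> 0 <= (v t - e) `^ (- p m) - (v t + e) `^ (- p m).
    move=> Dt; have := vD t Dt => vt; rewrite subr_ge0; apply: powR_anti => //; move: B0; lra.
  have E1 m t : 0 <= k * (v t - (B + 1)) `^ (- p m) by rewrite mulr_ge0 ?powR_ge0// ltW.
  apply: (@hierarchy_descent R (fun m t => h m (z + t%:C)) _ E p (fun t => alpha * t `^ (alpha - 1)) D N _
     (fun m t _ => cderive_h m t z0)) => //.
  - by move=> t b y Dt _ /andP[ty _]; exact: le_trans ty.
  - move=> m t Dt; rewrite !cmodM cmodN cmod_real gtr0_norm// ler_wpM2r ?cmod_ge0//.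
    rewrite -pE mulrA; apply: ler_wpM2l; first exact: mulr_ge0 (ltW (p_gt0 m)) (ltW a0).
    apply: ph_neg => // [||w]; first exact: D0.
      by rewrite -{1}(Rzx t) Re_le_cmod.
    apply: le_trans (Re_le_cmod _); rewrite cReD Rzx lerDl.
    by have /andP[] := ZB 0%N w.
  - move=> m t Dt; have vt := vD t Dt; have t0 := D0 t Dt.
    have dvc (cc : R) : is_derive t (1 : R) (fun t => v t + cc) (alpha * t `^ (alpha - 1)).
      have := is_deriveD (dv t Dt) (is_derive_cst cc t (1 : R)).
      by rewrite addr0.
    have p1 : 0 < v t + - e by move: B0; lra.
    have p2 : 0 < v t + e by move: B0; lra.
    have p3 : 0 < v t + - (B + 1) by move: B0; lra.
    have := is_deriveD (is_deriveB (is_derive_powR_comp (- p m) (dvc (- e)) p1)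
       (is_derive_powR_comp (- p m) (dvc e) p2))
      (is_deriveZ k (is_derive_powR_comp (- p m) (dvc (- (B + 1))) p3)).
    by move=> hh; apply: is_derive_eq hh _; rewrite /E pS (opprD (p m)) /GRing.scale /=; ring.
  - by move=> m t Dt; rewrite addr_ge0// E0.
  - by move=> m t _; exact: mulr_ge0 (ltW (p_gt0 m)) (mulr_ge0 (ltW a0) (powR_ge0 _ _)).
  - move=> m t r Dt r0.
    (* Chosen so that $v(y)-B=(2/r)^{1/p_m}$, where the crude bound equals [r]. *)
    pose y := (B + (2 / r) `^ (p m)^-1) `^ alpha^-1.
    have Dm : D (Num.max t y) by apply: le_trans Dt _; rewrite le_max lexx.
    exists (Num.max t y); split => //; first by rewrite le_max lexx.
    apply: le_trans (crude m _ Dm) _.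
    have r2 : 0 < (2 / r) `^ (p m)^-1 by rewrite powR_gt0// divr_gt0.
    have vy : B + (2 / r) `^ (p m)^-1 <= v (Num.max t y).
      have -> : B + (2 / r) `^ (p m)^-1 = y `^ alpha.
        by rewrite /y -powRrM mulVf ?gt_eqF// powRr1// addr_ge0// ltW.
      apply: ge0_ler_powR; rewrite ?nnegrE ?powR_ge0 ?(ltW a0) ?(ltW (D0 _ Dm))//.
      by rewrite le_max lexx orbT.
    apply: (@le_trans _ _ (2 * ((2 / r) `^ (p m)^-1) `^ (- p m))).
      rewrite ler_wpM2l//; apply: powR_anti => //; by rewrite lerBrDl.
    rewrite -powRrM mulrN mulVf ?gt_eqF// powR_inv1 ?divr_ge0 ?(ltW r0)//.
    by rewrite invf_div mulrCA divff// mulr1.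
  - move=> t Dt; have vt := vD t Dt.
    have [Xt|tX] := leP X t.
      by rewrite -[leLHS]addr0; apply: lerD => //; apply: near => //; exact: HX.
    rewrite -[leLHS]add0r; apply: lerD; first exact: E0.
    apply: le_trans (crude N t Dt) _.
    have w0 : 0 < v t - (B + 1) by move: B0; lra.
    have -> : v t - B = (v t - (B + 1)) * (1 + (v t - (B + 1))^-1).
      by field; rewrite gt_eqF.
    have i0 : 0 <= (v t - (B + 1))^-1 by rewrite invr_ge0 ltW.
    have vXi : 0 <= (v X + B + 2)^-1 by rewrite invr_ge0 !addr_ge0 ?powR_ge0 ?(ltW B0).
    rewrite powRM ?(ltW w0) ?addr_ge0// mulrA [2 * _]mulrC -mulrA mulrC ler_wpM2r ?powR_ge0//.
    rewrite powRN ler_pdivrMr ?powR_gt0 ?ltr_wpDr// -ler_pdivrMl// mulrC.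
    apply: le_trans kN _; apply: ge0_ler_powR; rewrite ?nnegrE ?(ltW (p_gt0 N)) ?addr_ge0 ?vXi//.
    rewrite lerD2l lef_pV2 ?posrE//; last by rewrite addr_gt0 ?addr_gt0 ?powR_gt0.
    have : v t <= v X.
      by apply: ge0_ler_powR; rewrite ?nnegrE ?(ltW a0) ?(ltW X0) ?(ltW (D0 t Dt)) ?(ltW tX).
    by move: B0; lra.
(* [k] is sent to 0 first, which removes the term for the compact range; [e] follows, and the
   remaining difference vanishes by continuity. *)
have key' e : 0 < e -> e < 1 -> cmod (h n (z + x%:C)) <= (v x - e) `^ (- p n) - (v x + e) `^ (- p n).
  move=> e0 e1; rewrite -subr_le0; apply: (@le_mul_eps _ ((v x - (B + 1)) `^ (- p n))) => k k0.
  by rewrite lerBlDl; exact: key.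
have vx := vD x Dx; have vx0 : 0 < v x by move: B0; lra.
have cvg0 : (v x - e) `^ (- p n) - (v x + e) `^ (- p n) @[e --> 0^'+] --> 0.
  apply: cvg_at_right_filter.
  have d1 : is_derive (0 : R) (1 : R) (fun e => v x + e) 1 by exact: is_derive_addr.
  have d2 : is_derive (0 : R) (1 : R) (fun e => v x - e) (- 1).
    have := is_deriveB (is_derive_cst (v x) (0 : R) (1 : R)) (is_derive_id (0 : R) (1 : R)).
    by rewrite sub0r.
  have p1 : 0 < v x + 0 by rewrite addr0.
  have p2 : 0 < v x - 0 by rewrite subr0.
  have e0 : (v x - 0) `^ (- p n) - (v x + 0) `^ (- p n) = 0 by rewrite subr0 addr0 subrr.
  rewrite -[X in _ --> X]e0.
  exact: is_derive_continuous (is_deriveB (is_derive_powR_comp (- p n) d2 p2) (is_derive_powR_comp (- p n) d1 p1)).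
apply: (cvgr_to_ge cvg0).
near=> e; apply: key'; near: e; [exact: nbhs_right_gt|exact: nbhs_right_lt].
Unshelve. all: by end_near. Qed.

Theorem bounded_identity z : 0 < complex.Im z ->
  cE P (fun w => cpowr (z + (bmean V Z 0 w)%:C) (- theta)) =
  cpowr (cE P (fun w => cpowr (z + (Z 0%N w)%:C) alpha)) (- (theta / alpha)).
Proof.
(* The line through [z] is parametrised from its point on the imaginary axis, so that the parameter
   is the abscissa. *)
move=> z0; pose z' : R[i] := Complex 0 (complex.Im z).
have zE : z = z' + (complex.Re z)%:C by apply: eq_ReIm; rewrite /= ?add0r ?addr0.
have := zero_left (_ : 0 < complex.Im z') (vanish_far (_ : 0 < complex.Im z') (erefl _)) 0%N (complex.Re z).
move=> /(_ z0 z0); rewrite -zE /h /f /g /bf /p /tn /th mul0r addr0.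
by move/eqP; rewrite subr_eq0 => /eqP.
Qed.

End BoundedIdentity.

(** * The unbounded case *)

Section ArgumentContinuity.
Context {R : realType}.

(** Includes the negative real axis, where the principal branch takes the value $\pi$, its limit
    from above. *)
Lemma parg_atan (w : R[i]) : 0 <= complex.Im w -> complex.Re w != 0 ->
  parg w = atan (complex.Im w / complex.Re w) + (if complex.Re w < 0 then pi else 0).
Proof.
case: w => u v /= v0 u0; set ph := atan _.
have ? := @pi_gt0 R; have h1 := atan_gtNpi2 (v / u); have h2 := atan_ltpi2 (v / u).
have cph : cmod (u +i* v) * cos ph = `|u|.
  rewrite cos_atan /cmod /=.
  have -> : u ^+ 2 + v ^+ 2 = u ^+ 2 * (1 + (v / u) ^+ 2) by field.
  rewrite sqrtrM ?sqr_ge0// sqrtr_sqr mulfK// gt_eqF// sqrtr_gt0 ltr_wpDr// sqr_ge0.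
  by [].
have sph : cmod (u +i* v) * sin ph = `|u| * (v / u).
  have c0 : cos ph != 0 by rewrite gt_eqF// cos_gt0_pihalf// h1.
  rewrite -cph -mulrA; congr (_ * _).
  have : tan ph = v / u by rewrite atanK.
  by move=> <-; rewrite /tan mulrCA divff// mulr1.
have w0 : u +i* v != 0 by apply: contra_neq u0 => -[].
have cm0 : 0 < cmod (u +i* v) by rewrite cmod_gt0.
have e : u +i* v = cpolar (cmod (u +i* v)) (ph + (if u < 0 then pi else 0)).
  apply: eq_ReIm; rewrite /cpolar /=; case: ifPn => [un|]; rewrite -?leNgt => *.
  - by rewrite cosDpi mulrN cph ltr0_norm// opprK.
  - by rewrite addr0 cph ger0_norm.
  - by rewrite sinDpi mulrN sph ltr0_norm// mulNr opprK mulrC divfK.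
  - by rewrite addr0 sph ger0_norm// mulrC divfK.
move: h1 h2; rewrite -/ph => h1 h2.
rewrite {1}e parg_cpolar//; case: ifPn => [un|]; rewrite -?leNgt => *; last by lra.
have vu : v / u <= 0 by rewrite mulr_ge0_le0// invr_le0 ltW.
have : ph <= 0 by rewrite -(@atan0 R) /ph le_atan.
by lra.
Qed.

Lemma cvg_seq_comp (h : R -> R) (u : nat -> R) (l : R) : {for l, continuous h} ->
  u n @[n --> \oo] --> l -> h (u n) @[n --> \oo] --> h l.
Proof. by move=> ch ul; exact: (cvg_comp _ _ ul ch). Qed.

Lemma ccvg_cmod (u : nat -> R[i]) (l : R[i]) : ccvg u l -> cmod (u n) @[n --> \oo] --> cmod l.
Proof.
move=> [h1 h2]; rewrite /cmod.
apply: (cvg_seq_comp (h := @Num.sqrt R)); first exact: sqrt_continuous.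
by apply: cvgD; apply: cvgM.
Qed.

(** Approach from the open upper half-plane makes the argument continuous up to the cut. The formula
    [uarg] serves limits on the imaginary axis, [parg_atan] all others. *)
Lemma ccvg_parg (u : nat -> R[i]) (l : R[i]) : (forall n, 0 < complex.Im (u n)) -> l != 0 ->
  ccvg u l -> parg (u n) @[n --> \oo] --> parg l.
Proof.
move=> u0 l0 [h1 h2].
have Il : 0 <= complex.Im l by apply: (cvgr_to_ge h2); apply: nearW => n; exact: ltW.
have [Rl|Rl] := eqVneq (complex.Re l) 0.
  have Il0 : 0 < complex.Im l.
    by rewrite lt_def Il andbT; apply: contra_neq l0 => h; exact: eq_ReIm.
  rewrite parg_upper//; under eq_fun do rewrite parg_upper//.
  apply: cvgB; first exact: cvg_cst.
  apply: (cvg_seq_comp (h := @atan R)); first exact: continuous_atan.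
  by apply: cvgM => //; apply: cvgV => //; rewrite gt_eqF.
rewrite parg_atan//.
have [Rn|Rp] := ltP (complex.Re l) 0.
  apply: (@cvg_trans _ ((fun n => atan (complex.Im (u n) / complex.Re (u n)) + pi) n @[n --> \oo])).
    have [N _ HN] := cvgr_lt _ h1 _ Rn; apply: near_eq_cvg; exists N => // n /= /HN /= Rn'.
    by rewrite parg_atan ?lt_eqF// ?Rn' // ltW.
  apply: cvgD; last exact: cvg_cst.
  apply: (cvg_seq_comp (h := @atan R)); first exact: continuous_atan.
  by apply: cvgM => //; apply: cvgV => //; rewrite gt_eqF.
have Rp' : 0 < complex.Re l by rewrite lt_def Rl.
apply: (@cvg_trans _ ((fun n => atan (complex.Im (u n) / complex.Re (u n)) + 0) n @[n --> \oo])).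
  have [N _ HN] := cvgr_gt _ h1 _ Rp'; apply: near_eq_cvg; exists N => // n /= /HN /= Rn'.
  by rewrite parg_atan ?gt_eqF// ?ltNge ?(ltW Rn') // ltW.
apply: cvgD; last exact: cvg_cst.
apply: (cvg_seq_comp (h := @atan R)); first exact: continuous_atan.
by apply: cvgM => //; apply: cvgV.
Qed.

Lemma ccvg_cpowr (u : nat -> R[i]) (l : R[i]) (s : R) : (forall n, 0 < complex.Im (u n)) ->
  l != 0 -> ccvg u l -> ccvg (fun n => cpowr (u n) s) (cpowr l s).
Proof.
move=> u0 l0 ul.
have cm : cmod (u n) `^ s @[n --> \oo] --> cmod l `^ s.
  have l_gt0 : 0 < cmod l by rewrite cmod_gt0.
  exact: (cvg_seq_comp (h := fun y => y `^ s) (is_derive_continuous (is_derive1_powR s l_gt0)) (ccvg_cmod ul)).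
have pa : s * parg (u n) @[n --> \oo] --> s * parg l.
  by apply: cvgM; [exact: cvg_cst|exact: ccvg_parg].
split; apply: cvgM => //.
  exact: (cvg_seq_comp (@continuous_cos R _) pa).
exact: (cvg_seq_comp (@continuous_sin R _) pa).
Qed.

(** The arguments need not converge; the modulus alone forces the limit. *)
Lemma ccvg_cpowr0 (u : nat -> R[i]) (s : R) : 0 < s -> ccvg u 0 ->
  ccvg (fun n => cpowr (u n) s) 0.
Proof.
move=> s0 ul.
have cm : cmod (u n) `^ s @[n --> \oo] --> 0.
  apply/cvgrPdist_lt => e e0.
  have e1 : 0 < e `^ s^-1 by rewrite powR_gt0.
  have := ccvg_cmod ul; rewrite cmod0 => /cvgrPdist_lt /(_ _ e1).
  apply: filterS => n; rewrite !sub0r !normrN ger0_norm ?cmod_ge0// ger0_norm ?powR_ge0// => h.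
  have -> : e = (e `^ s^-1) `^ s by rewrite -powRrM mulVf ?gt_eqF// powRr1// ltW.
  by apply: gt0_ltr_powR; rewrite ?nnegrE ?cmod_ge0 ?powR_ge0.
have sq (b : nat -> R) : (forall n, `|b n| <= 1) -> (cmod (u n) `^ s * b n) @[n --> \oo] --> 0.
  move=> b1; apply/cvgrPdist_lt => e e0; move/cvgrPdist_lt : cm => /(_ _ e0).
  apply: filterS => n; rewrite !sub0r !normrN normrM; apply: le_lt_trans.
  by rewrite ler_piMr.
split; apply: sq => n.
  by rewrite ler_norml cos_geN1 cos_le1.
by rewrite ler_norml sin_geN1 sin_le1.
Qed.

(** A fraction in $(0,1]$ is at most its $s$-th power, and the fractions $a/(a+b)$ and $b/(a+b)$ sum
    to 1. *)
Lemma powR_subadditive (a b s : R) : 0 <= a -> 0 <= b -> 0 < s < 1 ->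
  (a + b) `^ s <= a `^ s + b `^ s.
Proof.
move=> a0 b0 /andP[s0 s1].
have [->|an0] := eqVneq a 0; first by rewrite add0r powR0 ?gt_eqF// add0r.
have [->|bn0] := eqVneq b 0; first by rewrite addr0 powR0 ?gt_eqF// addr0.
have ap : 0 < a by rewrite lt_def an0.
have bp : 0 < b by rewrite lt_def bn0.
have ab : 0 < a + b by rewrite addr_gt0.
have H x : 0 < x -> x <= a + b -> x / (a + b) * (a + b) `^ s <= x `^ s.
  move=> x0 xab; have {2}-> : x = x / (a + b) * (a + b) by rewrite divfK// gt_eqF.
  rewrite powRM ?divr_ge0 ?(ltW x0) ?(ltW ab)// ler_wpM2r ?powR_ge0//.
  by apply: ger1_powR; [rewrite divr_gt0// ler_pdivrMr// mul1r|exact: ltW].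
have := lerD (H a ap _) (H b bp _); rewrite lerDl lerDr a0 b0 => /(_ isT isT).
by rewrite -mulrDl -mulrDl divff ?gt_eqF// mul1r.
Qed.

End ArgumentContinuity.

(** * Measurability of pointwise limits *)

Section MeasurableLimit.
Context {R : realType} {d} {T : measurableType d}.

(** Only countable quantifiers appear, so the set of convergence of a sequence of measurable
    functions is measurable. *)
Lemma cvgn_cauchyP (u : nat -> R) : cvgn u <->
  forall k : nat, exists N : nat, forall n : nat, `|u (N + n)%N - u N| <= k.+1%:R^-1.
Proof.
split=> [/cvg_ex[l ul] k|H].
  have e0 : 0 < k.+1%:R^-1 / 2 :> R by rewrite divr_gt0// invr_gt0.
  move/cvgrPdist_le : ul => /(_ _ e0)[N _ HN].
  exists N => n; have h1 := HN N (leqnn N); have h2 := HN (N + n)%N (leq_addr _ _).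
  rewrite (_ : _ - _ = (l - u N) - (l - u (N + n)%N)); last by ring.
  apply: le_trans (ler_normB _ _) _.
  by rewrite [leRHS](splitr _) lerD.
apply/cauchy_cvgP; apply/cauchy_exP => e e0.
have [k ke] : exists k : nat, k.+1%:R^-1 < e :> R.
  have := @cvg_harmonic R; move/cvgrPdist_lt => /(_ _ e0)[k _ hk].
  exists k; have := hk k (leqnn k); rewrite sub0r normrN /harmonic /= ger0_norm// invr_ge0.
have [N HN] := H k; exists (u N); exists N => // n /= Nn.
rewrite /ball /= distrC; apply: le_lt_trans ke.
by rewrite -(subnKC Nn).
Qed.

(** Where the sequence diverges [limn] returns the default [point]; restricting every term to the
    set of convergence, with the same default outside, gives a sequence that converges everywhere to
    [limn]. *)
Lemma measurable_limn (u : nat -> T -> R) : (forall n, measurable_fun setT (u n)) ->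
  measurable_fun setT (fun w => limn (u^~ w)).
Proof.
move=> mu.
pose C := [set w | cvgn (u^~ w)].
have mC : measurable C.
  have -> : C = \bigcap_k \bigcup_N \bigcap_n [set w | `|u (N + n)%N w - u N w| <= k.+1%:R^-1].
    apply/seteqP; split => w.
      move=> Cw k _; have [N HN] := (cvgn_cauchyP _).1 Cw k; exists N => // n _; exact: HN.
    move=> H; apply/cvgn_cauchyP => k; have [N _ HN] := H k I; exists N => n; exact: HN.
  apply: bigcap_measurable => // k _; apply: bigcup_measurable => N _.
  apply: bigcap_measurable => // n _.
  have mf : measurable_fun setT (fun w => `|u (N + n)%N w - u N w|).
    by apply: measurableT_comp => //; exact: measurable_funB.
  have := mf measurableT `]-oo, k.+1%:R^-1]%classic (measurable_itv _).
  rewrite setTI; congr measurable; apply/seteqP; split => w /=; by rewrite in_itv.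
apply: (@measurable_fun_cvg _ _ _ setT (fun n => (u n) \_ C)) => [n|w _].
  by apply/(measurable_restrictT _ mC); exact: measurable_funTS.
have [Cw|Cw] := pselect (C w).
  have -> : (fun n => ((u n) \_ C) w) = u^~ w by apply/funext => n; rewrite patchE mem_set.
  exact: Cw.
have -> : (fun n => ((u n) \_ C) w) = fun=> point by apply/funext => n; rewrite patchE memNset.
by rewrite dvgP//; exact: cvg_cst.
Qed.

End MeasurableLimit.

(** * Removing the truncation pathwise *)

Section UnboundedMeans.
Context {R : realType} {d} {T : measurableType d}.
Implicit Types (V Z : nat -> T -> R) (w : T).

Lemma clampE (B x : R) : x <= B -> clamp B x = Num.max 0 x.
Proof. by move=> xB; rewrite /clamp (min_idPl xB). Qed.

Lemma clamp_le_max0 (B x : R) : clamp B x <= Num.max 0 x.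
Proof. by rewrite /clamp ge_max !le_max !ge_min !lexx /= orbT. Qed.

Lemma tmean_le V Z Z' m n w : (forall n, 0 <= V n w <= 1) -> (forall n, Z n w <= Z' n w) ->
  tmean V Z m n w <= tmean V Z' m n w.
Proof.
move=> V01 ZZ; elim: m n => [|m IH] n //=.
have /andP[v0 v1] := V01 n.
by rewrite lerD// ler_wpM2l// subr_ge0.
Qed.

Lemma tmean_eq V Z Z' m n w : (forall k, (k < n + m)%N -> Z k w = Z' k w) ->
  tmean V Z m n w = tmean V Z' m n w.
Proof.
elim: m n => [|m IH] n ZZ //=; rewrite ZZ ?addnS ?ltnS ?leq_addr//; congr (_ + _ * _).
by apply: IH => k; rewrite addSnnS; exact: ZZ.
Qed.

Variables (V Z : nat -> T -> R).
Hypothesis V01 : forall n w, 0 <= V n w <= 1.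

Definition upart (n : nat) (w : T) : R := Num.max 0 (Z n w).
(** The level is [m.+1] because the bounded case asks for a positive bound. *)
Definition trunc (m n : nat) (w : T) : R := clamp m.+1%:R (Z n w).

Lemma trunc_bounds m n w : 0 <= trunc m n w <= m.+1%:R.
Proof. by rewrite clamp_ge0 clamp_le. Qed.

Lemma upart_ge0 n w : 0 <= upart n w.
Proof. by rewrite le_max lexx. Qed.

Lemma trunc_tmean_le m N w : tmean V (trunc m) N 0 w <= tmean V upart N 0 w.
Proof. by apply: tmean_le => n; [exact: V01|exact: clamp_le_max0]. Qed.

Lemma upart_tmean_nd w : {homo (fun N => tmean V upart N 0 w) : n m / (n <= m)%N >-> n <= m}.
Proof.
apply/nondecreasing_seqP => N; apply: tmean_nondecreasing => n; first exact: V01.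
exact: upart_ge0.
Qed.

Lemma trunc_tmeanE N w : exists m0, forall m, (m0 <= m)%N ->
  tmean V (trunc m) N 0 w = tmean V upart N 0 w.
Proof.
have [m0 Hm] : exists m0 : nat, forall k, (k < N)%N -> Z k w <= m0%:R.
  elim: N => [|N [m0 IH]]; first by exists 0%N.
  exists (maxn m0 (Num.truncn (Z N w)).+1) => k; rewrite ltnS leq_eqVlt => /orP[/eqP ->|/IH h].
    apply: le_trans (_ : (Num.truncn (Z N w)).+1%:R <= _); last by rewrite ler_nat leq_maxr.
    by rewrite ltW// truncnS_gt.
  by apply: (le_trans h); rewrite ler_nat leq_maxl.
exists m0 => m m0m; apply: tmean_eq => k; rewrite add0n => /Hm h.
by apply: clampE; rewrite (le_trans h)// ler_nat (leq_trans m0m).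
Qed.

Lemma bmean_trunc_ge m N w : tmean V (trunc m) N 0 w <= bmean V (trunc m) 0 w.
Proof.
have cv := tmean_cvg V01 (trunc_bounds m) (n := 0%N) (w := w).
rewrite -(cvg_lim _ cv)//; apply: nondecreasing_cvgn_le; last exact: cvgP cv.
apply/nondecreasing_seqP => k; apply: tmean_nondecreasing => n; first exact: V01.
by have /andP[] := trunc_bounds m n w.
Qed.

(** Interchange of two limits by a sandwich: truncated means stay below the full limit, while each
    partial sum is attained exactly once the truncation exceeds the finitely many atoms that it
    uses. *)
Lemma bmean_trunc_cvg w : (exists K : nat, forall N, tmean V upart N 0 w <= K%:R) ->
  bmean V (trunc m) 0 w @[m --> \oo] --> limn (fun N => tmean V upart N 0 w).
Proof.
move=> [K SK]; set S := fun N => tmean V upart N 0 w.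
have Scv : cvgn S.
  by apply: nondecreasing_is_cvgn; [exact: upart_tmean_nd|exists K%:R => _ [N _ <-]; exact: SK].
have up m : bmean V (trunc m) 0 w <= limn S.
  have cv := tmean_cvg V01 (trunc_bounds m) (n := 0%N) (w := w).
  apply: (cvgr_to_le cv); apply: nearW => N; apply: le_trans (trunc_tmean_le m N w) _.
  exact: (nondecreasing_cvgn_le (@upart_tmean_nd w)).
apply/cvgrPdist_le => e e0.
have lt_e : limn S - e < limn S by rewrite ltrBlDr ltrDl.
have [N _ HN] := cvgr_ge _ Scv _ lt_e.
have {}HN := HN N (leqnn N).
have [m0 Hm] := trunc_tmeanE N w; exists m0 => // m /= /Hm h.
rewrite ger0_norm ?subr_ge0// lerBlDr -lerBlDl; apply: le_trans (bmean_trunc_ge m N w).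
by rewrite h; exact: HN.
Qed.

Lemma bmean_trunc_cvgy w : ~ (exists K : nat, forall N, tmean V upart N 0 w <= K%:R) ->
  bmean V (trunc m) 0 w @[m --> \oo] --> +oo.
Proof.
move=> unb; apply/cvgryPge => A.
have [N HN] : exists N, A < tmean V upart N 0 w.
  apply: contrapT => H; apply: unb; exists (Num.truncn A).+1 => N.
  by rewrite (le_trans _ (ltW (truncnS_gt A)))// leNgt; apply/negP => h; apply: H; exists N.
have [m0 Hm] := trunc_tmeanE N w; exists m0 => // m /= /Hm h.
by apply: le_trans (bmean_trunc_ge m N w); rewrite h ltW.
Qed.

Lemma ccvg_cpowr_infty (z : R[i]) (s : R) (u : nat -> R) : s < 0 ->
  u n @[n --> \oo] --> +oo -> ccvg (fun n => cpowr (z + (u n)%:C) s) 0.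
Proof.
move=> s0 uy.
have key e : 0 < e -> \forall n \near \oo, cmod (cpowr (z + (u n)%:C) s) <= e.
  move=> e0; move/cvgryPge : uy => /(_ (e `^ s^-1 - complex.Re z)); apply: filterS => n h.
  have -> : e = (e `^ s^-1) `^ s by rewrite -powRrM mulVf ?lt_eqF// powRr1// ltW.
  apply: cpowr_le; rewrite ?powR_gt0// ?(ltW s0)//.
  by apply: le_trans (Re_le_cmod _); rewrite cReD /= -lerBlDl.
split; apply/cvgrPdist_le => e /key; apply: filterS => n h; rewrite sub0r normrN.
  exact: le_trans (normr_Re_le _) h.
exact: le_trans (normr_Im_le _) h.
Qed.

(** An integer bound makes the event a countable union. *)
Definition finite_mean : set T := [set w | exists K : nat, forall N, tmean V upart N 0 w <= K%:R].

(* [(z + M)^s] for [s < 0], with value [0] where the extended mean [M] is infinite. *)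
Definition mean_transform (s : R) (z : R[i]) (w : T) : R[i] :=
  if w \in finite_mean then cpowr (z + (limn (fun N => tmean V upart N 0 w))%:C) s else 0.

Lemma mean_transform_cvg (s : R) (z : R[i]) (w : T) : 0 < complex.Im z -> s < 0 ->
  ccvg (fun m => cpowr (z + (bmean V (trunc m) 0 w)%:C) s) (mean_transform s z w).
Proof.
move=> z0 s0; rewrite /mean_transform; case: ifPn => [/set_mem h|/negP h].
  by apply: ccvg_cpowr_shift => //; exact: bmean_trunc_cvg.
by apply: ccvg_cpowr_infty => //; apply: bmean_trunc_cvgy => H; apply: h; exact: mem_set.
Qed.

End UnboundedMeans.

(** * The identity for the extended mean, and its almost sure finiteness *)

Section UnboundedIdentity.
Context {R : realType} {d} {T : measurableType d} (P : probability T R).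
Implicit Types (V Z : nat -> T -> R).

Lemma mutually_independent_comp {I : eqType} (X : I -> T -> R) (f : I -> R -> R) :
  (forall i, measurable_fun setT (f i)) -> mutually_independent P X ->
  mutually_independent P (fun i => f i \o X i).
Proof.
move=> mf PX s B us mB; apply: (PX s (fun i => f i @^-1` B i)) => // i.
exact: measurable_pre.
Qed.

Lemma ae_of_probability1 (E : set T) : measurable E -> P E = 1%E -> \forall w \ae P, E w.
Proof.
move=> mE PE; exists (~` E); split; first exact: measurableC.
  by rewrite probability_setC// PE subee.
by move=> w.
Qed.

Lemma cmeasurable_cvg (X_ : nat -> T -> R[i]) (X : T -> R[i]) : (forall n, cmeasurable (X_ n)) ->
  (forall w, ccvg (X_^~ w) (X w)) -> cmeasurable X.
Proof.
move=> mX cv; split.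
  apply: (@measurable_fun_cvg _ _ _ setT (fun n w => complex.Re (X_ n w))) => [n|w _].
    exact: (mX n).1.
  exact: (cv w).1.
apply: (@measurable_fun_cvg _ _ _ setT (fun n w => complex.Im (X_ n w))) => [n|w _].
  exact: (mX n).2.
exact: (cv w).2.
Qed.

Lemma cE_ae (X Y : T -> R[i]) : cmeasurable X -> cmeasurable Y ->
  (\forall w \ae P, X w = Y w) -> cE P X = cE P Y.
Proof.
move=> [m1 m2] [m3 m4] XY; rewrite /cE /Rintegral; congr (fine _ +i* fine _); apply: ae_eq_integral => //;
  try (by apply/measurable_EFinP); by apply: filterS XY => w -> _.
Qed.

Variables (V Z : nat -> T -> R) (alpha theta : R) (eta : probability R R).
Hypotheses (alpha01 : 0 < alpha < 1) (theta0 : 0 < theta)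
  (eta0 : eta `[0%R, +oo[ = 1%E)
  (eta_alpha : (\int[eta]_(x in `[0%R, +oo[) (x `^ alpha)%:E < +oo)%E)
  (mV : forall k, measurable_fun setT (V k)) (mZ : forall k, measurable_fun setT (Z k))
  (VZ : mutually_independent P
    (fun i : nat + nat => match i with inl k => V k | inr k => Z k end))
  (lawV : forall (k : nat) (A : set R), measurable A ->
     P (V k @^-1` A) = beta_law (1 - alpha) (theta + k.+1%:R * alpha) A)
  (lawZ : forall (k : nat) (A : set R), measurable A -> P (Z k @^-1` A) = eta A).

Let a0 : 0 < alpha. Proof. by case/andP: alpha01. Qed.
Let a1 : alpha < 1. Proof. by case/andP: alpha01. Qed.

(** The bounded case asks for sticks in the unit interval pointwise; the beta law gives this only
    almost surely, and clamping does not change the law. *)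
Let V' (n : nat) (w : T) : R := clamp 1 (V n w).

Let V'01 n w : 0 <= V' n w <= 1. Proof. by rewrite clamp_ge0 clamp_le. Qed.

Let mV' n : measurable_fun setT (V' n).
Proof. exact: (measurableT_comp (measurable_clamp 1) (mV n)). Qed.

Let mtrunc m n : measurable_fun setT (trunc Z m n).
Proof. exact: (measurableT_comp (measurable_clamp _) (mZ n)). Qed.

Lemma measurable_max0 : measurable_fun setT (fun x : R => Num.max 0 x).
Proof. by apply: measurable_maxr => //; exact: measurable_cst. Qed.

Let mupart n : measurable_fun setT (upart Z n).
Proof. exact: (measurableT_comp measurable_max0 (mZ n)). Qed.

Let S N w := tmean V' (upart Z) N 0 w.

Let mS N : measurable_fun setT (S N).
Proof. exact: measurable_tmean. Qed.

Let indep_trunc m : mutually_independent P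
  (fun i : nat + nat => match i with inl k => V' k | inr k => trunc Z m k end).
Proof.
have := mutually_independent_comp
  (f := fun i : nat + nat => match i with inl _ => clamp 1 | inr _ => clamp m.+1%:R end) _ VZ.
rewrite (_ : (fun i : nat + nat => _ \o _) =
  (fun i : nat + nat => match i with inl k => V' k | inr k => trunc Z m k end)).
  by apply => -[_|_]; exact: measurable_clamp.
by apply/funext => -[k|k].
Qed.

Let lawV' (k : nat) (A : set R) : measurable A ->
  P (V' k @^-1` A) = beta_law (1 - alpha) (theta + k.+1%:R * alpha) A.
Proof.
move=> mA; transitivity (P (V k @^-1` (clamp 1 @^-1` A))) => //.
rewrite lawV; last exact: (measurable_pre (measurable_clamp 1)).
rewrite /beta_law (_ : clamp 1 @^-1` A `&` _ = A `&` `]0, 1[%classic)//.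
by apply/seteqP; split => x /= [Ax]; rewrite in_itv /= => /andP[x0 x1]; split;
  move: Ax; rewrite /preimage /= ?clamp_id ?(ltW x0) ?(ltW x1) ?x0.
Qed.

Let lawtrunc m (k : nat) (A : set R) : measurable A ->
  P (trunc Z m k @^-1` A) = P (trunc Z m 0 @^-1` A).
Proof.
move=> mA; have mc := measurable_pre (measurable_clamp m.+1%:R) mA.
by transitivity (P (Z k @^-1` (clamp m.+1%:R @^-1` A))) => //; rewrite lawZ// -(lawZ 0%N).
Qed.

Definition moment : R := Rintegral eta setT (fun x => Num.max 0 x `^ alpha).

Lemma integrable_moment : eta.-integrable setT (EFin \o (fun x : R => Num.max 0 x `^ alpha)).
Proof.
apply/integrableP; split.
  apply/measurable_EFinP.
  exact: (measurableT_comp (measurable_powR alpha) measurable_max0).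
rewrite (_ : integral _ _ _ = \int[eta]_(x in `[0%R, +oo[) (x `^ alpha)%:E)%E//.
rewrite [RHS]integral_mkcond; apply: eq_integral => x _ /=; rewrite patchE.
case: ifPn => [|/negP h].
  rewrite inE /= in_itv /= andbT => x0.
  by rewrite (max_idPr x0) ger0_norm// powR_ge0.
rewrite (max_idPl _); last first.
  by rewrite leNgt; apply/negP => x0; apply: h; rewrite inE /= in_itv /= andbT ltW.
by rewrite powR0 ?gt_eqF// normr0.
Qed.

Definition Phi (z : R[i]) : R[i] := cE eta (fun x => cpowr (z + (Num.max 0 x)%:C) alpha).

(** Subadditivity yields a majorant common to all truncation levels; it is integrable by the moment
    assumption on [eta]. *)
Lemma cpowr_growth (z : R[i]) (x y : R) : 0 <= y -> y <= Num.max 0 x ->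
  cmod (cpowr (z + y%:C) alpha) <= cmod z `^ alpha + Num.max 0 x `^ alpha.
Proof.
move=> y0 yx; rewrite cmod_cpowr.
apply: le_trans (_ : (cmod z + Num.max 0 x) `^ alpha <= _); last first.
  by apply: powR_subadditive; rewrite ?cmod_ge0// (le_trans y0).
have m0 : 0 <= Num.max 0 x by exact: le_trans yx.
apply: ge0_ler_powR; rewrite ?nnegrE ?cmod_ge0 ?addr_ge0 ?cmod_ge0 ?(ltW a0)//.
by apply: le_trans (ler_cmodD _ _) _; rewrite lerD2l cmod_real ger0_norm.
Qed.

Lemma integrable_growth (z : R[i]) :
  eta.-integrable setT (EFin \o (fun x : R => cmod z `^ alpha + Num.max 0 x `^ alpha)).
Proof.
have := integrableD measurableT (integrable_cst_fun eta (cmod z `^ alpha)) integrable_moment.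
by [].
Qed.

Let Phi_trunc m z := cE eta (fun x => cpowr (z + (clamp m.+1%:R x)%:C) alpha).

Let mPhi_trunc m z : 0 < complex.Im z ->
  cmeasurable (fun x => cpowr (z + (clamp m.+1%:R x)%:C) alpha).
Proof.
by move=> z0; apply: (cmeasurable_comp (cpowr_shift_measurable _ z0)); exact: measurable_clamp.
Qed.

Let Phi_trunc_cvg z : 0 < complex.Im z -> ccvg (Phi_trunc ^~ z) (Phi z).
Proof.
move=> z0; apply: (cE_dominated _ (integrable_growth z)) => [m|m x|x].
- exact: mPhi_trunc.
- by apply: cpowr_growth; [exact: clamp_ge0|exact: clamp_le_max0].
- apply: ccvg_cpowr_shift => //; apply/cvgrPdist_le => e e0.
  exists (Num.truncn x) => // m /= xm; rewrite clampE ?subrr ?normr0 ?(ltW e0)//.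
  by rewrite (le_trans (ltW (truncnS_gt x)))// ler_nat.
Qed.

Lemma Phi_gt0 z : 0 < complex.Im z -> 0 < complex.Im (Phi z).
Proof.
move=> z0; apply: (Im_cE_cpowr_gt0 measurable_max0 alpha01 z0 (integrable_growth z)) => x.
by apply: cpowr_growth => //; rewrite le_max lexx.
Qed.

Let Phi_truncE m z : 0 < complex.Im z ->
  cE P (fun w => cpowr (z + (trunc Z m 0 w)%:C) alpha) = Phi_trunc m z.
Proof.
move=> z0.
apply: (cE_same_law (X := Z 0%N) (X' := id) (k := cmod z `^ alpha + m.+1%:R `^ alpha)
  (f := fun x => cpowr (z + (clamp m.+1%:R x)%:C) alpha)) => //.
- by move=> A mA; rewrite lawZ.
- exact: mPhi_trunc.
- move=> x; have := @cpowr_growth z m.+1%:R (clamp m.+1%:R x) (clamp_ge0 _ _).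
  by rewrite (max_idPr _)//; apply; exact: clamp_le.
Qed.

Let Y (z : R[i]) (w : T) := mean_transform V' Z (- theta) z w.

Let mtheta_lt0 : - theta < 0. Proof. by rewrite oppr_lt0. Qed.

Let mM m z : 0 < complex.Im z ->
  cmeasurable (fun w => cpowr (z + (bmean V' (trunc Z m) 0 w)%:C) (- theta)).
Proof.
move=> z0; apply: (cmeasurable_comp (cpowr_shift_measurable _ z0)).
exact: (measurable_bmean mV' (mtrunc m) V'01 (trunc_bounds Z m)).
Qed.

Let mY z : 0 < complex.Im z -> cmeasurable (Y z).
Proof.
by move=> z0; apply: (cmeasurable_cvg (fun m => mM m z0)) => w; exact: mean_transform_cvg.
Qed.

Lemma mean_transformE z : 0 < complex.Im z -> cE P (Y z) = cpowr (Phi z) (- (theta / alpha)).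
Proof.
move=> z0.
have h1 : ccvg (fun m => cE P (fun w => cpowr (z + (bmean V' (trunc Z m) 0 w)%:C) (- theta))) (cE P (Y z)).
  apply: (cE_dominated _ (integrable_cst_fun P (complex.Im z `^ (- theta)))) => [m|m w|w].
  - exact: mM.
  - by apply: cpowr_norm_le; rewrite ?Im_shift// ltW.
  - exact: mean_transform_cvg.
have h2 : ccvg (fun m => cpowr (Phi_trunc m z) (- (theta / alpha))) (cpowr (Phi z) (- (theta / alpha))).
  apply: ccvg_cpowr; last exact: Phi_trunc_cvg.
    move=> m; apply: (Im_cE_cpowr_gt0 (measurable_clamp _) alpha01 z0 (integrable_growth z)) => x.
    by apply: cpowr_growth; [exact: clamp_ge0|exact: clamp_le_max0].
  by rewrite Im_neq0// Phi_gt0.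
apply: (ccvg_unique h1); congr ccvg : h2; apply/funext => m.
rewrite -Phi_truncE//; apply/esym.
apply: (bounded_identity (B := m.+1%:R) (P := P) alpha01 theta0) => //.
- by move=> n w; exact: trunc_bounds.
- by move=> k A; exact: lawtrunc.
Qed.

Let A := finite_mean V' Z.

Let mA : measurable A.
Proof.
have -> : A = \bigcup_K \bigcap_N [set w | S N w <= K%:R].
  apply/seteqP; split => w.
    by move=> [K HK]; exists K => // N _; exact: HK.
  by move=> [K _ HK]; exists K => N; exact: HK.
apply: bigcup_measurable => K _; apply: bigcap_measurable => // N _.
have := measurable_pre (mS N) (measurable_itv `]-oo, K%:R]%R).
congr measurable; apply/seteqP; split => w /=; by rewrite in_itv.
Qed.

Let moment_ge0 : 0 <= moment.
Proof. by apply: Rintegral_ge0 => x _; exact: powR_ge0. Qed.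

Let cmod_Phi_le (z : R[i]) : 0 < complex.Im z -> cmod (Phi z) <= cmod z `^ alpha + moment.
Proof.
move=> z0; have bd x : cmod (cpowr (z + (Num.max 0 x)%:C) alpha) <= cmod z `^ alpha + Num.max 0 x `^ alpha.
  by apply: cpowr_growth => //; rewrite le_max lexx.
have mc : cmeasurable (fun x : R => cpowr (z + (Num.max 0 x)%:C) alpha).
  exact: (cmeasurable_comp (cpowr_shift_measurable _ z0) measurable_max0).
apply: le_trans (cmod_cE_le mc (integrable_growth z) bd) _.
rewrite RintegralD//; first by rewrite Rint_cst.
  exact: (integrable_cst_fun eta).
exact: integrable_moment.
Qed.

(** Evaluation at $z=x+i$: the transform vanishes off [A] and is at most $x^{-\theta}$ on it, while
    the identity gives its expectation the modulus $|\Phi(z)|^{-\theta/\alpha}$ with $|\Phi(z)|\le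
    x^\alpha+1+$ [moment]. The two sides have the same order as $x\to\infty$, so no mass can be
    missing. *)
Let finite_mean_lower (x : R) : 0 < x ->
  (x `^ alpha + (1 + moment)) `^ (- (theta / alpha)) <= x `^ (- theta) * fine (P A).
Proof.
move=> x0; pose z : R[i] := Complex x 1.
have z0 : 0 < complex.Im z by exact: ltr01.
have q0 : 0 < theta / alpha by rewrite divr_gt0.
have cz : cmod z <= x + 1.
  have -> : z = x%:C + Complex 0 1 by apply: eq_ReIm; rewrite /= ?addr0 ?add0r.
  apply: le_trans (ler_cmodD _ _) _; rewrite cmod_real gtr0_norm// lerD2l.
  by rewrite /cmod /= expr0n expr1n add0r sqrtr1.
have PA : 0 < cmod (Phi z) by rewrite cmod_gt0 Im_neq0// Phi_gt0.
have up : cmod (Phi z) <= x `^ alpha + (1 + moment).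
  apply: le_trans (cmod_Phi_le z0) _; rewrite addrA lerD2r.
  apply: le_trans (_ : (x + 1) `^ alpha <= _).
    by apply: ge0_ler_powR; rewrite ?nnegrE ?cmod_ge0 ?addr_ge0 ?(ltW a0) ?(ltW x0).
  by have := powR_subadditive (ltW x0) ler01 alpha01; rewrite powR1.
apply: le_trans (_ : cmod (Phi z) `^ (- (theta / alpha)) <= _).
  rewrite !powRN lef_pV2 ?posrE ?powR_gt0//; last exact: lt_le_trans up.
  by apply: ge0_ler_powR; rewrite ?nnegrE ?(ltW q0) ?(ltW PA)// (le_trans (ltW PA)).
rewrite -cmod_cpowr -mean_transformE//.
have -> : x `^ (- theta) * fine (P A) = Rintegral P setT (fun w => x `^ (- theta) * \1_A w).
  rewrite RintegralZl//; last by apply: integrable_indic => //; rewrite setIT.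
  by congr (_ * _); rewrite /Rintegral integral_indic// setIT.
apply: cmod_cE_le; first exact: mY.
  by apply: integrable_Zl; apply: integrable_indic => //; rewrite setIT.
move=> w; rewrite /Y /mean_transform indicE; case: ifPn => [/set_mem Aw|_]; last first.
  by rewrite cmod0 mulr0.
rewrite mulr1; apply: cpowr_le => //; last exact: ltW.
apply: le_trans (Re_le_cmod _); rewrite cReD /= lerDl.
have cv := bmean_trunc_cvg V'01 Aw.
apply: (cvgr_to_ge cv); apply: nearW => m.
by have /andP[] := bmean_bounds V'01 (trunc_bounds Z m) 0 w.
Qed.

Let finite_mean_as : P A = 1%E.
Proof.
have fA : P A \is a fin_num by apply: fin_num_measure; exact: mA.
suff h : 1 <= fine (P A).
  have h' : (1 <= P A)%E by rewrite -(fineK fA) lee_fin.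
  by apply/eqP; rewrite eq_le h' probability_le1.
(* At $x=(n+1)^{1/\alpha}$ the lower bound divided by $x^{-\theta}$ is $u_n^{-\theta/\alpha}$. *)
pose u (n : nat) : R := 1 + (1 + moment) * n.+1%:R^-1.
have u1 : u n @[n --> \oo] --> (1 : R).
  rewrite -[X in _ --> X]addr0 -(mulr0 (1 + moment)); apply: cvgD; first exact: cvg_cst.
  by apply: cvgM; [exact: cvg_cst|exact: cvg_harmonic].
have q0 : 0 < theta / alpha by rewrite divr_gt0.
have := cvg_seq_comp (h := fun y => y `^ (- (theta / alpha)))
  (is_derive_continuous (is_derive1_powR (- (theta / alpha)) (@ltr01 R))) u1.
rewrite powR1 => cv; apply: (cvgr_to_le cv); apply: nearW => n.
have n0 : 0 < n.+1%:R :> R by [].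
have := finite_mean_lower (powR_gt0 alpha^-1 n0).
rewrite -!powRrM mulVf ?gt_eqF// powRr1 ?(ltW n0)//.
have -> : alpha^-1 * - theta = - (theta / alpha) by rewrite mulrN mulrC.
have nq : 0 < n.+1%:R `^ (- (theta / alpha)) :> R by exact: powR_gt0.
move=> h; rewrite -(ler_pM2l nq); apply: le_trans h.
have u0 : 0 <= u n by rewrite /u addr_ge0// mulr_ge0 ?addr_ge0 ?invr_ge0.
rewrite -powRM ?(ltW n0)// (_ : n.+1%:R * u n = n.+1%:R + (1 + moment))//.
by rewrite /u mulrDr mulr1 mulrCA divff ?mulr1// gt_eqF.
Qed.

Let V01_as k : \forall w \ae P, 0 <= V k w <= 1.
Proof.
have mI : measurable (`[0, 1]%classic : set R) by exact: measurable_itv.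
have : P (V k @^-1` `[0%R, 1%R]%classic) = 1%E.
  (* The value 1 is read off from [lawV] at [setT]: both sets have the same trace on the open unit
     interval, so no beta integral is evaluated. *)
  rewrite lawV// -(@probability_setT _ _ _ P) -(preimage_setT (V k)) lawV//.
  rewrite /beta_law (_ : `[0, 1]%classic `&` _ = setT `&` `]0, 1[%classic)//.
  rewrite setTI; apply/setIidr => x /=; rewrite !in_itv /= => /andP[x0 x1].
  by rewrite !ltW.
move/(ae_of_probability1 (measurable_pre (mV k) mI)); apply: filterS => w.
by rewrite /preimage /= in_itv.
Qed.

Let Z0_as k : \forall w \ae P, 0 <= Z k w.
Proof.
have mI : measurable (`[0, +oo[%classic : set R) by exact: measurable_itv.
have : P (Z k @^-1` `[0%R, +oo[%classic) = 1%E by rewrite lawZ.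
move/(ae_of_probability1 (measurable_pre (mZ k) mI)); apply: filterS => w.
by rewrite /preimage /= in_itv /= andbT.
Qed.

Lemma measurable_py_mean : measurable_fun setT (py_mean V Z).
Proof.
rewrite (_ : py_mean V Z = fun w => limn (fun n => tmean V Z n 0 w)).
  by apply: measurable_limn => n; exact: measurable_tmean.
by apply/funext => w; congr (limn _); apply/funext => n; rewrite tmeanE.
Qed.

(** Almost surely the mean is finite and clamping changes neither sticks nor atoms, so the modified
    transform agrees with that of [py_mean]. *)
Theorem unbounded_identity z : 0 < complex.Im z ->
  stieltjes P theta z (py_mean V Z) = cpowr (Phi z) (- (theta / alpha)).
Proof.
move=> z0; rewrite -mean_transformE//.
transitivity (cE P (fun w => cpowr (z + (py_mean V Z w)%:C) (- theta))) => //.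
apply: cE_ae.
- exact: (cmeasurable_comp (cpowr_shift_measurable _ z0) measurable_py_mean).
- exact: mY.
- have h1 := ae_of_probability1 mA finite_mean_as.
  have h2 := ae_foralln V01_as; have h3 := ae_foralln Z0_as.
  apply: filterS3 h1 h2 h3 => w Aw Vw Zw.
  rewrite /Y /mean_transform (mem_set Aw); congr (cpowr (z + _%:C) _).
  congr (limn _); apply/funext => n; rewrite tmeanE; apply: eq_bigr => k _.
  rewrite /upart (max_idPr (Zw k)); congr (_ * _); rewrite /stick /V' clamp_id//; congr (_ * _).
  by apply: eq_bigr => j _; rewrite clamp_id.
Qed.

End UnboundedIdentity.

(** * Boundary values *)

Section BoundaryValue.
Context {R : realType}.
Variables (alpha : R) (eta : probability R R) (t : R).
Hypotheses (alpha01 : 0 < alpha < 1) (t0 : 0 <= t)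
  (eta0 : eta `[0%R, +oo[ = 1%E)
  (eta_alpha : (\int[eta]_(x in `[0%R, +oo[) (x `^ alpha)%:E < +oo)%E).

Let a0 : 0 < alpha. Proof. by case/andP: alpha01. Qed.
Let a1 : alpha < 1. Proof. by case/andP: alpha01. Qed.

Let below : R -> R := (fun x => (t - x) `^ alpha) \_ `[0, t[.
Let above : R -> R := (fun x => (x - t) `^ alpha) \_ `]t, +oo[.
Let growth (x : R) : R := t `^ alpha + Num.max 0 x `^ alpha.

Let igrowth : eta.-integrable setT (EFin \o growth).
Proof.
have := integrable_growth alpha01 eta_alpha t%:C.
by rewrite cmod_real ger0_norm.
Qed.

Let mbelow : measurable_fun setT below.
Proof.
apply/(measurable_restrictT _ (measurable_itv _)); apply: measurable_funTS.
apply: (measurableT_comp (measurable_powR alpha)).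
by apply: measurable_funB => //; exact: measurable_cst.
Qed.

Let mabove : measurable_fun setT above.
Proof.
apply/(measurable_restrictT _ (measurable_itv _)); apply: measurable_funTS.
apply: (measurableT_comp (measurable_powR alpha)).
by apply: measurable_funB => //; exact: measurable_cst.
Qed.

Let belowE (x : R) : 0 <= x -> below x = if x < t then (t - x) `^ alpha else 0.
Proof.
by move=> x0; rewrite /below patchE mem_setE in_itv /= x0.
Qed.

Let aboveE (x : R) : above x = if t < x then (x - t) `^ alpha else 0.
Proof. by rewrite /above patchE mem_setE in_itv /= andbT. Qed.

Let below_bounds x : 0 <= below x <= growth x.
Proof.
rewrite /below patchE mem_setE in_itv /= /growth; case: ifPn => [/andP[x0 xt]|_].
  rewrite powR_ge0 /=; apply: le_trans (_ : t `^ alpha <= _); last by rewrite lerDl powR_ge0.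
  by apply: ge0_ler_powR; rewrite ?nnegrE ?(ltW a0) ?subr_ge0 ?(ltW xt)// gerBl.
by rewrite lexx addr_ge0// powR_ge0.
Qed.

Let above_bounds x : 0 <= above x <= growth x.
Proof.
rewrite aboveE /growth; case: ifPn => [tx|_]; last by rewrite lexx addr_ge0// powR_ge0.
have x0 : 0 <= x by rewrite (le_trans t0)// ltW.
rewrite powR_ge0 /= (max_idPr x0); apply: le_trans (_ : x `^ alpha <= _); last by rewrite lerDr powR_ge0.
by apply: ge0_ler_powR; rewrite ?nnegrE ?(ltW a0) ?subr_ge0 ?(ltW tx)// gerBl.
Qed.

Let ibelow : eta.-integrable setT (EFin \o below).
Proof.
apply: dominated_integrable_fun mbelow igrowth _ => x.
by have /andP[h1 h2] := below_bounds x; rewrite ger0_norm.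
Qed.

Let iabove : eta.-integrable setT (EFin \o above).
Proof.
apply: dominated_integrable_fun mabove igrowth _ => x.
by have /andP[h1 h2] := above_bounds x; rewrite ger0_norm.
Qed.

Let A_minusE : A_minus eta alpha t = Rintegral eta setT below.
Proof. exact: Rintegral_mkcond. Qed.

Let A_plusE : A_plus eta alpha t = Rintegral eta setT above.
Proof. exact: Rintegral_mkcond. Qed.

Lemma parg_real (u : R) : u != 0 -> parg u%:C = if u < 0 then pi else 0.
Proof. by move=> u0; rewrite parg_atan//= mul0r atan0 add0r. Qed.

Let boundary (x : R) : R[i] := cpowr (Num.max 0 x - t)%:C alpha.

(** For $x<t$ the argument of $x-t$ is $\pi$, whence the factor $e^{i\alpha\pi}$ on [below]; for
    $x>t$ it is 0. *)
Let boundaryE (x : R) : 0 <= x ->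
  boundary x = Complex (cos (alpha * pi) * below x + above x) (sin (alpha * pi) * below x).
Proof.
move=> x0; rewrite /boundary (max_idPr x0) belowE// aboveE /cpowr cmod_real.
have [xt|tx|->] := ltgtP x t.
- rewrite parg_real ?subr_eq0 ?lt_eqF// subr_lt0 xt ltr0_norm ?subr_lt0// opprB addr0.
  by rewrite mulrC [in X in _ +i* X]mulrC.
- rewrite parg_real ?subr_eq0 ?gt_eqF// subr_lt0 ltNge (ltW tx) /= gtr0_norm ?subr_gt0//.
  by rewrite !mulr0 cos0 sin0 mulr1 add0r mulr0.
- by rewrite subrr normr0 powR0 ?gt_eqF// !mul0r !mulr0 addr0.
Qed.

Section Sequence.
Variable u : nat -> R.
Hypotheses (u0 : forall n, 0 < u n) (ucv : u n @[n --> \oo] --> 0).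

Let z n : R[i] := Complex (- t) (u n).

Let boundary_cvg x : ccvg (fun n => cpowr (z n + (Num.max 0 x)%:C) alpha) (boundary x).
Proof.
have cv : ccvg (fun n => z n + (Num.max 0 x)%:C) (Num.max 0 x - t)%:C.
  split; under eq_fun do rewrite ?cReD ?cImD /=; last by under eq_fun do rewrite addr0.
  by rewrite addrC; exact: cvg_cst.
have [e0|n0] := eqVneq (Num.max 0 x - t) 0.
  rewrite /boundary e0 in cv *.
  have -> : cpowr 0%:C alpha = 0 :> R[i].
    by rewrite /cpowr cmod0 powR0 ?gt_eqF// !mul0r.
  exact: ccvg_cpowr0.
apply: ccvg_cpowr => //; first by move=> n; rewrite Im_shift; exact: u0.
by apply: contra_neq n0 => /(congr1 (@complex.Re R)).
Qed.

Let mz n : cmeasurable (fun x : R => cpowr (z n + (Num.max 0 x)%:C) alpha).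
Proof.
exact: (cmeasurable_comp (cpowr_shift_measurable alpha (u0 n : 0 < complex.Im (z n))) measurable_max0).
Qed.

Let mboundary : cmeasurable boundary.
Proof. exact: cmeasurable_cvg mz boundary_cvg. Qed.

Lemma Phi_boundary : ccvg (fun n => Phi alpha eta (z n))
  (Complex (gamma_fn eta alpha t) (zeta_fn eta alpha t)).
Proof.
(* A bound on the heights gives one majorant for the whole sequence. *)
have [M HM] : exists M, forall n, u n <= M.
  have [M [_ HM]] := cvg_seq_bounded (cvgP _ ucv).
  have MM : M < M + 1 by rewrite ltrDl.
  by exists (M + 1) => n; apply: le_trans (ler_norm _) _; exact: (HM _ MM n I).
have M0 : 0 <= M by exact: le_trans (ltW (u0 0%N)) (HM 0%N).
have ig := integrable_growth alpha01 eta_alpha (t + M)%:C.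
have bd n x : cmod (cpowr (z n + (Num.max 0 x)%:C) alpha) <= cmod (t + M)%:C `^ alpha + Num.max 0 x `^ alpha.
  apply: le_trans (cpowr_growth alpha01 (z n) _ (lexx _)) _; first by rewrite le_max lexx.
  rewrite lerD2r; apply: ge0_ler_powR; rewrite ?nnegrE ?cmod_ge0 ?(ltW a0)//.
  have -> : z n = (- t)%:C + Complex 0 (u n) by apply: eq_ReIm; rewrite /= ?addr0 ?add0r.
  apply: le_trans (ler_cmodD _ _) _; rewrite !cmod_real normrN !ger0_norm ?addr_ge0//.
  by rewrite lerD2l /cmod /= expr0n add0r sqrtr_sqr ger0_norm// ltW.
have h := cE_dominated mz ig bd boundary_cvg.
suff -> : Complex (gamma_fn eta alpha t) (zeta_fn eta alpha t) = cE eta boundary by exact: h.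
transitivity (cE eta (fun x => Complex (cos (alpha * pi) * below x + above x) (sin (alpha * pi) * below x))).
  rewrite /cE /= RintegralD// ?RintegralZl//; last by apply: integrable_Zl.
  by rewrite /gamma_fn /zeta_fn A_minusE A_plusE.
apply: cE_ae => //.
  split => /=; last by apply: measurable_funM => //; exact: measurable_cst.
  by apply: measurable_funD => //; apply: measurable_funM => //; exact: measurable_cst.
have := ae_of_probability1 (measurable_itv _) eta0; apply: filterS => x.
by rewrite /= in_itv /= andbT => x0; rewrite boundaryE.
Qed.

End Sequence.

Let s0 : 0 < sin (alpha * pi).
Proof.
by apply: sin_gt0_pi; rewrite mulr_gt0 ?pi_gt0//= gtr_pMl ?pi_gt0.
Qed.

Lemma zeta_fn_ge0 : 0 <= zeta_fn eta alpha t.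
Proof.
rewrite /zeta_fn A_minusE mulr_ge0 ?(ltW s0)// Rintegral_ge0// => x _.
by have /andP[] := below_bounds x.
Qed.

Hypothesis sing : (\int[eta]_s sing_kernel alpha t s < +oo)%E.

Let no_atom : eta [set t] = 0%E.
Proof.
have ms : measurable_fun setT (sing_kernel alpha t).
  apply: measurable_fun_ifT.
  - by apply: measurable_fun_eqr => //; exact: measurable_cst.
  - exact: measurable_cst.
  - apply/measurable_EFinP; apply: (measurableT_comp (measurable_powR _)).
    by apply: measurableT_comp => //; apply: measurable_funB => //; exact: measurable_cst.
apply/eqP; rewrite eq_le measure_ge0 andbT leNgt; apply/negP => pt.
move: sing; rewrite ltNge => /negP; apply.
apply: le_trans (ge0_subset_integral eta (measurable_set1 t) measurableT ms _ _) => //.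
  rewrite (eq_integral (cst +oo%E)) => [|x]; last first.
    by rewrite inE /= => ->; rewrite /sing_kernel eqxx.
  by rewrite integral_cst// gt0_mulye.
by move=> x _; rewrite /sing_kernel; case: ifPn => // _; rewrite ?leey// lee_fin powR_ge0.
Qed.

(** As $\sin(\alpha\pi)>0$, a zero value would make [A_minus] and [A_plus] vanish, hence also the
    integral of [below + above], which on the half-line is positive except at the null point $t$. *)
Lemma boundary_neq0 : Complex (gamma_fn eta alpha t) (zeta_fn eta alpha t) != 0.
Proof.
apply/negP => /eqP[]; rewrite /gamma_fn /zeta_fn => g0 /eqP.
rewrite mulf_eq0 gt_eqF//= => /eqP Am; move: g0; rewrite Am mulr0 add0r => Ap.
have ba0 x : 0 <= below x + above x.
  by have /andP[h1 _] := below_bounds x; have /andP[h2 _] := above_bounds x; rewrite addr_ge0.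
have : Rintegral eta setT (fun x => below x + above x) = 0.
  by rewrite RintegralD// -A_minusE -A_plusE Am Ap addr0.
apply/eqP; rewrite gt_eqF//; apply: Rint_gt0 => //.
  exact: (integrableD measurableT ibelow iabove).
set D := _ @^-1` _.
have mD : measurable D.
  exact: (measurable_pre (measurable_funD mbelow mabove) (measurable_set1 0)).
have mP : measurable (~` `[0, +oo[%classic : set R) by apply: measurableC; exact: measurable_itv.
have sub : D `<=` ~` `[0, +oo[%classic `|` [set t].
  move=> x Dx; have [x0|xn] := leP 0 x; last first.
    by left => /=; rewrite in_itv /= andbT leNgt xn.
  right; move: Dx; rewrite /D /= belowE// aboveE; have [xt|tx|//] := ltgtP x t.
    by rewrite addr0 => /eqP; rewrite gt_eqF// powR_gt0// subr_gt0.
  by rewrite add0r => /eqP; rewrite gt_eqF// powR_gt0// subr_gt0.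
have : (eta D <= 0)%E.
  have mU := measurableU _ _ mP (measurable_set1 t).
  apply: (@le_trans _ _ (eta (~` (`[0, +oo[%classic : set R) `|` [set t]))).
    by apply: le_measure; rewrite ?inE.
  apply: le_trans (measureU2 _ _ _) _ => //.
  have pn : eta (~` `[0%R, +oo[%classic) = 0%E.
    by rewrite probability_setC ?eta0 ?subee//; exact: measurable_itv.
  by rewrite [X in (X + _)%E](pn : _ = 0%E) [X in (_ + X)%E](no_atom : _ = 0%E) adde0.
by move=> h; apply/eqP => D1; move: h; rewrite D1 lee_fin ler10.
Qed.

(** Since $\zeta_\alpha\ge0$, the correction for $\gamma_\alpha<0$ is $+\pi$. When $\gamma_\alpha=0$
    the value lies on the positive imaginary axis, where the convention of [atan_div] gives
    $\pi/2$. *)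
Lemma parg_boundary : parg (Complex (gamma_fn eta alpha t) (zeta_fn eta alpha t)) =
  atan_div (zeta_fn eta alpha t) (gamma_fn eta alpha t) + (if gamma_fn eta alpha t < 0 then pi else 0).
Proof.
rewrite /atan_div; case: eqVneq => [g0|gn0]; last by rewrite parg_atan//= zeta_fn_ge0.
have z0 : 0 < zeta_fn eta alpha t.
  rewrite lt_def zeta_fn_ge0 andbT; apply/negP => /eqP z0.
  by have := boundary_neq0; rewrite g0 z0 eqxx.
by rewrite z0 g0 ltxx parg_upper//= /uarg /= mul0r atan0 subr0 addr0.
Qed.

End BoundaryValue.

(** * The jump across the real axis *)

Section StieltjesInversion.
Context {R : realType} {d} {T : measurableType d} (P : probability T R).
Variables (X : T -> R) (theta t : R).
Hypotheses (theta0 : 0 < theta) (mX : measurable_fun setT X).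

Lemma stieltjes_conj (z : R[i]) : 0 < complex.Im z ->
  stieltjes P theta z^* X = (stieltjes P theta z X)^*.
Proof.
move=> z0; have m := cmeasurable_comp (cpowr_shift_measurable (- theta) z0) mX.
have cj w : cpowr (z^* + Complex (X w) 0) (- theta) = (cpowr (z + (X w)%:C) (- theta))^*.
  rewrite -cpowr_conj ?Im_shift//; congr cpowr.
  by apply: eq_ReIm; rewrite ?cReD ?cImD; case: (z) => a b /=; rewrite ?addr0.
have Re_conj (w : R[i]) : complex.Re w^* = complex.Re w by case: w.
have Im_conj (w : R[i]) : complex.Im w^* = - complex.Im w by case: w.
apply: eq_ReIm; rewrite ?Re_conj ?Im_conj.
  rewrite -[LHS]/(Rintegral P setT (fun w => complex.Re (cpowr (z^* + Complex (X w) 0) (- theta)))).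
  by apply: eq_Rintegral => w _; rewrite cj Re_conj.
rewrite -[LHS]/(Rintegral P setT (fun w => complex.Im (cpowr (z^* + Complex (X w) 0) (- theta)))).
transitivity (Rintegral P setT (fun w => -1 * complex.Im (cpowr (z + (X w)%:C) (- theta)))).
  by apply: eq_Rintegral => w _; rewrite cj Im_conj mulN1r.
rewrite RintegralZl//; first by rewrite mulN1r.
apply: (bounded_integrable (k := complex.Im z `^ (- theta)) P m.2) => w.
apply: le_trans (normr_Im_le _) _; apply: cpowr_norm_le; rewrite ?Im_shift//.
by rewrite oppr_le0 ltW.
Qed.

(** The two transforms are conjugate, so their difference is purely imaginary and the quotient is
    real already before the limit. *)
Lemma Delta_quotE (e : R) : 0 < e ->
  Delta_quot P theta X t e = (- (complex.Im (stieltjes P theta (Complex (- t) e) X) / pi))%:C.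
Proof.
move=> e0; rewrite /Delta_quot (_ : Complex (- t) (- e) = (Complex (- t) e)^*)//.
rewrite stieltjes_conj//; case: (stieltjes _ _ _ _) => a b /=.
have p0 : pi != 0 :> R by rewrite gt_eqF// pi_gt0.
have w0 : Complex 0 (2 * pi) != 0 :> R[i].
  by apply/negP => /eqP[] /eqP; rewrite mulf_eq0 (negPf p0) pnatr_eq0.
apply: (mulfI w0); rewrite mulVKf//.
generalize (pi : R) p0 => q q0; apply: eq_ReIm => /=; first by ring.
by field.
Qed.

End StieltjesInversion.

Theorem theorem5p1 (R : realType) (alpha theta : R) (eta : probability R R)
  (d : measure_display) (Omega : measurableType d) (P : probability Omega R)
  (V Z : nat -> Omega -> R) (t : R) :
  0 < alpha < 1 -> 0 < theta ->
  eta `[0%R, +oo[ = 1%E ->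
  (\int[eta]_(x in `[0%R, +oo[) (x `^ alpha)%:E < +oo)%E ->
  (forall k, measurable_fun setT (V k)) ->
  (forall k, measurable_fun setT (Z k)) ->
  mutually_independent P
    (fun i : nat + nat => match i with inl k => V k | inr k => Z k end) ->
  (forall (k : nat) (A : set R), measurable A ->
     P (V k @^-1` A) = beta_law (1 - alpha) (theta + k.+1%:R * alpha) A) ->
  (forall (k : nat) (A : set R), measurable A -> P (Z k @^-1` A) = eta A) ->
  Theta_set alpha eta t ->
  (complex.Re (Delta_quot P theta (py_mean V Z) t e) @[e --> 0^'+] -->
     (pi * (zeta_fn eta alpha t ^+ 2 + gamma_fn eta alpha t ^+ 2)
            `^ (theta / (2 * alpha)))^-1
     * sin (rho_fn eta alpha theta t))
  /\ (complex.Im (Delta_quot P theta (py_mean V Z) t e) @[e --> 0^'+] --> 0).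
Proof.
move=> alpha01 theta0 eta0 eta_alpha mV mZ VZ lawV lawZ [[t0 sing] _].
case/andP: (alpha01) => a0 _.
have mX := measurable_py_mean mV mZ.
set L : R[i] := Complex (gamma_fn eta alpha t) (zeta_fn eta alpha t).
have L0 : L != 0 by exact: boundary_neq0.
(* The modulus of [L] is a square root, which halves the exponent to $\theta/(2\alpha)$; the angle
   of the power is minus [rho_fn]. *)
have Im_limit : complex.Im (cpowr L (- (theta / alpha))) =
    - ((zeta_fn eta alpha t ^+ 2 + gamma_fn eta alpha t ^+ 2) `^ (theta / (2 * alpha)))^-1
      * sin (rho_fn eta alpha theta t).
  have -> : rho_fn eta alpha theta t = theta / alpha * parg L.
    rewrite /L parg_boundary// /rho_fn mulrDr; congr (_ + _).
    by case: ifP => _; [rewrite [RHS]mulrC mulrA|rewrite mulr0].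
  rewrite [LHS]/= [in sin _]mulNr sinN mulrN powRN [RHS]mulNr; congr (- (_^-1 * _)).
  have s0 : 0 <= zeta_fn eta alpha t ^+ 2 + gamma_fn eta alpha t ^+ 2 by rewrite addr_ge0 ?sqr_ge0.
  rewrite /cmod /= addrC -powR12_sqrt// -powRrM; congr (_ `^ _).
  by rewrite invfM mulrCA.
(* Sequences are used because dominated convergence, and with it [Phi_boundary], is sequential. *)
have key (u : nat -> R) : (forall n, 0 < u n) -> u n @[n --> \oo] --> 0 ->
    complex.Re (Delta_quot P theta (py_mean V Z) t (u n)) @[n --> \oo] -->
    (pi * (zeta_fn eta alpha t ^+ 2 + gamma_fn eta alpha t ^+ 2)
            `^ (theta / (2 * alpha)))^-1 * sin (rho_fn eta alpha theta t).
  move=> u0 ucv.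
  have cv : ccvg (fun n => cpowr (Phi alpha eta (Complex (- t) (u n))) (- (theta / alpha)))
      (cpowr L (- (theta / alpha))).
    apply: ccvg_cpowr => //; last exact: Phi_boundary.
    by move=> n; apply: Phi_gt0 => //; exact: u0.
  have -> : (pi * (zeta_fn eta alpha t ^+ 2 + gamma_fn eta alpha t ^+ 2)
      `^ (theta / (2 * alpha)))^-1 * sin (rho_fn eta alpha theta t) =
      - (complex.Im (cpowr L (- (theta / alpha))) / pi).
    by rewrite Im_limit mulNr mulNr opprK invfM -mulrA mulrC.
  have -> : (fun n => complex.Re (Delta_quot P theta (py_mean V Z) t (u n))) =
      (fun n => - (complex.Im (cpowr (Phi alpha eta (Complex (- t) (u n))) (- (theta / alpha))) / pi)).
    apply/funext => n; rewrite Delta_quotE// -(unbounded_identity alpha01 theta0 eta0 eta_alpha mV mZ VZ lawV lawZ)//.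
    exact: u0.
  by apply: cvgN; apply: cvgM; [exact: cv.2|exact: cvg_cst].
split.
  by apply/cvg_at_rightP => u [u0 ucv]; exact: key.
apply/cvg_at_rightP => u [u0 _].
rewrite (_ : (fun n => complex.Im _) = fun=> 0); first exact: cvg_cst.
by apply/funext => n; rewrite Delta_quotE.
Qed.
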